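(* Let $x:M^2\to\mathbb{R}^n$ be a super-conformal minimal surface (a conformal minimal immersion of a connected Riemann surface with $x_{zz}\cdot x_{zz}\equiv0$). Any adjoint transform $\hat x$ of $x$ is given by $$\hat x=x-\frac{x\cdot x_{\bar z}+\bar g}{x_z\cdot x_{\bar z}}\,x_z-\frac{x\cdot x_z+g}{x_z\cdot x_{\bar z}}\,x_{\bar z}\qquad( * )$$ for some meromorphic $g$. Conversely, any $\hat x$ given by $( * )$ for some meromorphic $g$ is an adjoint transform of $x$.
   Context: The dot product is the Euclidean inner product of $\mathbb{R}^n$ extended complex bilinearly to $\mathbb{C}^n$; $z$ is a local complex coordinate of $M$. A conformal minimal immersion satisfies $x_z\cdot x_z=0$, $x_{z\bar z}=0$, $x_z\cdot x_{\bar z}>0$. In a coordinate, $g$ is a meromorphic function; globally $g\,dz$ is a meromorphic 1-form on $M$. By convention poles of $g$ are allowed (there $\hat x=\infty$), as is $g\equiv\infty$, for which $\hat x$ is the constant map $\infty$ (the degenerate dual surface). Maps into $\mathbb{R}^n\cup\{\infty\}$ are regarded as maps into $S^n$ by inverse stereographic projection. Adjoint transforms are defined as follows. Let $\mathbb{R}^{n+2}_1$ be $\mathbb{R}^{n+2}$ with $\langle Y,Y\rangle=\sum_{i=1}^{n+1}Y_i^2-Y_{n+2}^2$, extended complex bilinearly, and identify $S^n$ with the projectivized light cone by $y\leftrightarrow[(y,1)]$. For a conformal immersion $y:M\to S^n$ with local coordinate $z$, the canonical lift $Y$ is the (forward) light-cone-valued lift, $y=[Y]$, with $\langle Y_z,Y_{\bar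 z}\rangle=\frac12$. Let $V=\mathrm{span}\{Y,\mathrm{Re}\,Y_z,\mathrm{Im}\,Y_z,Y_{z\bar z}\}$, $V^\perp$ its orthogonal complement with normal connection $D$, and $N\in V$ the unique section with $\langle N,N\rangle=0$, $\langle N,Y\rangle=-1$, $\langle N,Y_z\rangle=0$. The equation $Y_{zz}=-\frac s2Y+\kappa$ defines the complex function $s$ and $\kappa\in\Gamma(V^\perp\otimes\mathbb{C})$; $y$ is Willmore if $D_{\bar z}D_{\bar z}\kappa+\frac{\bar s}2\kappa=0$ (minimal surfaces in $\mathbb{R}^n$ are Willmore). An adjoint transform of a Willmore immersion $y:M\to S^n$ is a smooth map $\hat y:M\to S^n$ such that on an open dense subset, with respect to local coordinates, $\hat y=[\hat Y]$ with $\hat Y=\frac12|\mu|^2Y+\bar\mu Y_z+\mu Y_{\bar z}+N$ for a smooth local complex function $\mu$ satisfying $\mu_z-\frac12\mu^2-s=0$ and $\langle\eta,\eta\rangle=0$, where $\eta=D_{\bar z}\kappa+\frac{\bar\mu}2\kappa$. An adjoint transform of $x$ means one of its image in $S^n$ under inverse stereographic projection. *)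

(* Defs.v *)
From HB Require Import structures.
From mathcomp Require Import all_boot all_order all_algebra.
From mathcomp Require Import all_classical all_reals all_analysis.
From mathcomp Require Export complex.
Set Implicit Arguments.
Unset Strict Implicit.
Unset Printing Implicit Defensive.
Import Order.TTheory GRing.Theory Num.Theory numFieldNormedType.Exports.
Local Open Scope classical_set_scope.
Local Open Scope ring_scope.

(* [R[i]] packaged as an abstract numeric field, so that the topology and the
   notion of derivative that the library attaches to every numeric field apply;
   [derivable f z 1] for [f : C R -> C R] is complex differentiability. *)
Definition C (R : realType) : numClosedFieldType := R[i].

Definition toC (R : realType) (t : R) : C R := Complex t 0.
Definition imag (R : realType) : C R := Complex 0 1.
Definition re (R : realType) (z : C R) : R := complex.Re z.
Definition im (R : realType) (z : C R) : R := complex.Im z.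
Definition cvec (R : realType) (m : nat) (v : 'rV[R]_m) : 'rV[C R]_m :=
  map_mx (@toC R) v.

Definition dot (K : comNzRingType) (m : nat) (u v : 'rV[K]_m) : K :=
  \sum_(i < m) u 0 i * v 0 i.

(* The last coordinate is the time-like one. *)
Definition mink (K : comNzRingType) (m : nat) (u v : 'rV[K]_(m + 1)) : K :=
  dot (lsubmx u) (lsubmx v) - u 0 (rshift m ord0) * v 0 (rshift m ord0).

Section Calculus.
Variable R : realType.

Definition line (T : Type) (f : C R -> T) (z v : C R) : R -> T :=
  fun t => f (z + v * toC t).

Definition partial (v : C R) (f : C R -> R) (z : C R) : R :=
  derive1 (line f z v) 0.

(* The variables [u, v] of [z = u + iv] correspond to the directions
   [1] and [imag R]. *)
Fixpoint Ck (k : nat) (U : set (C R)) (f : C R -> R) : Prop :=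
  match k with
  | 0 => forall z, U z -> {for z, continuous f}
  | k'.+1 =>
      (forall z, U z ->
         derivable (line f z 1) 0 1 /\ derivable (line f z (imag R)) 0 1) /\
      Ck k' U (partial 1 f) /\ Ck k' U (partial (imag R) f)
  end.

Definition smooth (U : set (C R)) (f : C R -> R) : Prop :=
  forall k, Ck k U f.

Definition smoothC (U : set (C R)) (F : C R -> C R) : Prop :=
  smooth U (fun z => re (F z)) /\ smooth U (fun z => im (F z)).

Definition smoothV (m : nat) (U : set (C R)) (F : C R -> 'rV[C R]_m) : Prop :=
  forall j, smoothC U (fun z => F z 0 j).

Definition partialC (v : C R) (F : C R -> C R) (z : C R) : C R :=
  toC (partial v (fun w => re (F w)) z) +
  imag R * toC (partial v (fun w => im (F w)) z).

Definition dz (F : C R -> C R) (z : C R) : C R :=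
  (partialC 1 F z - imag R * partialC (imag R) F z) / 2.

Definition dzb (F : C R -> C R) (z : C R) : C R :=
  (partialC 1 F z + imag R * partialC (imag R) F z) / 2.

Definition Dz (m : nat) (F : C R -> 'rV[C R]_m) (z : C R) : 'rV[C R]_m :=
  \row_j dz (fun w => F w 0 j) z.

Definition Dzb (m : nat) (F : C R -> 'rV[C R]_m) (z : C R) : 'rV[C R]_m :=
  \row_j dzb (fun w => F w 0 j) z.

Definition holomorphic (U : set (C R)) (f : C R -> C R) : Prop :=
  forall z, U z -> derivable f z 1.

(* Functions into the Riemann sphere: [None] is the value oo. *)
Definition fin (g : C R -> option (C R)) (z : C R) : C R := odflt 0 (g z).

Definition fin_holo_at (g : C R -> option (C R)) (z : C R) : Prop :=
  g z <> None /\ derivable (fin g) z 1.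

Definition pole (g : C R -> option (C R)) (z : C R) : Prop :=
  [/\ g z = None,
      \forall w \near z^', fin_holo_at g w &
      forall B : R, \forall w \near z^', toC B <= `|fin g w| ].

Definition meromorphic (U : set (C R)) (g : C R -> option (C R)) : Prop :=
  forall z, U z -> (\forall w \near z, fin_holo_at g w) \/ pole g z.

End Calculus.

(* [chart_map] and [chart_inv] are only meaningful on [chart_dom] and on its
   image, respectively. *)
Record chart (R : realType) (M : topologicalType) := Chart {
  chart_dom : set M;
  chart_map :> M -> C R;
  chart_inv : C R -> M }.

Definition chart_img (R : realType) (M : topologicalType) (c : chart R M) :
  set (C R) := c @` chart_dom c.

Definition is_chart (R : realType) (M : topologicalType) (c : chart R M) :=
  [/\ open (chart_dom c),
      open (chart_img c),
      forall p, chart_dom c p -> {for p, continuous c},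
      forall z, chart_img c z -> {for z, continuous (chart_inv c)} &
      forall p, chart_dom c p -> chart_inv c (c p) = p ].

Definition transition (R : realType) (M : topologicalType) (c d : chart R M) :
  C R -> C R := fun z => d (chart_inv c z).

(* Second countability need not be required: for connected surfaces it follows
   from the other axioms (Rado). *)
Record riemannSurface (R : realType) := RiemannSurface {
  carrier :> topologicalType;
  atlas : set (chart R carrier);
  surface_hausdorff : hausdorff_space carrier;
  atlas_chart : forall c, atlas c -> is_chart c;
  atlas_cover : forall p, exists2 c, atlas c & chart_dom c p;
  atlas_compat : forall c d, atlas c -> atlas d ->
    holomorphic (c @` (chart_dom c `&` chart_dom d)) (transition c d) }.

Section Surfaces.
Variables (R : realType) (M : riemannSurface R).

(* Complexified coordinate expression of a vector-valued map. *)
Definition loc (m : nat) (c : chart R M) (f : M -> 'rV[R]_m) :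
  C R -> 'rV[C R]_m := fun z => cvec (f (chart_inv c z)).

Definition smooth_map (m : nat) (f : M -> 'rV[R]_m) : Prop :=
  forall c, atlas c -> smoothV (chart_img c) (loc c f).

Definition conformal_immersion (m : nat) (f : M -> 'rV[R]_m) : Prop :=
  smooth_map f /\
  forall c, atlas c -> forall z, chart_img c z ->
    dot (Dz (loc c f) z) (Dz (loc c f) z) = 0 /\
    0 < dot (Dz (loc c f) z) (Dzb (loc c f) z).

Definition conformal_minimal_immersion (m : nat) (f : M -> 'rV[R]_m) : Prop :=
  conformal_immersion f /\
  forall c, atlas c -> forall z, chart_img c z ->
    Dzb (Dz (loc c f)) z = 0.

Definition superconformal_minimal (m : nat) (f : M -> 'rV[R]_m) : Prop :=
  conformal_minimal_immersion f /\
  forall c, atlas c -> forall z, chart_img c z ->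
    dot (Dz (Dz (loc c f)) z) (Dz (Dz (loc c f)) z) = 0.

(* A 1-form [g dz] with values in the extended plane is the family of its
   coefficients in the charts. *)
Definition is_form (g : chart R M -> C R -> option (C R)) : Prop :=
  forall c d, atlas c -> atlas d ->
  forall p, chart_dom c p -> chart_dom d p ->
    g c (c p) = omap (fun a => a * derive1 (transition c d) (c p)) (g d (d p)).

Definition meromorphic_form (g : chart R M -> C R -> option (C R)) : Prop :=
  is_form g /\ forall c, atlas c -> meromorphic (chart_img c) (g c).

Definition infinite_form (g : chart R M -> C R -> option (C R)) : Prop :=
  forall c, atlas c -> forall z, chart_img c z -> g c z = None.

End Surfaces.

Section Spheres.
Variables (R : realType) (M : riemannSurface R) (n : nat).

Definition in_sphere (v : 'rV[R]_(n + 1)) : Prop := dot v v = 1.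

Definition light (v : 'rV[R]_(n + 1)) : 'rV[R]_(n + 1 + 1) := row_mx v 1%:M.

(* [None] is the point at infinity. *)
Definition inv_stereo (v : option 'rV[R]_n) : 'rV[R]_(n + 1) :=
  match v with
  | Some v => row_mx ((2 / (dot v v + 1)) *: v)
                     ((dot v v - 1) / (dot v v + 1))%:M
  | None => row_mx 0 1%:M
  end.

Definition sphere_immersion (y : M -> 'rV[R]_(n + 1)) : Prop :=
  (forall p, in_sphere (y p)) /\ conformal_immersion y.

Definition canonical_lift (c : chart R M) (y : M -> 'rV[R]_(n + 1))
    (Y : C R -> 'rV[R]_(n + 1 + 1)) : Prop :=
  smoothV (chart_img c) (fun z => cvec (Y z)) /\
  forall z, chart_img c z ->
    (exists2 l : R, 0 < l & Y z = l *: light (y (chart_inv c z))) /\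
    mink (Dz (fun w => cvec (Y w)) z) (Dzb (fun w => cvec (Y w)) z) = 1 / 2.

(* A basis (as rows) of the fibre of [V] at [z]. *)
Definition Vmx (Y : C R -> 'rV[R]_(n + 1 + 1)) (z : C R) :
    'M[R]_(4, n + 1 + 1) :=
  let Yc := fun w => cvec (Y w) in
  \matrix_(i < 4) [:: Y z; map_mx (@re R) (Dz Yc z); map_mx (@im R) (Dz Yc z);
                      map_mx (@re R) (Dzb (Dz Yc) z)]`_i.

Definition in_V (Y : C R -> 'rV[R]_(n + 1 + 1)) (z : C R)
    (v : 'rV[R]_(n + 1 + 1)) : Prop := (v <= Vmx Y z)%MS.

Definition in_VC (Y : C R -> 'rV[R]_(n + 1 + 1)) (z : C R)
    (w : 'rV[C R]_(n + 1 + 1)) : Prop := (w <= map_mx (@toC R) (Vmx Y z))%MS.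

Definition in_VperpC (Y : C R -> 'rV[R]_(n + 1 + 1)) (z : C R)
    (w : 'rV[C R]_(n + 1 + 1)) : Prop :=
  forall v, in_V Y z v -> mink w (cvec v) = 0.

(* [psi' = D_zbar psi], the component of the derivative normal to [V]. *)
Definition normal_dzb (U : set (C R)) (Y : C R -> 'rV[R]_(n + 1 + 1))
    (psi psi' : C R -> 'rV[C R]_(n + 1 + 1)) : Prop :=
  forall z, U z -> in_VperpC Y z (psi' z) /\ in_VC Y z (Dzb psi z - psi' z).

(* The canonical lift [Y] of [y] in the chart [c], with the data it determines:
   [N], [s], [kappa] and [kappa' = D_zbar kappa]. *)
Record frame (c : chart R M) (y : M -> 'rV[R]_(n + 1))
    (Y N : C R -> 'rV[R]_(n + 1 + 1)) (s : C R -> C R)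
    (kappa kappa' : C R -> 'rV[C R]_(n + 1 + 1)) : Prop := Frame {
  frame_lift : canonical_lift c y Y;
  frame_N : forall z, chart_img c z ->
    [/\ in_V Y z (N z), mink (N z) (N z) = 0, mink (N z) (Y z) = -1 &
        mink (cvec (N z)) (Dz (fun w => cvec (Y w)) z) = 0];
  frame_kappa : forall z, chart_img c z ->
    in_VperpC Y z (kappa z) /\
    Dz (Dz (fun w => cvec (Y w))) z = - (s z / 2) *: cvec (Y z) + kappa z;
  frame_kappa' : normal_dzb (chart_img c) Y kappa kappa' }.

Definition willmore (y : M -> 'rV[R]_(n + 1)) : Prop :=
  sphere_immersion y /\
  forall c, atlas c ->
  exists Y N s kappa kappa' kappa'',
    [/\ frame c y Y N s kappa kappa',
        normal_dzb (chart_img c) Y kappa' kappa'' &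
        forall z, chart_img c z ->
          kappa'' z + ((s z)^* / 2) *: kappa z = 0].

Definition adjoint_lift (Y N : C R -> 'rV[R]_(n + 1 + 1)) (mu : C R -> C R)
    (z : C R) : 'rV[C R]_(n + 1 + 1) :=
  (`|mu z| ^+ 2 / 2) *: cvec (Y z) + (mu z)^* *: Dz (fun w => cvec (Y w)) z +
  mu z *: Dzb (fun w => cvec (Y w)) z + cvec (N z).

Definition adjoint_transform (y yhat : M -> 'rV[R]_(n + 1)) : Prop :=
  [/\ willmore y, smooth_map yhat, forall p, in_sphere (yhat p) &
  exists U : set M,
    [/\ open U, dense U &
    forall c, atlas c ->
    exists Y N s kappa kappa' mu,
      [/\ frame c y Y N s kappa kappa',
          smoothC (c @` (chart_dom c `&` U)) mu &
      forall z, (c @` (chart_dom c `&` U)) z ->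
        let eta := kappa' z + ((mu z)^* / 2) *: kappa z in
        [/\ exists2 t : R, t != 0 &
              adjoint_lift Y N mu z = toC t *: loc c (light \o yhat) z,
            dz mu z - (mu z) ^+ 2 / 2 - s z = 0 &
            mink eta eta = 0]]]].

Definition adjoint_transform_euclidean (x : M -> 'rV[R]_n)
    (xhat : M -> option 'rV[R]_n) : Prop :=
  adjoint_transform (fun p => inv_stereo (Some (x p)))
                    (fun p => inv_stereo (xhat p)).

(* The formula is an identity in [C^n] whose right-hand side is real. *)
Definition given_by_form (x : M -> 'rV[R]_n)
    (g : chart R M -> C R -> option (C R)) (xhat : M -> option 'rV[R]_n) :
    Prop :=
  forall c, atlas c -> forall p, chart_dom c p ->
    let z := c p in
    let X := loc c x in
    let Xz := Dz X z in
    let Xzb := Dzb X z in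
    match g c z with
    | Some a => exists2 v, xhat p = Some v &
        cvec v = X z - ((dot (X z) Xzb + a^*) / dot Xz Xzb) *: Xz
                     - ((dot (X z) Xz + a) / dot Xz Xzb) *: Xzb
    | None => xhat p = None
    end.

End Spheres.

(* Main.v *)
From HB Require Import structures.
Require Import Defs.
From mathcomp Require Import all_boot all_order all_algebra.
From mathcomp Require Import all_classical all_reals all_analysis.
From mathcomp Require Import ring lra.
Set Implicit Arguments.
Unset Strict Implicit.
Unset Printing Implicit Defensive.
Import Order.TTheory GRing.Theory Num.Theory numFieldNormedType.Exports.
Local Open Scope classical_set_scope.
Local Open Scope ring_scope.

(* Let [L] be the lift of [x] to the light cone with [<L, P> = -1], where [P] represents the point at
   infinity, and put [rho = x_z . x_zbar], [phi = rho_z / rho], [b = x . x_z]. Minimality gives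
   [L_zzbar = rho P]; hence [s = phi_z - phi^2 / 2], [D_zbar kappa] is a multiple of [kappa], and
   super-conformality, which makes [kappa] null, turns the condition on [eta] into a triviality. With
   [mu = phi - 2 rho conj h] the Riccati equation becomes [h_zbar = - rho h^2], that is
   [(1 / h)_zbar = rho = b_zbar], so that [1 / h = b + g] with [g] holomorphic, and the expansion of the
   adjoint lift in [L], [L_z], [L_zbar], [P] is the formula for [xhat]. Where [xhat] is infinite,
   [1 / g = h / (1 - b h)] is still smooth, hence holomorphic: either the point is a pole of [g], or
   [xhat] is infinite nearby, and connectedness makes the second case global. *)

(** * Complex numbers and continuity *)

(** The predicate [smooth] only means real smoothness. Hence holomorphic functions must be proved
    smooth for the converse, and removable singularities and isolated zeros are needed for [1 / g]
    to decide between a pole and a locally infinite [xhat]. All this rests on Cauchy's formula on a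
    square; the boundary integral of [1 / z] is never evaluated, only shown to be nonzero.

    An adjoint transform provides [mu] on a dense open set only, and with an arbitrary frame in each
    chart. Therefore the canonical lift, [N] and [s] are shown to be unique in a chart, and [h] is
    rewritten as a quotient of pairings of the light-cone lift of [xhat] with [L] and [L_zbar].
    These pairings are smooth on the whole chart, so identities extend from the dense set by
    continuity and [h] stays smooth where [xhat] is infinite.

    In the converse, finite points, poles and [g = oo] are treated alike: locally [g] is a quotient
    of holomorphic functions without common zeros, and multiplying the lift of [xhat] by the squared
    modulus of the denominator removes the pole. The dense open set is the one where [xhat] differs
    from [x]; density holds because [b] is nowhere holomorphic, [b_zbar = rho] being positive. *)

Section ComplexNumbers.
Variable R : realType.
Implicit Types z w : C R.

Lemma complex_eqP z w : re z = re w -> im z = im w -> z = w.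
Proof. by case: z w => [a b] [c d] /= -> ->. Qed.

Lemma reD z w : re (z + w) = re z + re w.
Proof. by case: z w => [a b] [c d]. Qed.
Lemma imD z w : im (z + w) = im z + im w.
Proof. by case: z w => [a b] [c d]. Qed.
Lemma reN z : re (- z) = - re z.
Proof. by case: z. Qed.
Lemma imN z : im (- z) = - im z.
Proof. by case: z. Qed.
Lemma reM z w : re (z * w) = re z * re w - im z * im w.
Proof. by case: z w => [a b] [c d]. Qed.
Lemma imM z w : im (z * w) = re z * im w + im z * re w.
Proof. by case: z w => [a b] [c d]. Qed.
Lemma re_toC (t : R) : re (toC t) = t. Proof. by []. Qed.
Lemma im_toC (t : R) : im (toC t) = 0. Proof. by []. Qed.
Lemma re_imag : re (imag R) = 0. Proof. by []. Qed.
Lemma im_imag : im (imag R) = 1. Proof. by []. Qed.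
Lemma re0 : re (0 : C R) = 0. Proof. by []. Qed.
Lemma im0 : im (0 : C R) = 0. Proof. by []. Qed.
Lemma re1 : re (1 : C R) = 1. Proof. by []. Qed.
Lemma im1 : im (1 : C R) = 0. Proof. by []. Qed.
Lemma re_conj z : re z^* = re z.
Proof. by case: z. Qed.
Lemma im_conj z : im z^* = - im z.
Proof. by case: z. Qed.

Lemma toCD (s t : R) : toC (s + t) = toC s + toC t.
Proof. by apply: complex_eqP; rewrite ?reD ?imD ?re_toC ?im_toC ?addr0. Qed.
Lemma toCN (t : R) : toC (- t) = - toC t.
Proof. by apply: complex_eqP; rewrite ?reN ?imN ?re_toC ?im_toC ?oppr0. Qed.
Lemma toCM (s t : R) : toC (s * t) = toC s * toC t.
Proof. by apply: complex_eqP; rewrite ?reM ?imM ?re_toC ?im_toC; ring. Qed.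
Lemma toC0 : toC (0 : R) = 0. Proof. by []. Qed.
Lemma toC1 : toC (1 : R) = 1. Proof. by []. Qed.

HB.instance Definition _ := GRing.isZmodMorphism.Build R (C R) (@toC R)
  (fun s t => etrans (toCD s (- t)) (congr1 (fun v => toC s + v) (toCN t))).
HB.instance Definition _ := GRing.isMonoidMorphism.Build R (C R) (@toC R)
  (conj toC1 (fun s t => toCM s t)).

Lemma complexE z : z = toC (re z) + imag R * toC (im z).
Proof.
apply: complex_eqP; rewrite ?reD ?imD ?reM ?imM ?re_toC ?im_toC re_imag im_imag; ring.
Qed.

Lemma imag2 : imag R * imag R = -1.
Proof. by apply: complex_eqP; rewrite ?reM ?imM re_imag im_imag ?reN ?imN ?re1 ?im1; ring. Qed.

(** The norm of [C R] takes its values in [C R]; estimates use this equivalent real-valued norm. It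
    is submultiplicative, but inversion costs a factor 2 ([n1V]). *)
Definition n1 z : R := `|re z| + `|im z|.

Lemma n1_ge0 z : 0 <= n1 z.
Proof. by rewrite addr_ge0. Qed.
Lemma n1D z w : n1 (z + w) <= n1 z + n1 w.
Proof. rewrite /n1 reD imD; have := ler_normD (re z) (re w); have := ler_normD (im z) (im w). lra. Qed.
Lemma n1N z : n1 (- z) = n1 z.
Proof. by rewrite /n1 reN imN !normrN. Qed.
Lemma n1M z w : n1 (z * w) <= n1 z * n1 w.
Proof.
rewrite /n1 reM imM.
have := ler_normB (re z * re w) (im z * im w).
have := ler_normD (re z * im w) (im z * re w).
rewrite !normrM. nra.
Qed.
Lemma n1_0 : n1 0 = 0. Proof. by rewrite /n1 re0 im0 normr0 addr0. Qed.
Lemma n1_eq0 z : n1 z = 0 -> z = 0.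
Proof.
move=> /eqP; rewrite paddr_eq0// !normr_eq0 => /andP[/eqP h1 /eqP h2].
exact: complex_eqP.
Qed.
Lemma n1_gt0 z : z != 0 -> 0 < n1 z.
Proof. by move=> z0; rewrite lt0r n1_ge0 andbT; apply: contra z0 => /eqP/n1_eq0/eqP. Qed.
Lemma n1_toC (t : R) : n1 (toC t) = `|t|.
Proof. by rewrite /n1 re_toC im_toC normr0 addr0. Qed.
Lemma n1_imagM z : n1 (imag R * z) = n1 z.
Proof. by rewrite /n1 reM imM re_imag im_imag !mul0r !mul1r sub0r add0r normrN addrC. Qed.
Lemma n1_sym z w : n1 (z - w) = n1 (w - z).
Proof. by rewrite -n1N opprB. Qed.

Lemma normE z : `|z| = toC (Num.sqrt (re z ^+ 2 + im z ^+ 2)).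
Proof. by case: z => a b; rewrite [LHS]complex.normc_def. Qed.

Lemma leC z w : (z <= w) = (im w == im z) && (re z <= re w).
Proof. by case: z w => [a b] [c d]; exact: complex.lecE. Qed.
Lemma ltC z w : (z < w) = (im w == im z) && (re z < re w).
Proof. by case: z w => [a b] [c d]; exact: complex.ltcE. Qed.
Lemma le_toC (s t : R) : (toC s <= toC t) = (s <= t).
Proof. by rewrite leC /= eqxx. Qed.
Lemma lt_toC (s t : R) : (toC s < toC t) = (s < t).
Proof. by rewrite ltC /= eqxx. Qed.

Lemma norm_le_n1 z : `|z| <= toC (n1 z).
Proof.
rewrite normE le_toC; apply: (le_trans _ (y := Num.sqrt (n1 z ^+ 2))).
  rewrite ler_sqrt ?exprn_ge0 ?n1_ge0// /n1 -[re z ^+ 2]real_normK ?num_real// -[im z ^+ 2]real_normK ?num_real//.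
  have := normr_ge0 (re z); have := normr_ge0 (im z); nra.
by rewrite sqrtr_sqr ger0_norm// n1_ge0.
Qed.

Lemma n1_le_norm z : toC (n1 z) <= 2 * `|z|.
Proof.
have -> : 2 * `|z| = toC (2 * Num.sqrt (re z ^+ 2 + im z ^+ 2)).
  by rewrite normE rmorphM rmorph_nat.
rewrite le_toC; set s := Num.sqrt _.
have s0 : 0 <= s by exact: sqrtr_ge0.
have s2 : s ^+ 2 = re z ^+ 2 + im z ^+ 2 by rewrite sqr_sqrtr// addr_ge0// sqr_ge0.
have h1 : `|re z| <= s by rewrite -[`|_|]ger0_norm// -ler_sqr ?nnegrE ?s2 ?real_normK ?num_real// lerDl sqr_ge0.
have h2 : `|im z| <= s by rewrite -[`|_|]ger0_norm// -ler_sqr ?nnegrE ?s2 ?real_normK ?num_real// lerDr sqr_ge0.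
rewrite /n1; lra.
Qed.

(** The inverse is the conjugate divided by [d = re z ^ 2 + im z ^ 2], and [n1 z ^ 2 <= 2 * d]. *)
Lemma n1V z : n1 z^-1 <= 2 / n1 z.
Proof.
have [->|z0] := eqVneq z 0; first by rewrite invr0 n1_0 invr0 mulr0.
have z1 := n1_gt0 z0.
set d := re z ^+ 2 + im z ^+ 2.
have d2 : n1 z ^+ 2 <= 2 * d.
  rewrite /n1 /d -[re z ^+ 2]real_normK ?num_real// -[im z ^+ 2]real_normK ?num_real//.
  have := sqr_ge0 (`|re z| - `|im z|); nra.
have d0 : 0 < d by have := exprn_gt0 2 z1; lra.
have zz : z * z^* = toC d.
  by rewrite -normCK normE -rmorphXn /= sqr_sqrtr// addr_ge0// sqr_ge0.
have -> : z^-1 = z^* * toC d^-1.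
  apply: (mulfI z0); rewrite mulfV// mulrA zz -toCM mulfV//; exact: lt0r_neq0.
apply: (le_trans (n1M _ _)); rewrite n1_toC ger0_norm; last by rewrite invr_ge0 ltW.
have -> : n1 z^* = n1 z by rewrite /n1 re_conj im_conj normrN.
rewrite ler_pdivlMr// mulrAC ler_pdivrMr// -expr2 //.
Qed.

Lemma nbhsCP (z : C R) (A : set (C R)) :
  nbhs z A <-> exists2 e : R, 0 < e & forall w, n1 (w - z) < e -> A w.
Proof.
split=> [/nbhs_ballP [e /= e0 zA]|[e e0 zA]].
- have [re0 ime] : 0 < re e /\ im e = 0.
    by move: e0; rewrite ltC => /andP[/eqP-> ->].
  exists (re e) => // w we; apply: zA; rewrite /ball /=.
  rewrite (_ : e = toC (re e)); last by apply: complex_eqP.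
  by apply: le_lt_trans (norm_le_n1 _) _; rewrite lt_toC n1_sym.
- apply/nbhs_ballP; exists (toC (e / 2)) => /=.
    by rewrite -toC0 lt_toC divr_gt0.
  move=> w; rewrite /ball /= => we; apply: zA; rewrite -lt_toC.
  apply: (le_lt_trans (n1_le_norm _)); rewrite distrC.
  have -> : toC e = 2 * toC (e/2) by rewrite -(rmorph_nat (@toC R) 2) -rmorphM mulrC divfK.
  by rewrite ltr_pM2l.
Qed.

End ComplexNumbers.

Section Continuity.
Variable R : realType.

Lemma contRP (f : C R -> R) (z : C R) : {for z, continuous f} <->
  forall e : R, 0 < e -> exists2 d : R, 0 < d &
    forall w, n1 (w - z) < d -> `|f w - f z| < e.
Proof.
split=> [/cvgrPdist_lt h e e0|h].
- have /nbhsCP[d d0 dh] := h e e0; exists d => // w /dh; by rewrite distrC.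
- move=> A /nbhs_ballP[e /= e0 eA]; have [d d0 dh] := h e e0.
  apply/nbhsCP; exists d => // w /dh wd; by apply: eA; rewrite /ball /= distrC.
Qed.

Lemma contCP (f : C R -> C R) (z : C R) : {for z, continuous f} <->
  forall e : R, 0 < e -> exists2 d : R, 0 < d &
    forall w, n1 (w - z) < d -> n1 (f w - f z) < e.
Proof.
split=> [h e e0|h].
- have /nbhsCP[d d0 dh] : nbhs z (f @^-1` [set w | n1 (w - f z) < e]).
    by apply: h; apply/nbhsCP; exists e.
  by exists d.
- move=> A /nbhsCP[e e0 eA]; have [d d0 dh] := h e e0.
  by apply/nbhsCP; exists d => // w /dh /eA.
Qed.

Lemma re_le_n1 (z : C R) : `|re z| <= n1 z.
Proof. by rewrite lerDl. Qed.
Lemma im_le_n1 (z : C R) : `|im z| <= n1 z.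
Proof. by rewrite lerDr. Qed.

Lemma cont_reim (f : C R -> C R) (z : C R) : {for z, continuous f} <->
  {for z, continuous (fun w => re (f w))} /\ {for z, continuous (fun w => im (f w))}.
Proof.
split=> [/contCP h|[/contRP h1 /contRP h2]].
- split; apply/contRP => e e0; have [d d0 dh] := h e e0; exists d => // w /dh.
  + by apply: le_lt_trans; rewrite -reN -reD re_le_n1.
  + by apply: le_lt_trans; rewrite -imN -imD im_le_n1.
- apply/contCP => e e0; have e20 : 0 < e / 2 by rewrite divr_gt0.
  have [d1 d10 dh1] := h1 _ e20; have [d2 d20 dh2] := h2 _ e20.
  exists (Num.min d1 d2); first by rewrite lt_min d10.
  move=> w; rewrite lt_min => /andP[/dh1 + /dh2].
  rewrite /n1 reD imD reN imN; lra.
Qed.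

(** Stated with a remainder instead of a difference quotient, the derivative needs no division and
    [h = 0] is harmless. *)
Lemma isCdP (f : C R -> C R) (z D : C R) : is_derive z 1 f D <->
  forall e : R, 0 < e -> exists2 d : R, 0 < d &
    forall h, n1 h < d -> n1 (f (z + h) - f z - D * h) <= e * n1 h.
Proof.
have key (l : C R) : h^-1 *: ((f \o shift z) (h *: (1 : C R)) - f z) @[h --> 0^'] --> l <->
    forall e : R, 0 < e -> exists2 d : R, 0 < d &
      forall h, n1 h < d -> n1 (f (z + h) - f z - l * h) <= e * n1 h.
  split=> [lh e e0|H].
  - have /lh : nbhs l [set w | n1 (w - l) < e] by apply/nbhsCP; exists e.
    have U : forall P, nbhs (0 : C R)^' P -> nbhs (0 : C R) (fun h => h != 0 -> P h) by [].
    move=> /U/nbhsCP[d d0 dh]; exists d => // h hd.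
    have [->|h0] := eqVneq h 0; first by rewrite addr0 subrr mulr0 subrr n1_0 mulr0.
    have /= := dh h; rewrite subr0 => /(_ hd h0) hl.
    have -> : f (z + h) - f z - l * h = (h^-1 *: (f (h *: 1 + z) - f z) - l) * h.
      rewrite mulrBl; congr (_ - _); rewrite /GRing.scale /= mulr1 (addrC h) [RHS]mulrAC mulVf ?mul1r//.
    by apply: (le_trans (n1M _ _)); rewrite ler_wpM2r ?n1_ge0// ltW.
  - move=> A /nbhsCP[e e0 eA].
    (* [n1V] costs a factor 2 and the inequality to reach is strict, hence a third. *)
    have e30 : 0 < e / 3 by rewrite divr_gt0.
    have [d d0 dh] := H _ e30.
    have U : forall P, nbhs (0 : C R) (fun h => h != 0 -> P h) -> nbhs (0 : C R)^' P by [].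
    apply: U; apply/nbhsCP; exists d => // h; rewrite subr0 => hd h0; apply: eA.
    have -> : h^-1 *: ((f \o shift z) (h *: 1) - f z) - l = (f (z + h) - f z - l * h) * h^-1.
      rewrite /= /GRing.scale /= mulr1 (addrC h) [RHS]mulrBl mulfK// mulrC//.
    have h1 := n1_gt0 h0.
    apply: (le_lt_trans (n1M _ _)); apply: (le_lt_trans (ler_wpM2l (n1_ge0 _) (n1V _))).
    apply: (le_lt_trans (ler_wpM2r _ (dh _ hd))); first by rewrite divr_ge0// ltW.
    rewrite (_ : e / 3 * n1 h * (2 / n1 h) = e * 2 / 3); last by field; rewrite gt_eqF.
    lra.
split=> [[df <-]|H]; first by apply/key; exact: df.
have hD := (key D).2 H; split; first by apply/cvg_ex; exists D.
exact: cvg_lim.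
Qed.

Lemma derivable_isCd (f : C R -> C R) (z : C R) :
  derivable f z 1 -> is_derive z 1 f (derive1 f z).
Proof. by move=> df; rewrite derive1E; exact: derivableP. Qed.

Implicit Types (f g : C R -> C R) (z : C R).

Lemma cont_cst (k : C R) z : {for z, continuous (fun _ : C R => k)}.
Proof. exact: cst_continuous. Qed.
Lemma cont_id z : {for z, continuous (fun w : C R => w)}.
Proof. exact: cvg_id. Qed.
Lemma contD f g z : {for z, continuous f} -> {for z, continuous g} ->
  {for z, continuous (fun w => f w + g w)}.
Proof. by move=> cf cg; exact: (@continuousD _ _ _ f g z cf cg). Qed.
Lemma contM f g z : {for z, continuous f} -> {for z, continuous g} ->
  {for z, continuous (fun w => f w * g w)}.
Proof. by move=> cf cg; exact: (@continuousM _ _ f g z cf cg). Qed.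
Lemma contV f z : f z != 0 -> {for z, continuous f} ->
  {for z, continuous (fun w => (f w)^-1)}.
Proof. by move=> f0 cf; exact: (@continuousV _ _ f z f0 cf). Qed.
Lemma cont_near f g z : (\forall w \near z, f w = g w) ->
  {for z, continuous f} -> {for z, continuous g}.
Proof.
move=> fg /contCP cf; apply/contCP => e e0; have [d d0 dh] := cf e e0.
have fgz : f z = g z := nbhs_singleton fg.
have /nbhsCP[d' d'0 d'h] := fg.
exists (Num.min d d'); first by rewrite lt_min d0.
by move=> w; rewrite lt_min => /andP[/dh + /d'h]; rewrite fgz => + <-.
Qed.
Lemma derivable_cont f z : derivable f z 1 -> {for z, continuous f}.
Proof. by move=> /derivable1_diffP/differentiable_continuous. Qed.

Lemma cderivable_cst (k : C R) z : derivable (fun _ : C R => k) z 1.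
Proof. exact: derivable_cst. Qed.
Lemma cderivable_id z : derivable (fun w : C R => w) z 1.
Proof. exact: derivable_id. Qed.
Lemma cderivableD f g z : derivable f z 1 -> derivable g z 1 ->
  derivable (fun w => f w + g w) z 1.
Proof. by move=> df dg; exact: (@derivableD _ _ _ f g z 1 df dg). Qed.
Lemma cderivableM f g z : derivable f z 1 -> derivable g z 1 ->
  derivable (fun w => f w * g w) z 1.
Proof. by move=> df dg; exact: (@derivableM _ _ f g z 1 df dg). Qed.
Lemma cderivableV f z : f z != 0 -> derivable f z 1 ->
  derivable (fun w => (f w)^-1) z 1.
Proof. by move=> f0 df; exact: (@derivableV _ _ f z 1 f0 df). Qed.

End Continuity.

(** * Real derivatives, the mean value inequality and primitives *)

Section RealDerivatives.
Variable R : realType.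

Lemma is_deriveRP (u : R -> R) (t D : R) : is_derive t 1 u D <->
  forall e : R, 0 < e -> exists2 d : R, 0 < d &
    forall h, `|h| < d -> `|u (t + h) - u t - D * h| <= e * `|h|.
Proof.
have key (l : R) : h^-1 *: ((u \o shift t) (h *: (1 : R)) - u t) @[h --> 0^'] --> l <->
    forall e : R, 0 < e -> exists2 d : R, 0 < d &
      forall h, `|h| < d -> `|u (t + h) - u t - l * h| <= e * `|h|.
  split=> [lh e e0|H].
  - have /lh : nbhs l (ball l e) by exact: nbhsx_ballx.
    move=> [d /= d0 dh]; exists d => // h hd.
    have [->|h0] := eqVneq h 0; first by rewrite addr0 subrr mulr0 subrr normr0 mulr0.
    have /= := dh h; rewrite /ball /= sub0r normrN => /(_ hd h0); rewrite distrC => hl.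
    have -> : u (t + h) - u t - l * h = (h^-1 *: (u (h *: 1 + t) - u t) - l) * h.
      rewrite mulrBl; congr (_ - _); rewrite /GRing.scale /= mulr1 (addrC h) [RHS]mulrAC mulVf ?mul1r//.
    by rewrite normrM ler_wpM2r// ltW.
  - move=> A /nbhs_ballP[e /= e0 eA].
    have e30 : 0 < e / 3 by rewrite divr_gt0.
    have [d d0 dh] := H _ e30.
    exists d => // h /=; rewrite sub0r normrN => hd h0; apply: eA; rewrite /ball /= distrC.
    have -> : h^-1 *: (u (h *: 1 + t) - u t) - l = (u (t + h) - u t - l * h) * h^-1.
      rewrite /GRing.scale /= mulr1 (addrC h) [RHS]mulrBl mulfK// mulrC//.
    rewrite normrM normfV ltr_pdivrMr ?normr_gt0//.
    apply: (le_lt_trans (dh _ hd)); rewrite ltr_pM2r ?normr_gt0//; lra.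
split=> [[df <-]|H]; first by apply/key; exact: df.
have hD := (key D).2 H; split; first by apply/cvg_ex; exists D.
exact: cvg_lim.
Qed.

Lemma MVT_le (u v : R -> R) (M a b : R) : a <= b ->
  (forall t, a <= t <= b -> is_derive t 1 u (v t)) ->
  (forall t, a <= t <= b -> v t <= M) -> u b - u a <= M * (b - a).
Proof.
move=> ab ud vM; have [||c + ->] := @MVT_segment R u v a b ab.
- by move=> x; rewrite in_itv /= => /andP[/ltW ax /ltW xb]; apply: ud; rewrite ax.
- apply: derivable_within_continuous => t; rewrite in_itv /= => tab.
  by have [] := ud t tab.
- by rewrite in_itv /= => /vM cM; rewrite ler_wpM2r// subr_ge0.
Qed.

Lemma MVT_norm (u v : R -> R) (M a b : R) : a <= b ->
  (forall t, a <= t <= b -> is_derive t 1 u (v t)) ->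
  (forall t, a <= t <= b -> `|v t| <= M) -> `|u b - u a| <= M * (b - a).
Proof.
move=> ab ud vM; rewrite ler_norml; apply/andP; split.
- have : - u b - - u a <= M * (b - a); last by lra.
  apply: (@MVT_le (fun t => - u t) (fun t => - v t)) => // [t /ud|t /vM].
  + exact: is_deriveN.
  + by rewrite ler_norml lerNl => /andP[].
- apply: (MVT_le ab ud) => t /vM; exact: le_trans (ler_norm _).
Qed.

(** The fundamental theorem of calculus gives a primitive on each interval [(-(n+1), n+1)].
    Normalised to vanish at 0, two of them agree where both are defined, their difference having
    derivative 0, so they glue to a primitive on the whole line. *)
Lemma primitive_exists (u : R -> R) : continuous u ->
  exists F : R -> R, F 0 = 0 /\ forall t : R, is_derive t (1 : R) F (u t).
Proof.
move=> cu.
have loc (n : nat) : exists F : R -> R, F 0 = 0 /\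
    forall t : R, `|t| < n.+1%:R -> is_derive t (1 : R) F (u t).
  pose B : R := n.+1%:R.
  pose F (x : R) : R := (\int[lebesgue_measure]_(s in `[-B, x]) u s)%R.
  exists (fun x => F x - F 0); split=> [|t]; first by rewrite subrr.
  rewrite ltr_norml -/B => /andP[t1 t2].
  have iu : lebesgue_measure.-integrable `[-B, B] (EFin \o u).
    apply: continuous_compact_integrable; first exact: segment_compact.
    by apply: continuous_subspaceT => x; exact: cu.
  have [dF F'] := @continuous_FTC1_closed R u (-B) t B t2 iu t1 (cu t).
  have FD : is_derive t 1 F (u t) by apply: DeriveDef; [exact: dF|rewrite -derive1E; exact: F'].
  have := is_deriveB FD (is_derive_cst (F 0) t 1); rewrite subr0; exact.
have [G GP] := choice loc.
have agree (n m : nat) (x : R) : `|x| < n.+1%:R -> `|x| < m.+1%:R -> G n x = G m x.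
  move=> xn xm.
  have D (t : R) : `|t| <= `|x| -> is_derive t 1 (fun s => G n s - G m s) 0.
    move=> tx; rewrite -(subrr (u t)).
    by apply: is_deriveB; [apply: (GP n).2|apply: (GP m).2]; apply: le_lt_trans tx _.
  have [x0|x0] := leP 0 x.
  - have := @MVT_norm (fun s => G n s - G m s) (fun=> 0) 0 0 x x0.
    rewrite mul0r /= (GP n).1 (GP m).1 subrr subr0 => H; apply/eqP; rewrite -subr_eq0 -normr_le0.
    apply: H => // [t /andP[t0 tx]|t _]; last by rewrite normr0.
    by apply: D; rewrite !ger0_norm.
  - have := @MVT_norm (fun s => G n s - G m s) (fun=> 0) 0 x 0 (ltW x0).
    rewrite mul0r /= (GP n).1 (GP m).1 subrr sub0r normrN => H; apply/eqP; rewrite -subr_eq0 -normr_le0.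
    apply: H => // [t /andP[t0 tx]|t _]; last by rewrite normr0.
    by apply: D; rewrite !ler0_norm ?lerN2// ltW.
pose N (x : R) : nat := Num.truncn `|x|.
have NP (x : R) : `|x| < (N x).+1%:R by rewrite -truncn_lt_nat.
exists (fun x => G (N x) x); split; first by rewrite (GP _).1.
move=> t; apply: (@near_eq_is_derive _ _ _ (G (N t)) ); last exact: (GP _).2.
apply/nbhs_ballP; exists ((N t).+1%:R - `|t|) => /=; first by rewrite subr_gt0.
move=> s; rewrite /ball /= => st.
apply: agree => //; have := ler_normD t (s - t); rewrite distrC in st.
rewrite addrC subrK; lra.
Qed.

End RealDerivatives.

(** * Curve integrals and the theorem of Goursat *)

Section Curves.
Variable R : realType.
Implicit Types (phi psi : R -> C R) (f : C R -> C R) (a b t M : R).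

(** Differentiation of curves goes by components, so that the mean value inequality and the
    existence of primitives carry over from the real line. *)
Definition cder (Phi : R -> C R) (t : R) (v : C R) : Prop :=
  is_derive t (1 : R) (fun s => re (Phi s)) (re v) /\
  is_derive t (1 : R) (fun s => im (Phi s)) (im v).

Lemma cderP (Phi : R -> C R) t v : cder Phi t v <->
  forall e : R, 0 < e -> exists2 d : R, 0 < d &
    forall h, `|h| < d -> n1 (Phi (t + h) - Phi t - v * toC h) <= e * `|h|.
Proof.
have reE h : re (Phi (t + h) - Phi t - v * toC h) =
    re (Phi (t + h)) - re (Phi t) - re v * h.
  by rewrite !reD !reN reM re_toC im_toC mulr0 subr0.
have imE h : im (Phi (t + h) - Phi t - v * toC h) =
    im (Phi (t + h)) - im (Phi t) - im v * h.
  by rewrite !imD !imN imM re_toC im_toC mulr0 add0r.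
split=> [[/is_deriveRP h1 /is_deriveRP h2] e e0|H].
- have e20 : 0 < e / 2 by rewrite divr_gt0.
  have [d1 d10 dh1] := h1 _ e20; have [d2 d20 dh2] := h2 _ e20.
  exists (Num.min d1 d2); first by rewrite lt_min d10.
  move=> h; rewrite lt_min => /andP[/dh1 + /dh2]; rewrite /n1 reE imE; lra.
- split; apply/is_deriveRP => e e0; have [d d0 dh] := H e e0; exists d => // h /dh.
  + by apply: le_trans; rewrite -reE re_le_n1.
  + by apply: le_trans; rewrite -imE im_le_n1.
Qed.

Lemma cder_ext (Phi Psi : R -> C R) t v : (forall s, Phi s = Psi s) ->
  cder Phi t v -> cder Psi t v.
Proof. by move=> /funext ->. Qed.

Lemma cder_line (a b : C R) t : cder (fun s => a + b * toC s) t b.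
Proof.
apply/cderP => e e0; exists 1 => // h _.
rewrite toCD. have -> : a + b * (toC t + toC h) - (a + b * toC t) - b * toC h = 0.   by ring.
by rewrite n1_0 mulr_ge0// ltW.
Qed.

Lemma cderD (Phi Psi : R -> C R) t v w : cder Phi t v -> cder Psi t w ->
  cder (fun s => Phi s + Psi s) t (v + w).
Proof.
move=> [p1 p2] [q1 q2]; split.
- by rewrite (_ : (fun s => _) = (fun s => re (Phi s) + re (Psi s))) ?reD;
    [exact: is_deriveD|apply/funext => s; rewrite reD].
- by rewrite (_ : (fun s => _) = (fun s => im (Phi s) + im (Psi s))) ?imD;
    [exact: is_deriveD|apply/funext => s; rewrite imD].
Qed.

Lemma cder_comp f (Phi : R -> C R) t D v : is_derive (Phi t) 1 f D ->
  cder Phi t v -> cder (fun s => f (Phi s)) t (D * v).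
Proof.
move=> /isCdP fD /cderP Pv; apply/cderP => e e0.
(* [K] dominates both [n1 v + 1], which bounds the increment of [Phi] by [K * |h|], and [n1 D]. With
   [e1 * K <= e / 2] the error of [f] and the error of [Phi] multiplied by [D] each contribute at
   most [e / 2 * |h|]. *)
pose K := n1 D + n1 v + 1.
have K0 : 0 < K by have := n1_ge0 D; have := n1_ge0 v; rewrite /K; lra.
pose e1 := Num.min 1 (e / (2 * K)).
have e10 : 0 < e1 by rewrite lt_min ltr01 divr_gt0// mulr_gt0.
have e1K : e1 * K <= e / 2.
  apply: (@le_trans _ _ (e / (2 * K) * K)).
    by rewrite ler_wpM2r ?ge_min ?lexx ?orbT// ltW.
  by rewrite le_eqVlt; apply/orP; left; apply/eqP; field; rewrite gt_eqF.
have e11 : e1 <= 1 by rewrite ge_min lexx.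
have [d1 d10 dh1] := fD _ e10; have [d2 d20 dh2] := Pv _ e10.
exists (Num.min d2 (d1 / K)); first by rewrite lt_min d20 divr_gt0.
move=> h; rewrite lt_min => /andP[/dh2 P2].
rewrite ltr_pdivlMr// => hK.
set k := Phi (t + h) - Phi t in P2.
have kle : n1 k <= K * `|h|.
  have kk : n1 k <= n1 (k - v * toC h) + n1 (v * toC h).
    have {1}-> : k = (k - v * toC h) + v * toC h by ring.
    exact: n1D.
  have := n1M v (toC h); rewrite n1_toC => vv.
  apply: (le_trans kk); apply: (le_trans (lerD P2 vv)).
  by rewrite -mulrDl ler_wpM2r// /K; have := n1_ge0 D; lra.
have kd : n1 k < d1 by apply: le_lt_trans kle _; rewrite mulrC.
have := dh1 _ kd; have -> : Phi t + k = Phi (t + h) by rewrite /k; ring.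
move=> F.
have -> : f (Phi (t + h)) - f (Phi t) - D * v * toC h =
  (f (Phi (t + h)) - f (Phi t) - D * k) + D * (k - v * toC h) by ring.
apply: (le_trans (n1D _ _)).
have := n1M D (k - v * toC h) => DM.
have D0 := n1_ge0 D; have h0 := normr_ge0 h.
have s1 : n1 (f (Phi (t + h)) - f (Phi t) - D * k) <= e / 2 * `|h|.
  apply: (le_trans F); apply: (@le_trans _ _ (e1 * (K * `|h|))).
    by rewrite ler_wpM2l// ltW.
  by rewrite mulrA ler_wpM2r.
have s2 : n1 (D * (k - v * toC h)) <= e / 2 * `|h|.
  apply: (le_trans DM); apply: (@le_trans _ _ (K * (e1 * `|h|))).
    apply: ler_pM => //; first exact: n1_ge0.
    by rewrite /K; have := n1_ge0 v; lra.
  by rewrite mulrA (mulrC K) ler_wpM2r.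
lra.
Qed.

Lemma cder_cst (a : C R) t : cder (fun=> a) t 0.
Proof. by apply: cder_ext (cder_line a 0 t) => s; rewrite mul0r addr0. Qed.

Lemma is_deriveC_scale (k : C R) (z : C R) : is_derive z 1 (fun w => k * w) k.
Proof.
apply/isCdP => e e0; exists 1 => // h _.
have -> : k * (z + h) - k * z - k * h = 0 by ring.
by rewrite n1_0 mulr_ge0 ?n1_ge0// ltW.
Qed.

Lemma cderZ (k : C R) (Phi : R -> C R) t v : cder Phi t v ->
  cder (fun s => k * Phi s) t (k * v).
Proof. by move=> Pv; exact: (cder_comp (is_deriveC_scale k (Phi t)) Pv). Qed.

(** The factor 2 arises because the two components are estimated separately. *)
Lemma cder_MVT (Phi phi : R -> C R) a b M : a <= b ->
  (forall t, a <= t <= b -> cder Phi t (phi t)) ->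
  (forall t, a <= t <= b -> n1 (phi t) <= M) ->
  n1 (Phi b - Phi a) <= 2 * M * (b - a).
Proof.
move=> ab Pp pM; rewrite /n1 reD imD reN imN.
have := @MVT_norm R (fun t => re (Phi t)) (fun t => re (phi t)) M a b ab.
have := @MVT_norm R (fun t => im (Phi t)) (fun t => im (phi t)) M a b ab.
move=> H1 H2; have {}H1 : `|im (Phi b) - im (Phi a)| <= M * (b - a).
  apply: H1 => t tab; first by have [] := Pp t tab.
  exact: le_trans (im_le_n1 _) (pM t tab).
have {}H2 : `|re (Phi b) - re (Phi a)| <= M * (b - a).
  apply: H2 => t tab; first by have [] := Pp t tab.
  exact: le_trans (re_le_n1 _) (pM t tab).
lra.
Qed.

Definition ccont (phi : R -> C R) : Prop :=
  continuous (fun s => re (phi s)) /\ continuous (fun s => im (phi s)).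

Lemma ccontD phi psi : ccont phi -> ccont psi -> ccont (fun t => phi t + psi t).
Proof.
move=> [p1 p2] [q1 q2]; split=> t.
- rewrite (_ : (fun s => _) = (fun s => re (phi s) + re (psi s))).
    by apply: cvgD; [exact: p1|exact: q1].
  by apply/funext => s; rewrite reD.
- rewrite (_ : (fun s => _) = (fun s => im (phi s) + im (psi s))).
    by apply: cvgD; [exact: p2|exact: q2].
  by apply/funext => s; rewrite imD.
Qed.

Lemma ccontM phi psi : ccont phi -> ccont psi -> ccont (fun t => phi t * psi t).
Proof.
move=> [p1 p2] [q1 q2]; split=> t.
- rewrite (_ : (fun s => _) =
    (fun s => re (phi s) * re (psi s) - im (phi s) * im (psi s))).
    by apply: cvgB; apply: cvgM; [exact: p1|exact: q1|exact: p2|exact: q2].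
  by apply/funext => s; rewrite reM.
- rewrite (_ : (fun s => _) =
    (fun s => re (phi s) * im (psi s) + im (phi s) * re (psi s))).
    by apply: cvgD; apply: cvgM; [exact: p1|exact: q2|exact: p2|exact: q1].
  by apply/funext => s; rewrite imM.
Qed.

Lemma ccont_cst (k : C R) : ccont (fun=> k).
Proof. by split=> t; exact: cvg_cst. Qed.

Lemma ccontZ (k : C R) phi : ccont phi -> ccont (fun t => k * phi t).
Proof. by move=> h; apply: (ccontM (ccont_cst k) h). Qed.

Lemma ccont_line (a b : C R) : ccont (fun t => a + b * toC t).
Proof.
by split=> t; apply: differentiable_continuous; apply/derivable1_diffP;
  have [h1 h2] := cder_line a b t; [case: h1|case: h2].
Qed.

Lemma ccontV phi : ccont phi -> (forall t, phi t != 0) -> ccont (fun t => (phi t)^-1).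
Proof.
move=> [p1 p2] p0.
pose d t := re (phi t) ^+ 2 + im (phi t) ^+ 2.
have d0 t : d t != 0.
  apply: contra (p0 t); rewrite /d paddr_eq0 ?sqr_ge0// !sqrf_eq0 => /andP[/eqP h1 /eqP h2].
  by apply/eqP/complex_eqP.
have cd : continuous d.
  move=> t; rewrite /d; apply: cvgD; rewrite /GRing.exp /=; apply: cvgM;
  by [exact: p1|exact: p2].
have VE t : (phi t)^-1 = (phi t)^* * toC (d t)^-1.
  apply: (mulfI (p0 t)); rewrite mulfV// mulrA -normCK normE -rmorphXn /= sqr_sqrtr.
    by rewrite -rmorphM /= mulfV// d0.
  by rewrite addr_ge0// sqr_ge0.
split=> t.
- rewrite (_ : (fun s => _) = (fun s => re (phi s) * (d s)^-1)).
    by apply: cvgM; [exact: p1|apply: cvgV; [exact: d0|exact: cd]].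
  by apply/funext => s; rewrite VE reM re_toC im_toC mulr0 subr0 re_conj.
- rewrite (_ : (fun s => _) = (fun s => - im (phi s) * (d s)^-1)).
    by apply: cvgM; [apply: cvgN; exact: p2|apply: cvgV; [exact: d0|exact: cd]].
  by apply/funext => s; rewrite VE imM re_toC im_toC mulr0 add0r im_conj.
Qed.

Lemma ccont_comp f (a b : C R) : continuous f -> ccont (fun t => f (a + b * toC t)).
Proof.
move=> cf; have [l1 l2] := ccont_line a b.
have cl t : (fun s => a + b * toC s) @ t --> a + b * toC t.
  move=> A /nbhsCP[e e0 eA].
  have e20 : 0 < e / 2 by rewrite divr_gt0.
  move: (l1 t) (l2 t) => /cvgrPdist_lt /(_ _ e20) h1 /cvgrPdist_lt /(_ _ e20) h2.
  apply: (@filterS2 _ (nbhs t) _ _ _ _ _ h1 h2) => s s1 s2; apply: eA; move: s1 s2.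
  rewrite n1_sym [n1 _]/n1 [re (_ - _)]reD [im (_ - _)]imD reN imN; lra.
split=> t.
- have [h _] := (cont_reim f (a + b * toC t)).1 (cf _).
  exact: (@continuous_comp _ _ _ (fun s : R => a + b * toC s) (fun w => re (f w)) t (cl t) h).
- have [_ h] := (cont_reim f (a + b * toC t)).1 (cf _).
  exact: (@continuous_comp _ _ _ (fun s : R => a + b * toC s) (fun w => im (f w)) t (cl t) h).
Qed.

(** The integral is the increment of a chosen global primitive, which makes additivity over
    intervals an identity. The zero curve is the default when there is no primitive. *)
Definition curve_int (phi : R -> C R) (a b : R) : C R :=
  let Phi := xget (fun=> 0) [set Phi | forall t, cder Phi t (phi t)] in
  Phi b - Phi a.

(** On the segment, [Phi] differs from the chosen primitive by a function with derivative 0.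
    Continuity of [phi] on the whole line is what excludes the default value. *)
Lemma curve_intE (Phi phi : R -> C R) a b : a <= b -> ccont phi ->
  (forall t, a <= t <= b -> cder Phi t (phi t)) ->
  curve_int phi a b = Phi b - Phi a.
Proof.
move=> ab [c1 c2] Pp; rewrite /curve_int.
case: xgetP => [Psi _ /= Ps|none].
- apply/eqP; rewrite -subr_eq0; apply/eqP/n1_eq0/eqP; rewrite eq_le n1_ge0 andbT.
  have := @cder_MVT (fun t => Psi t + -1 * Phi t) (fun t => phi t + -1 * phi t) a b 0 ab.
  rewrite mulr0 mul0r.
  have -> : Psi b + -1 * Phi b - (Psi a + -1 * Phi a) = Psi b - Psi a - (Phi b - Phi a) by ring.
  apply=> t tab; first by apply: cderD (Ps t) _; exact: cderZ (Pp t tab).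
  by rewrite mulN1r subrr n1_0.
- have [F [_ Fu]] := primitive_exists c1; have [G [_ Gu]] := primitive_exists c2.
  by have := none (fun t => Complex (F t) (G t)); case; split; [exact: Fu|exact: Gu].
Qed.

Lemma curve_int_prim phi : ccont phi -> exists Phi : R -> C R, forall t, cder Phi t (phi t).
Proof.
move=> [c1 c2].
have [F [_ Fu]] := primitive_exists c1; have [G [_ Gu]] := primitive_exists c2.
by exists (fun t => Complex (F t) (G t)); split; [exact: Fu|exact: Gu].
Qed.

Lemma curve_int_split phi a m b :
  curve_int phi a b = curve_int phi a m + curve_int phi m b.
Proof. by rewrite /curve_int; ring. Qed.

Lemma curve_intD phi psi a b : a <= b -> ccont phi -> ccont psi ->
  curve_int (fun t => phi t + psi t) a b = curve_int phi a b + curve_int psi a b.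
Proof.
move=> ab c1 c2; have [Phi P] := curve_int_prim c1; have [Psi Q] := curve_int_prim c2.
rewrite (@curve_intE (fun t => Phi t + Psi t))//; last 2 first.
- exact: ccontD.
- by move=> t _; exact: cderD.
by rewrite (@curve_intE Phi phi)// (@curve_intE Psi psi)//; ring.
Qed.

Lemma curve_intZ (k : C R) phi a b : a <= b -> ccont phi ->
  curve_int (fun t => k * phi t) a b = k * curve_int phi a b.
Proof.
move=> ab c1; have [Phi P] := curve_int_prim c1.
rewrite (@curve_intE (fun t => k * Phi t))//; last 2 first.
- exact: ccontZ.
- by move=> t _; exact: cderZ.
by rewrite (@curve_intE Phi phi)//; ring.
Qed.

Lemma curve_int_le phi a b M : a <= b -> ccont phi ->
  (forall t, a <= t <= b -> n1 (phi t) <= M) ->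
  n1 (curve_int phi a b) <= 2 * M * (b - a).
Proof.
move=> ab c1 pM; have [Phi P] := curve_int_prim c1.
rewrite (@curve_intE Phi phi)//; apply: (@cder_MVT _ phi) => // t _; exact: P.
Qed.

Lemma curve_int_im_ge phi a b M : a <= b -> ccont phi ->
  (forall t, a <= t <= b -> M <= im (phi t)) ->
  M * (b - a) <= im (curve_int phi a b).
Proof.
move=> ab c1 pM; have [Phi P] := curve_int_prim c1.
rewrite (@curve_intE Phi phi)// imD imN.
have : - im (Phi b) - - im (Phi a) <= - M * (b - a); last by lra.
apply: (@MVT_le R (fun t => - im (Phi t)) (fun t => - im (phi t))) => // t /pM.
- by move=> _; apply: is_deriveN; have [] := P t.
- by rewrite lerN2.
Qed.

End Curves.

Section Goursat.
Variable R : realType.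
Implicit Types (a b c d r m M : R) (z w p u : C R) (f g : C R -> C R).

Lemma nested_intervals (x y : nat -> R) :
  (forall n, x n <= x n.+1) -> (forall n, y n.+1 <= y n) -> (forall n, x n <= y n) ->
  exists s, forall n, x n <= s <= y n.
Proof.
move=> xi yd xy.
have xm n k : x n <= x (n + k)%N.
  by elim: k => [|k IH]; rewrite ?addn0// addnS (le_trans IH).
have ym n k : y (n + k)%N <= y n.
  by elim: k => [|k IH]; rewrite ?addn0// addnS (le_trans _ IH).
have xyn n k : x n <= y k.
  by apply: le_trans (xm n k) _; apply: le_trans (xy _) _; rewrite addnC.
exists (sup (range x)) => n; apply/andP; split.
- apply: ub_le_sup; last by exists n.
  by exists (y 0%N) => _ [k _ <-].
- apply: ge_sup; first by exists (x 0%N), 0%N.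
  by move=> _ [k _ <-].
Qed.

Lemma half_powers_lt (W e : R) : 0 <= W -> 0 < e -> exists n : nat, W / 2 ^+ n < e.
Proof.
move=> W0 e0; exists (Num.truncn (W / e)).+1.
set n := (Num.truncn _).+1.
have h1 : W / e < n%:R by rewrite -truncn_lt_nat// divr_ge0// ltW.
have h2 : (n%:R : R) < 2 ^+ n by rewrite -natrX ltr_nat ltn_expl.
by rewrite ltr_pdivrMr ?exprn_gt0// mulrC -ltr_pdivrMr// (lt_trans h1).
Qed.

(** Bisection: a rectangle violating [P] has a quarter violating [P], and the nested bad rectangles
    shrink to a point [(p, q)] at which the local hypothesis fails. *)
Lemma quad_induction (P : R -> R -> R -> R -> Prop) a0 b0 c0 d0 :
  a0 <= b0 -> c0 <= d0 ->
  (forall a b c d, a <= b -> c <= d ->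
    P a ((a + b) / 2) c ((c + d) / 2) -> P ((a + b) / 2) b c ((c + d) / 2) ->
    P a ((a + b) / 2) ((c + d) / 2) d -> P ((a + b) / 2) b ((c + d) / 2) d ->
    P a b c d) ->
  (forall p q : R, a0 <= p <= b0 -> c0 <= q <= d0 -> exists2 e, 0 < e &
    forall a b c d, a0 <= a <= p -> p <= b <= b0 -> c0 <= c <= q -> q <= d <= d0 ->
      b - a < e -> d - c < e -> P a b c d) ->
  P a0 b0 c0 d0.
Proof.
move=> ab0 cd0 split_P local_P; apply: contrapT => nP.
pose good (s : (R * R) * (R * R)) :=
  [/\ s.1.1 <= s.1.2, s.2.1 <= s.2.2 & ~ P s.1.1 s.1.2 s.2.1 s.2.2].
(* Stated for every rectangle, good or not, so that [choice] yields a total selection that can be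
   iterated. *)
have step (s : (R * R) * (R * R)) : exists s' : (R * R) * (R * R), good s ->
    [/\ good s', s.1.1 <= s'.1.1 /\ s'.1.2 <= s.1.2, s.2.1 <= s'.2.1 /\ s'.2.2 <= s.2.2,
       s'.1.2 - s'.1.1 = (s.1.2 - s.1.1) / 2 & s'.2.2 - s'.2.1 = (s.2.2 - s.2.1) / 2].
  have [gs|ngs] := pselect (good s); last by exists s.
  case: s gs => -[a b] [c d] [/= ab cd nPs].
  pose m := (a + b) / 2; pose n := (c + d) / 2.
  have am : a <= m by rewrite /m; lra.
  have mb : m <= b by rewrite /m; lra.
  have cn : c <= n by rewrite /n; lra.
  have nd : n <= d by rewrite /n; lra.
  have [p1|p1] := pselect (P a m c n); last first.
    by exists ((a, m), (c, n)) => _; rewrite /good /=; split=> //; rewrite ?lexx//; rewrite /m /n; lra.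
  have [p2|p2] := pselect (P m b c n); last first.
    by exists ((m, b), (c, n)) => _; rewrite /good /=; split=> //; rewrite ?lexx//; rewrite /m /n; lra.
  have [p3|p3] := pselect (P a m n d); last first.
    by exists ((a, m), (n, d)) => _; rewrite /good /=; split=> //; rewrite ?lexx//; rewrite /m /n; lra.
  exists ((m, b), (n, d)) => _; rewrite /good /=; split=> //; rewrite ?lexx//; rewrite /m /n; try lra.
  by split=> //; move=> p4; apply: nPs; exact: split_P.
have [S SP] := choice step.
pose s n := iter n S ((a0, b0), (c0, d0)).
have gs n : good (s n) by elim: n => [//|n IH]; have [] := SP _ IH.
have sP n := SP _ (gs n).
have w1 n : (s n).1.2 - (s n).1.1 = (b0 - a0) / 2 ^+ n.
  elim: n => [|n IH]; first by rewrite expr0 divr1.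
  by have [_ _ _ + _] := sP n; rewrite -[S _]/(s n.+1) => ->; rewrite IH exprS invfM; ring.
have w2 n : (s n).2.2 - (s n).2.1 = (d0 - c0) / 2 ^+ n.
  elim: n => [|n IH]; first by rewrite expr0 divr1.
  by have [_ _ _ _ +] := sP n; rewrite -[S _]/(s n.+1) => ->; rewrite IH exprS invfM; ring.
have [|||p pP] := @nested_intervals (fun n => (s n).1.1) (fun n => (s n).1.2).
- by move=> n; have [_ [+ _] _ _ _] := sP n.
- by move=> n; have [_ [_ +] _ _ _] := sP n.
- by move=> n; have [] := gs n.
have [|||q qP] := @nested_intervals (fun n => (s n).2.1) (fun n => (s n).2.2).
- by move=> n; have [_ _ [+ _] _ _] := sP n.
- by move=> n; have [_ _ [_ +] _ _] := sP n.
- by move=> n; have [] := gs n.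
have bounds n : [/\ a0 <= (s n).1.1, (s n).1.2 <= b0, c0 <= (s n).2.1 & (s n).2.2 <= d0].
  elim: n => [|n [h1 h2 h3 h4]]; first by [].
  have [_ [k1 k2] [k3 k4] _ _] := sP n.
  by split; [exact: le_trans k1|exact: le_trans k2 _|exact: le_trans k3|exact: le_trans k4 _].
have [e e0 He] := local_P p q (pP 0%N) (qP 0%N).
have [|//|n nP1] := @half_powers_lt (Num.max (b0 - a0) (d0 - c0)) e.
  by rewrite le_max subr_ge0 ab0.
have n2 : 0 < (2 : R) ^+ n by rewrite exprn_gt0.
have [g1 g2 g3] := gs n; apply: g3.
have [h1 h2 h3 h4] := bounds n.
have /andP[p1 p2] := pP n; have /andP[q1 q2] := qP n.
apply: He; rewrite ?h1 ?h2 ?h3 ?h4 ?p1 ?p2 ?q1 ?q2//.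
- by apply: le_lt_trans nP1; rewrite w1 ler_pM2r ?invr_gt0// le_max lexx.
- by apply: le_lt_trans nP1; rewrite w2 ler_pM2r ?invr_gt0// le_max lexx orbT.
Qed.

(** The factor [1] gives both kinds of lines the shape [a + b * toC t] of [cder_line] and
    [ccont_line]. *)
Definition hor c (t : R) : C R := imag R * toC c + 1 * toC t.
Definition ver a (t : R) : C R := toC a + imag R * toC t.

Lemma re_hor c t : re (hor c t) = t.
Proof. by rewrite /hor reD !reM /=; ring. Qed.
Lemma im_hor c t : im (hor c t) = c.
Proof. by rewrite /hor imD !imM /=; ring. Qed.
Lemma re_ver a t : re (ver a t) = a.
Proof. by rewrite /ver reD !reM /=; ring. Qed.
Lemma im_ver a t : im (ver a t) = t.
Proof. by rewrite /ver imD !imM /=; ring. Qed.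
Lemma hor_ver a c : hor c a = ver a c.
Proof. by rewrite /hor /ver; ring. Qed.

(** The integral along the boundary taken counterclockwise; [imag R] is the velocity on the vertical
    sides. *)
Definition rect_int f a b c d : C R :=
  curve_int (fun t => f (hor c t)) a b + imag R * curve_int (fun t => f (ver b t)) c d
  - curve_int (fun t => f (hor d t)) a b - imag R * curve_int (fun t => f (ver a t)) c d.

Definition rect_cont f a b c d : Prop :=
  (ccont (fun t => f (hor c t)) /\ ccont (fun t => f (hor d t))) /\
  (ccont (fun t => f (ver a t)) /\ ccont (fun t => f (ver b t))).

(* The four full lines carrying the sides: only there are the integrands required to be continuous. *)
Definition on_lines a b c d z : Prop :=
  (im z = c \/ im z = d) \/ (re z = a \/ re z = b).

Definition in_rect a b c d z : Prop := (a <= re z <= b) /\ (c <= im z <= d).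

Lemma rect_int_ext f g a b c d : (forall z, on_lines a b c d z -> f z = g z) ->
  rect_int f a b c d = rect_int g a b c d.
Proof.
move=> fg; rewrite /rect_int.
have -> : (fun t => f (hor c t)) = (fun t => g (hor c t)).
  by apply/funext => t; apply: fg; rewrite /on_lines im_hor; left; left.
have -> : (fun t => f (hor d t)) = (fun t => g (hor d t)).
  by apply/funext => t; apply: fg; rewrite /on_lines im_hor; left; right.
have -> : (fun t => f (ver a t)) = (fun t => g (ver a t)).
  by apply/funext => t; apply: fg; rewrite /on_lines re_ver; right; left.
have -> // : (fun t => f (ver b t)) = (fun t => g (ver b t)).
by apply/funext => t; apply: fg; rewrite /on_lines re_ver; right; right.
Qed.

Lemma rect_contD f g a b c d : rect_cont f a b c d -> rect_cont g a b c d ->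
  rect_cont (fun z => f z + g z) a b c d.
Proof. by move=> [[h1 h2] [h3 h4]] [[k1 k2] [k3 k4]]; split; split; exact: ccontD. Qed.
Lemma rect_contM f g a b c d : rect_cont f a b c d -> rect_cont g a b c d ->
  rect_cont (fun z => f z * g z) a b c d.
Proof. by move=> [[h1 h2] [h3 h4]] [[k1 k2] [k3 k4]]; split; split; exact: ccontM. Qed.
Lemma rect_contZ (k : C R) f a b c d : rect_cont f a b c d ->
  rect_cont (fun z => k * f z) a b c d.
Proof. by move=> [[h1 h2] [h3 h4]]; split; split; exact: ccontZ. Qed.
Lemma rect_cont_cont f a b c d : continuous f -> rect_cont f a b c d.
Proof. by move=> cf; split; split; exact: ccont_comp. Qed.

Lemma rect_intD f g a b c d : a <= b -> c <= d ->
  rect_cont f a b c d -> rect_cont g a b c d ->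
  rect_int (fun z => f z + g z) a b c d = rect_int f a b c d + rect_int g a b c d.
Proof.
move=> ab cd [[h1 h2] [h3 h4]] [[k1 k2] [k3 k4]].
by rewrite /rect_int !curve_intD//; ring.
Qed.

Lemma rect_intZ (k : C R) f a b c d : a <= b -> c <= d -> rect_cont f a b c d ->
  rect_int (fun z => k * f z) a b c d = k * rect_int f a b c d.
Proof.
move=> ab cd [[h1 h2] [h3 h4]].
by rewrite /rect_int !curve_intZ//; ring.
Qed.

Lemma rect_int_le f a b c d M : a <= b -> c <= d -> rect_cont f a b c d ->
  (forall z, in_rect a b c d z -> on_lines a b c d z -> n1 (f z) <= M) ->
  n1 (rect_int f a b c d) <= 4 * M * ((b - a) + (d - c)).
Proof.
move=> ab cd [[h1 h2] [h3 h4]] fM; rewrite /rect_int.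
have k1 : n1 (curve_int (fun t => f (hor c t)) a b) <= 2 * M * (b - a).
  apply: curve_int_le => // t tab; apply: fM; rewrite /in_rect /on_lines re_hor im_hor ?lexx//.
  by left; left.
have k2 : n1 (curve_int (fun t => f (hor d t)) a b) <= 2 * M * (b - a).
  apply: curve_int_le => // t tab; apply: fM; rewrite /in_rect /on_lines re_hor im_hor ?lexx//.
    by rewrite cd.
  by left; right.
have k3 : n1 (curve_int (fun t => f (ver a t)) c d) <= 2 * M * (d - c).
  apply: curve_int_le => // t tab; apply: fM; rewrite /in_rect /on_lines re_ver im_ver ?lexx//.
  by right; left.
have k4 : n1 (curve_int (fun t => f (ver b t)) c d) <= 2 * M * (d - c).
  apply: curve_int_le => // t tab; apply: fM; rewrite /in_rect /on_lines re_ver im_ver ?lexx//.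
    by rewrite ab.
  by right; right.
apply: (le_trans (n1D _ _)); rewrite n1N n1_imagM.
have := n1D (curve_int (fun t => f (hor c t)) a b + imag R * curve_int (fun t => f (ver b t)) c d)
   (- curve_int (fun t => f (hor d t)) a b).
have := n1D (curve_int (fun t => f (hor c t)) a b) (imag R * curve_int (fun t => f (ver b t)) c d).
rewrite n1N n1_imagM; lra.
Qed.

Lemma rect_int_prim f (F : C R -> C R) a b c d : a <= b -> c <= d -> rect_cont f a b c d ->
  (forall z, in_rect a b c d z -> is_derive z 1 F (f z)) -> rect_int f a b c d = 0.
Proof.
move=> ab cd [[h1 h2] [h3 h4]] Ff; rewrite /rect_int.
rewrite (@curve_intE _ (fun t => F (hor c t)) (fun t => f (hor c t)))//; last first.
  move=> t tab; rewrite -[f _]mulr1.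
  apply: (@cder_comp _ F) (cder_line _ _ _).
  by apply: Ff; rewrite /in_rect re_hor im_hor lexx.
rewrite (@curve_intE _ (fun t => F (hor d t)) (fun t => f (hor d t)))//; last first.
  move=> t tab; rewrite -[f _]mulr1.
  apply: (@cder_comp _ F) (cder_line _ _ _).
  by apply: Ff; rewrite /in_rect re_hor im_hor lexx cd.
rewrite -!curve_intZ//.
rewrite (@curve_intE _ (fun t => F (ver a t)) (fun t => imag R * f (ver a t)))//; last 2 first.
- exact: ccontZ.
- move=> t tab; rewrite mulrC.
  apply: (@cder_comp _ F) (cder_line _ _ _).
  by apply: Ff; rewrite /in_rect re_ver im_ver lexx.
rewrite (@curve_intE _ (fun t => F (ver b t)) (fun t => imag R * f (ver b t)))//; last 2 first.
- exact: ccontZ.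
- move=> t tab; rewrite mulrC.
  apply: (@cder_comp _ F) (cder_line _ _ _).
  by apply: Ff; rewrite /in_rect re_ver im_ver lexx ab.
by rewrite !hor_ver; ring.
Qed.

Lemma rect_int_splitx f a m b c d :
  rect_int f a b c d = rect_int f a m c d + rect_int f m b c d.
Proof. rewrite /rect_int !(curve_int_split _ a m b); ring. Qed.
Lemma rect_int_splity f a b c m d :
  rect_int f a b c d = rect_int f a b c m + rect_int f a b m d.
Proof. rewrite /rect_int !(curve_int_split _ c m d); ring. Qed.

Lemma n1_small z : (forall e : R, 0 < e -> n1 z <= e) -> z = 0.
Proof.
move=> H; apply: n1_eq0; apply/eqP; rewrite eq_le n1_ge0 andbT.
by apply/ler_addgt0Pl => e e0; rewrite addr0; exact: H.
Qed.

Lemma continuous_affine (k l : C R) : continuous (fun z : C R => k + l * z).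
Proof.
by move=> z; apply: contD; [exact: cont_cst|apply: contM; [exact: cont_cst|exact: cont_id]].
Qed.

Lemma is_derive_quadratic (k l z : C R) :
  is_derive z 1 (fun w : C R => k * w + l / 2 * (w * w)) (k + l * z).
Proof.
apply/isCdP => e e0; pose K := n1 (l / 2) + 1.
have K0 : 0 < K by rewrite /K; have := n1_ge0 (l / 2); lra.
exists (e / K); first by rewrite divr_gt0.
move=> h; rewrite ltr_pdivlMr// => hd.
have -> : k * (z + h) + l / 2 * ((z + h) * (z + h)) - (k * z + l / 2 * (z * z)) -
  (k + l * z) * h = l / 2 * h * h by field.
apply: (le_trans (n1M _ _)); rewrite ler_wpM2r ?n1_ge0//.
apply: (le_trans (n1M _ _)); apply: le_trans (ltW hd).
by rewrite mulrC ler_wpM2l ?n1_ge0// /K; lra.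
Qed.

(** The bound [4 * e * S ^ 2], with [S] the half-perimeter, is reproduced exactly under quartering:
    four terms, each with [S] halved. On a small rectangle near a point, [f] may be replaced by its
    difference with its affine Taylor polynomial, which has a primitive; this difference is at most
    [e * S] on the boundary. *)
Lemma goursat f a b c d : a <= b -> c <= d -> continuous f ->
  (forall z, in_rect a b c d z -> derivable f z 1) -> rect_int f a b c d = 0.
Proof.
move=> ab cd cf df.
have key (e : R) : 0 < e -> n1 (rect_int f a b c d) <= 4 * e * ((b - a) + (d - c)) ^+ 2.
  move=> e0.
  apply: (quad_induction (P := fun a b c d =>
    n1 (rect_int f a b c d) <= 4 * e * ((b - a) + (d - c)) ^+ 2)) => //.
  - move=> a1 b1 c1 d1 ab1 cd1 q1 q2 q3 q4.
    rewrite (rect_int_splitx _ a1 ((a1 + b1) / 2)) !(rect_int_splity _ _ _ c1 ((c1 + d1) / 2) d1).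
    apply: (le_trans (n1D _ _)).
    apply: (le_trans (lerD (n1D _ _) (n1D _ _))).
    apply: (le_trans (lerD (lerD q1 q3) (lerD q2 q4))).
    by rewrite le_eqVlt; apply/orP; left; apply/eqP; field.
  - move=> p q pab qcd; pose z0 := ver p q.
    have dz0 : derivable f z0 1 by apply: df; rewrite /in_rect re_ver im_ver.
    have [D hD] : exists D, is_derive z0 1 f D by exists (derive1 f z0); exact: derivable_isCd.
    have [h h0 Hh] := (isCdP f z0 D).1 hD e e0.
    exists (h / 2); first by rewrite divr_gt0.
    move=> a1 b1 c1 d1 /andP[a1a a1p] /andP[pb1 b1b] /andP[c1c c1q] /andP[qd1 d1d] ab1 cd1.
    have ab' : a1 <= b1 by exact: le_trans pb1.
    have cd' : c1 <= d1 by exact: le_trans qd1.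
    pose A (z : C R) : C R := (f z0 - D * z0) + D * z.
    pose E (z : C R) : C R := f z + -1 * A z.
    have cA : continuous A by exact: continuous_affine.
    have cE : continuous E.
      by move=> z; apply: (@contD _ f (fun w => -1 * A w)); [exact: cf|apply: contM; [exact: cont_cst|exact: cA]].
    have IA : rect_int A a1 b1 c1 d1 = 0.
      apply: (@rect_int_prim A (fun z => (f z0 - D * z0) * z + D / 2 * (z * z)) a1 b1 c1 d1 ab' cd').
        exact: rect_cont_cont.
      by move=> z _; exact: is_derive_quadratic.
    have fE : rect_int f a1 b1 c1 d1 = rect_int E a1 b1 c1 d1.
      rewrite /E rect_intD//; [|exact: rect_cont_cont|by apply: rect_contZ; exact: rect_cont_cont].
      by rewrite rect_intZ//; [rewrite IA mulr0 addr0|exact: rect_cont_cont].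
    rewrite fE; apply: (@le_trans _ _ (4 * (e * ((b1 - a1) + (d1 - c1))) * ((b1 - a1) + (d1 - c1)))).
      apply: rect_int_le => //; first exact: rect_cont_cont.
      move=> z [/andP[z1 z2] /andP[z3 z4]] _.
      have zz : n1 (z - z0) <= (b1 - a1) + (d1 - c1).
        rewrite /n1 reD imD reN imN re_ver im_ver; apply: lerD; rewrite ler_norml; lra.
      have := Hh (z - z0); have -> : z0 + (z - z0) = z by ring.
      have -> : f z - f z0 - D * (z - z0) = E z by rewrite /E /A; ring.
      move=> /(_ _)/le_trans; apply; first by apply: le_lt_trans zz _; lra.
      by rewrite ler_pM2l.
    by rewrite expr2 !mulrA.
apply: n1_small => e e0.
pose K := 4 * ((b - a) + (d - c)) ^+ 2 + 1.
have K0 : 0 < K by rewrite /K; have := sqr_ge0 ((b - a) + (d - c)); lra.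
have := key (e / K); rewrite divr_gt0// => /(_ isT)/le_trans; apply.
rewrite (_ : 4 * _ * _ = e * ((4 * ((b - a) + (d - c)) ^+ 2) / K)); last by field; rewrite gt_eqF.
by rewrite ger_pMr// ler_pdivrMr// mul1r /K; lra.
Qed.

(** A square of half-side [del] around [p] is cut out; the four remaining rectangles avoid [p], and
    near [p] continuity bounds [f] by [K], so that the integral is at most [16 * K * del]. *)
Lemma goursat_punctured f p a b c d :
  a < re p < b -> c < im p < d -> continuous f ->
  (forall z, in_rect a b c d z -> z != p -> derivable f z 1) -> rect_int f a b c d = 0.
Proof.
move=> /andP[ap pb] /andP[cp pd] cf df.
apply: n1_small => e e0.
have [h h0 Hh] := (contCP f p).1 (cf p) 1 ltr01.
pose K := n1 (f p) + 1.
have K0 : 0 < K by rewrite /K; have := n1_ge0 (f p); lra.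
pose del := Num.min (Num.min (Num.min (re p - a) (b - re p)) (Num.min (im p - c) (d - im p)))
   (Num.min (h / 3) (e / (16 * K))).
have del0 : 0 < del.
  by rewrite !lt_min !subr_gt0 ap pb cp pd /= !divr_gt0 ?mulr_gt0.
have [d1 d2 d3 d4] : [/\ del <= re p - a, del <= b - re p, del <= im p - c & del <= d - im p].
  by split; rewrite !ge_min lexx ?orbT.
have d5 : del <= h / 3 by rewrite !ge_min lexx ?orbT.
have d6 : del <= e / (16 * K) by rewrite !ge_min lexx ?orbT.
have np z : (re z <> re p) \/ (im z <> im p) -> z != p.
  by move=> hz; apply/eqP => zp; move: hz; rewrite zp; case.
rewrite (rect_int_splitx _ a (re p - del)) (rect_int_splitx _ (re p - del) (re p + del)).
rewrite (rect_int_splity _ (re p - del) (re p + del) c (im p - del)).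
rewrite (rect_int_splity _ (re p - del) (re p + del) (im p - del) (im p + del)).
rewrite (goursat (a := a))//; [|lra|lra|]; last first.
  move=> z [/andP[z1 z2] /andP[z3 z4]]; apply: df; first by split; apply/andP; split=> //; lra.
  by apply: np; left; lra.
rewrite (goursat (b := b))//; [|lra|lra|]; last first.
  move=> z [/andP[z1 z2] /andP[z3 z4]]; apply: df; first by split; apply/andP; split=> //; lra.
  by apply: np; left; lra.
rewrite (goursat (c := c))//; [|lra|lra|]; last first.
  move=> z [/andP[z1 z2] /andP[z3 z4]]; apply: df; first by split; apply/andP; split=> //; lra.
  by apply: np; right; lra.
rewrite (goursat (d := d))//; [|lra|lra|]; last first.
  move=> z [/andP[z1 z2] /andP[z3 z4]]; apply: df; first by split; apply/andP; split=> //; lra.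
  by apply: np; right; lra.
rewrite !(add0r, addr0).
apply: (@le_trans _ _ (4 * K * ((re p + del - (re p - del)) + (im p + del - (im p - del))))).
  apply: rect_int_le; [lra|lra|exact: rect_cont_cont|].
  move=> z [/andP[z1 z2] /andP[z3 z4]] _.
  have zp : n1 (z - p) < h.
    apply: (@le_lt_trans _ _ (del + del)); last lra.
    by rewrite /n1 reD imD reN imN; apply: lerD; rewrite ler_norml; lra.
  have := Hh _ zp; have := n1D (f z - f p) (f p).
  have -> : f z - f p + f p = f z by ring.
  by rewrite /K; lra.
apply: (@le_trans _ _ (16 * K * (e / (16 * K)))).
  have -> : 4 * K * ((re p + del - (re p - del)) + (im p + del - (im p - del))) = 16 * K * del by ring.
  by rewrite ler_wpM2l// mulr_ge0// ltW.
by rewrite le_eqVlt; apply/orP; left; apply/eqP; field; rewrite gt_eqF.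
Qed.

End Goursat.

(** * Cauchy's formula on a square *)

Section CauchySquare.
Variable R : realType.
Variable r : R.
Hypothesis r0 : 0 < r.
Implicit Types (z w u : C R) (f g : C R -> C R).

Definition square_int f : C R := rect_int f (- r) r (- r) r.
Definition square_cont f : Prop := rect_cont f (- r) r (- r) r.
Definition on_square z : Prop := on_lines (- r) r (- r) r z.
Definition in_square z : Prop := `|re z| < r /\ `|im z| < r.
Definition in_csquare z : Prop := in_rect (- r) r (- r) r z.

(** By [depth_le], a lower bound for the [n1] distance from [w] to the four lines carrying the
    sides. *)
Definition depth w : R := Num.min (r - `|re w|) (r - `|im w|).

Lemma depth_gt0 w : in_square w -> 0 < depth w.
Proof. by move=> [h1 h2]; rewrite lt_min !subr_gt0 h1. Qed.

Lemma depth_le z w : on_square z -> depth w <= n1 (z - w).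
Proof.
have r1 : r = `|r| by rewrite ger0_norm// ltW.
have key (s t : R) : `|s| = r -> r - `|t| <= `|s - t|.
  by move=> <-; have := ler_normD (s - t) t; rewrite subrK; lra.
rewrite /depth => H; rewrite /n1 reD imD reN imN.
have := normr_ge0 (re z - re w); have := normr_ge0 (im z - im w) => i0 j0.
rewrite ge_min; apply/orP.
have keyi : `|im z| = r -> r - `|im w| <= `|re z - re w| + `|im z - im w|.
  by move=> /(key _ (im w)); lra.
have keyr : `|re z| = r -> r - `|re w| <= `|re z - re w| + `|im z - im w|.
  by move=> /(key _ (re w)); lra.
by case: H => -[]H; [right; apply: keyi|right; apply: keyi|left; apply: keyr|left; apply: keyr];
  rewrite H ?normrN -r1.
Qed.

Lemma on_square_neq z w : in_square w -> on_square z -> z - w != 0.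
Proof.
move=> /depth_gt0 w0 /(depth_le w) zw; apply/eqP => zw0.
by move: zw; rewrite zw0 n1_0; lra.
Qed.

Lemma n1_inv_le z w : in_square w -> on_square z -> n1 (z - w)^-1 <= 2 / depth w.
Proof.
move=> iw oz; apply: (le_trans (n1V _)).
rewrite ler_pM2l// lef_pV2 ?posrE; first exact: depth_le.
- by apply: n1_gt0; exact: on_square_neq.
- exact: depth_gt0.
Qed.

Lemma square_cont_inv w : in_square w -> square_cont (fun z => (z - w)^-1).
Proof.
move=> iw; split; split; apply: ccontV.
all: try (apply: ccontD; [exact: ccont_line|exact: ccont_cst]).
all: move=> t; apply: on_square_neq => //; rewrite /on_square /on_lines ?im_hor ?re_ver.
- by left; left.
- by left; right.
- by right; left.
- by right; right.
Qed.

(** Cauchy integrals with the kernel [1 / (z - w)] and its first two derivatives in [w], without the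
    factor [1 / (2 pi i)]. *)
Definition cauchy1 g w : C R := square_int (fun z => g z * (z - w)^-1).
Definition cauchy2 g w : C R := square_int (fun z => g z * ((z - w)^-1 * (z - w)^-1)).
Definition cauchy3 g w : C R :=
  square_int (fun z => g z * (2 * ((z - w)^-1 * (z - w)^-1 * (z - w)^-1))).

Let rr : - r <= r.
Proof. by have := r0; lra. Qed.

Lemma square_int_le f M : square_cont f ->
  (forall z, in_csquare z -> on_square z -> n1 (f z) <= M) ->
  n1 (square_int f) <= 16 * M * r.
Proof.
move=> cf fM.
apply: (le_trans (rect_int_le rr rr cf fM)).
by rewrite le_eqVlt; apply/orP; left; apply/eqP; ring.
Qed.

Lemma ccont_bounded (phi : R -> C R) (a b : R) : a <= b -> ccont phi ->
  exists M : R, forall t, a <= t <= b -> n1 (phi t) <= M.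
Proof.
move=> ab [c1 c2].
have cn : continuous (fun t => `|re (phi t)| + `|im (phi t)|).
  by move=> t; apply: cvgD; apply: cvg_norm; [exact: c1|exact: c2].
have [|s sab sM] := @EVT_max R (fun t => `|re (phi t)| + `|im (phi t)|) a b ab.
  by apply: continuous_subspaceT.
exists (n1 (phi s)) => t tab; apply: sM; by rewrite in_itv.
Qed.

Lemma square_bounded g : square_cont g ->
  exists2 M : R, 0 < M & forall z, in_csquare z -> on_square z -> n1 (g z) <= M.
Proof.
move=> [[/(ccont_bounded rr) [M1 H1] /(ccont_bounded rr) [M2 H2]]].
move=> [/(ccont_bounded rr) [M3 H3] /(ccont_bounded rr) [M4 H4]].
have horE z c : im z = c -> z = hor c (re z).
  by move=> zc; apply: complex_eqP; rewrite ?re_hor ?im_hor.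
have verE z c : re z = c -> z = ver c (im z).
  by move=> zc; apply: complex_eqP; rewrite ?re_ver ?im_ver.
exists (`|M1| + `|M2| + `|M3| + `|M4| + 1).
  by have := normr_ge0 M1; have := normr_ge0 M2; have := normr_ge0 M3; have := normr_ge0 M4; lra.
move=> z [z1 z2] oz.
have := ler_norm M1; have := ler_norm M2; have := ler_norm M3; have := ler_norm M4.
have := normr_ge0 M1; have := normr_ge0 M2; have := normr_ge0 M3; have := normr_ge0 M4.
case: oz => -[]zE.
- by rewrite (horE _ _ zE); have := H1 _ z1; lra.
- by rewrite (horE _ _ zE); have := H2 _ z1; lra.
- by rewrite (verE _ _ zE); have := H3 _ z2; lra.
- by rewrite (verE _ _ zE); have := H4 _ z2; lra.
Qed.

(* Quadratic Taylor remainder of the kernel, uniform on the square, gives the derivative of the integral. *)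
Lemma kernel_derive g (kap : C R -> C R -> C R) (kap1 : C R -> C R) (E : C R -> C R -> C R)
    (w : C R) (del B : R) : 0 < del ->
  square_cont g -> (forall u, n1 u < del -> square_cont (kap u)) -> square_cont kap1 ->
  (forall u z, n1 u < del -> on_square z ->
     kap u z = kap 0 z + u * kap1 z + u * u * E u z /\ n1 (E u z) <= B) ->
  is_derive w 1 (fun w' => square_int (fun z => g z * kap (w' - w) z))
    (square_int (fun z => g z * kap1 z)).
Proof.
move=> del0 cg ck ck1 HE; apply/isCdP => e e0.
have [M M0 gM] := square_bounded cg.
pose K := 16 * (M * `|B|) * r + 1.
have K1 : 0 <= 16 * (M * `|B|) * r by rewrite !mulr_ge0// ltW.
have K0 : 0 < K by rewrite /K; lra.
exists (Num.min del (e / K)); first by rewrite lt_min del0 divr_gt0.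
move=> u; rewrite lt_min ltr_pdivlMr// => /andP[ud uK].
have c0 := ck 0; rewrite n1_0 in c0; have {}c0 := c0 del0.
have cu := ck _ ud.
have -> : w + u - w = u by ring.
rewrite subrr.
have k1 : square_cont (fun z => g z * kap u z) by exact: rect_contM.
have k2 : square_cont (fun z => -1 * (g z * kap 0 z)) by apply: rect_contZ; exact: rect_contM.
have k3 : square_cont (fun z => - u * (g z * kap1 z)) by apply: rect_contZ; exact: rect_contM.
have -> : square_int (fun z => g z * kap u z) - square_int (fun z => g z * kap 0 z) -
    square_int (fun z => g z * kap1 z) * u =
  square_int (fun z => g z * kap u z + -1 * (g z * kap 0 z) + - u * (g z * kap1 z)).
  rewrite /square_int rect_intD//; last exact: rect_contD.
  rewrite rect_intD// !rect_intZ//; [ring| |]; exact: rect_contM.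
apply: (@le_trans _ _ (16 * (M * (n1 u * n1 u * `|B|)) * r)).
  apply: square_int_le; first by apply: rect_contD => //; exact: rect_contD.
  move=> z iz oz; have [-> EB] := HE u z ud oz.
  have -> : g z * (kap 0 z + u * kap1 z + u * u * E u z) + -1 * (g z * kap 0 z) +
    - u * (g z * kap1 z) = g z * (u * u * E u z) by ring.
  apply: (le_trans (n1M _ _)); apply: ler_pM; rewrite ?n1_ge0//; first exact: gM.
  apply: (le_trans (n1M _ _)); apply: ler_pM; rewrite ?n1_ge0//; first exact: n1M.
  by apply: le_trans EB (ler_norm _).
have -> : 16 * (M * (n1 u * n1 u * `|B|)) * r = (16 * (M * `|B|) * r * n1 u) * n1 u by ring.
rewrite ler_wpM2r ?n1_ge0//; apply: le_trans (ltW uK).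
by rewrite mulrC ler_wpM2l ?n1_ge0// /K; lra.
Qed.

Lemma in_square_near w u : in_square w -> n1 u < depth w / 2 ->
  in_square (w + u) /\ depth w / 2 <= depth (w + u).
Proof.
move=> iw; have w0 := depth_gt0 iw; rewrite /n1 => ud.
have [d1 d2] : depth w <= r - `|re w| /\ depth w <= r - `|im w|.
  by rewrite /depth !ge_min !lexx ?orbT.
have h1 := ler_normD (re w) (re u); have h2 := ler_normD (im w) (im u).
have := normr_ge0 (re u); have := normr_ge0 (im u) => i0 j0.
split; first by split; rewrite ?reD ?imD; lra.
rewrite [depth (w + u)]/depth reD imD le_min; apply/andP; split; lra.
Qed.

Lemma cauchy1_derive g w : square_cont g -> in_square w ->
  is_derive w 1 (cauchy1 g) (cauchy2 g w).
Proof.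
move=> cg iw; have w0 := depth_gt0 iw.
(* Moving [w] by less than half its depth leaves half the depth, and [n1_inv_le] then bounds the
   kernel by [2 / (depth w / 2)]. *)
pose be := 4 / depth w.
have be0 : 0 < be by rewrite divr_gt0.
(* With [A = z - w] the expansion is exact: [1 / (A - u) = 1 / A + u / A ^ 2 + u ^ 2 / (A ^ 2 (A -
   u))]. *)
have H := @kernel_derive g (fun u z => (z - (w + u))^-1) (fun z => (z - w)^-1 * (z - w)^-1)
  (fun u z => (z - w)^-1 * (z - w)^-1 * (z - (w + u))^-1) w (depth w / 2) (be * be * be).
have HE : (fun w' => square_int (fun z => g z * (z - (w + (w' - w)))^-1)) = cauchy1 g.
  apply/funext => w'; rewrite /cauchy1; congr square_int; apply/funext => z.
  by have -> : w + (w' - w) = w' by ring.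
rewrite HE in H; apply: H => //; first by rewrite divr_gt0.
- by move=> u /(in_square_near iw) [iu _]; exact: square_cont_inv.
- by apply: rect_contM; exact: square_cont_inv.
- move=> u z ud oz; have [iu du] := in_square_near iw ud.
  have z0 := on_square_neq iw oz; have z1 := on_square_neq iu oz; rewrite addr0; split.
    rewrite /=; field; apply/andP; split=> //.
  have b1 : n1 (z - w)^-1 <= be.
    by apply: (le_trans (n1_inv_le iw oz)); rewrite /be ler_pM2r ?invr_gt0// ler_nat.
  have b2 : n1 (z - (w + u))^-1 <= be.
    apply: (le_trans (n1_inv_le iu oz)).
    have -> : be = 2 / (depth w / 2) by rewrite /be; field; rewrite gt_eqF.
    by rewrite ler_pM2l// lef_pV2// posrE ?divr_gt0//; exact: depth_gt0.
  apply: (le_trans (n1M _ _)); apply: ler_pM; rewrite ?n1_ge0//.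
  by apply: (le_trans (n1M _ _)); apply: ler_pM; rewrite ?n1_ge0.
Qed.

Lemma cauchy2_derive g w : square_cont g -> in_square w ->
  is_derive w 1 (cauchy2 g) (cauchy3 g w).
Proof.
move=> cg iw; have w0 := depth_gt0 iw.
pose be := 4 / depth w.
have be0 : 0 < be by rewrite divr_gt0.
pose a (z : C R) := (z - w)^-1; pose b (u z : C R) := (z - (w + u))^-1.
(* From [b - a = u a b] one gets [b ^ 2 - a ^ 2 - 2 u a ^ 3 = u a (b - a) (b + 2 a) = u ^ 2 a ^ 2 b
   (2 a + b)]. *)
have H := @kernel_derive g (fun u z => b u z * b u z) (fun z => 2 * (a z * a z * a z))
  (fun u z => a z * a z * (b u z * (a z + a z + b u z)))
  w (depth w / 2) (be * be * (be * (be + be + be))).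
have HE : (fun w' => square_int (fun z => g z * (b (w' - w) z * b (w' - w) z))) = cauchy2 g.
  apply/funext => w'; rewrite /cauchy2 /b; congr square_int; apply/funext => z.
  by have -> : w + (w' - w) = w' by ring.
rewrite HE in H; apply: H => //; first by rewrite divr_gt0.
- by move=> u /(in_square_near iw) [iu _]; apply: rect_contM; exact: square_cont_inv.
- apply: rect_contZ; apply: rect_contM; last exact: square_cont_inv.
  by apply: rect_contM; exact: square_cont_inv.
- move=> u z ud oz; have [iu du] := in_square_near iw ud.
  have z0 := on_square_neq iw oz; have z1 := on_square_neq iu oz; rewrite /b addr0 /a; split.
    rewrite /=; field; apply/andP; split=> //.
  have b1 : n1 (z - w)^-1 <= be.
    by apply: (le_trans (n1_inv_le iw oz)); rewrite /be ler_pM2r ?invr_gt0// ler_nat.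
  have b2 : n1 (z - (w + u))^-1 <= be.
    apply: (le_trans (n1_inv_le iu oz)).
    have -> : be = 2 / (depth w / 2) by rewrite /be; field; rewrite gt_eqF.
    by rewrite ler_pM2l// lef_pV2// posrE ?divr_gt0//; exact: depth_gt0.
  apply: (le_trans (n1M _ _)); apply: ler_pM; rewrite ?n1_ge0//.
    by apply: (le_trans (n1M _ _)); apply: ler_pM; rewrite ?n1_ge0.
  apply: (le_trans (n1M _ _)); apply: ler_pM; rewrite ?n1_ge0//.
  by apply: (le_trans (n1D _ _)); apply: lerD => //; apply: (le_trans (n1D _ _)); exact: lerD.
Qed.

(** The quotient [(f z - f w) / (z - w)], completed by the derivative at [w], is continuous and
    holomorphic off [w], so [goursat_punctured] applies to it. The constant [2 pi i] is left as the
    Cauchy integral of 1. *)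
Lemma cauchy_formula f w : continuous f ->
  (forall z, in_csquare z -> derivable f z 1) -> in_square w ->
  cauchy1 f w = f w * cauchy1 (fun=> 1) w.
Proof.
move=> cf df iw; have [w1 w2] := iw; move: w1 w2; rewrite !ltr_norml => w1 w2.
have dw : derivable f w 1 by apply: df; split; apply/andP; split; lra.
pose Q z := if z == w then derive1 f w else (f z - f w) * (z - w)^-1.
have nearQ z : z != w -> \forall z' \near z, (f z' - f w) * (z' - w)^-1 = Q z'.
  move=> zw; apply/nbhsCP; exists (n1 (z - w)); first by apply: n1_gt0; rewrite subr_eq0.
  move=> z' z'z; rewrite /Q ifF//; apply/negbTE; apply: contraTN z'z => /eqP ->.
  by rewrite n1_sym ltxx.
have dQ z : in_csquare z -> z != w -> derivable Q z 1.
  move=> iz zw; apply: near_eq_derivable (nearQ z zw) _.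
  apply: cderivableM; first by apply: cderivableD; [exact: df|exact: cderivable_cst].
  apply: cderivableV; first by rewrite subr_eq0.
  by apply: cderivableD; [exact: cderivable_id|exact: cderivable_cst].
have cQ : continuous Q.
  move=> z; have [->|zw] := eqVneq z w.
  - apply/contCP => e e0.
    have e30 : 0 < e / 3 by rewrite divr_gt0.
    have [d d0 dh] := (isCdP f w _).1 (derivable_isCd dw) _ e30.
    exists d => // z' zw'; rewrite /Q eqxx; have [z'w|z'w] := eqVneq z' w; first by rewrite subrr n1_0.
    have z0 : z' - w != 0 by rewrite subr_eq0.
    have := dh _ zw'; have -> : w + (z' - w) = z' by ring.
    move=> H; have -> : (f z' - f w) * (z' - w)^-1 - derive1 f w =
      (f z' - f w - derive1 f w * (z' - w)) * (z' - w)^-1 by field.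
    have n0 := n1_gt0 z0.
    apply: (le_lt_trans (n1M _ _)); apply: (le_lt_trans (ler_wpM2l (n1_ge0 _) (n1V _))).
    apply: (le_lt_trans (ler_wpM2r _ H)); first by rewrite divr_ge0// ltW.
    have -> : e / 3 * n1 (z' - w) * (2 / n1 (z' - w)) = e * 2 / 3 by field; rewrite gt_eqF.
    lra.
  - apply: cont_near (nearQ z zw) _; apply: contM; first by apply: contD; [exact: cf|exact: cont_cst].
    by apply: contV; [rewrite subr_eq0|apply: contD; [exact: cont_id|exact: cont_cst]].
have I0 : square_int Q = 0.
  by apply: (@goursat_punctured _ Q w) => // z iz zw; exact: dQ.
have k1 : square_cont Q by exact: rect_cont_cont.
have k2 : square_cont (fun z => 1 * (z - w)^-1).
  by apply: rect_contZ; exact: square_cont_inv.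
have -> : cauchy1 f w = square_int (fun z => Q z + f w * (1 * (z - w)^-1)).
  apply: rect_int_ext => z oz; have z0 := on_square_neq iw oz.
  by rewrite /Q ifF; [ring|rewrite -subr_eq0; exact/negbTE].
by rewrite /square_int rect_intD//; [rewrite rect_intZ// [rect_int Q _ _ _ _]I0 add0r|exact: rect_contZ].
Qed.

Lemma in_square0 : in_square 0.
Proof. by split; rewrite normr0. Qed.

(** On each side of the square the integrand, multiplied by the velocity, has imaginary part
    [r / (t ^ 2 + r ^ 2) >= 1 / (2 r)], so each side contributes at least 1 to the imaginary part of
    the integral. *)
Lemma cauchy1_one_neq0 : cauchy1 (fun=> 1) 0 != 0.
Proof.
have cinv := square_cont_inv in_square0.
have [[c1 c2] [c3 c4]] : square_cont (fun z => 1 * (z - 0)^-1) by exact: rect_contZ.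
suff : 0 < im (cauchy1 (fun=> 1) 0).
  by apply: contraTneq => ->; rewrite im0 ltxx.
have N1 (phi : R -> C R) : - curve_int phi (-r) r = -1 * curve_int phi (-r) r by rewrite mulN1r.
rewrite /cauchy1 /square_int /rect_int -mulrN !N1 -!curve_intZ//; last first.
  exact: ccontZ.
have invE z : z != 0 -> z^-1 = z^* * toC (re z ^+ 2 + im z ^+ 2)^-1.
  move=> z0; apply: (mulfI z0); rewrite mulfV// mulrA -normCK normE -rmorphXn /= sqr_sqrtr.
    rewrite -rmorphM /= mulfV// paddr_eq0 ?sqr_ge0// !sqrf_eq0.
    by apply: contra z0 => /andP[/eqP h1 /eqP h2]; apply/eqP/complex_eqP.
  by rewrite addr_ge0// sqr_ge0.
have low (t : R) : - r <= t <= r -> (2 * r)^-1 <= r / (t ^+ 2 + r ^+ 2).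
  move=> /andP[t1 t2].
  have q0 : 0 < t ^+ 2 + r ^+ 2 by have := sqr_ge0 t; have := exprn_gt0 2 r0; lra.
  rewrite ler_pdivlMr// mulrC ler_pdivrMr ?mulr_gt0//; nra.
have part (phi : R -> C R) : ccont phi -> (forall t, im (phi t) = r / (t ^+ 2 + r ^+ 2)) ->
    1 <= im (curve_int phi (- r) r).
  move=> cp pE; have := @curve_int_im_ge _ phi (- r) r (2 * r)^-1 rr cp.
  have -> : (2 * r)^-1 * (r - - r) = 1 by field; rewrite gt_eqF.
  by apply=> t tr; rewrite pE; exact: low.
have horn0 (c : R) t : c != 0 -> hor c t != 0.
  by apply: contra => /eqP h; rewrite -(im_hor c t) h.
have vern0 (c : R) t : c != 0 -> ver c t != 0.
  by apply: contra => /eqP h; rewrite -(re_ver c t) h.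
have rn0 : r != 0 by rewrite gt_eqF.
have nrn0 : - r != 0 by rewrite oppr_eq0.
have p1 := part _ c1; have p2 := part _ (ccontZ (imag R) c4).
have p3 := part _ (ccontZ (-1) c2); have p4 := part _ (ccontZ (imag R) (ccontZ (-1) c3)).
have {}p1 : 1 <= im (curve_int (fun t => 1 * (hor (- r) t - 0)^-1) (- r) r).
  apply: p1 => t; rewrite mul1r subr0 invE ?horn0//.
  by rewrite imM re_conj im_conj re_toC im_toC re_hor im_hor sqrrN; ring.
have {}p2 : 1 <= im (curve_int (fun t => imag R * (1 * (ver r t - 0)^-1)) (- r) r).
  apply: p2 => t; rewrite mul1r subr0 invE ?vern0//.
  by rewrite !(imM, reM) re_conj im_conj re_toC im_toC re_ver im_ver re_imag im_imag addrC [r ^+ 2 + _]addrC; ring.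
have {}p3 : 1 <= im (curve_int (fun t => -1 * (1 * (hor r t - 0)^-1)) (- r) r).
  apply: p3 => t; rewrite mul1r subr0 mulN1r imN invE ?horn0//.
  by rewrite imM re_conj im_conj re_toC im_toC re_hor im_hor; ring.
have {}p4 : 1 <= im (curve_int (fun t => imag R * (-1 * (1 * (ver (- r) t - 0)^-1))) (- r) r).
  apply: p4 => t; rewrite mul1r subr0 mulN1r invE ?vern0//.
  by rewrite !(imM, reM, reN, imN) re_conj im_conj re_toC im_toC re_ver im_ver re_imag im_imag sqrrN addrC [r ^+ 2 + _]addrC; ring.
have pos (v : C R) : 1 <= im v -> 0 < im v by exact: lt_le_trans.
by rewrite imD; apply: addr_gt0; [rewrite imD; apply: addr_gt0;
  [rewrite imD; apply: addr_gt0|]|]; apply: pos.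
Qed.

Lemma is_deriveC_quot (G c : C R -> C R) (G' c' z : C R) : c z != 0 ->
  is_derive z 1 G G' -> is_derive z 1 c c' ->
  is_derive z 1 (fun w => G w * (c w)^-1) (G' * (c z)^-1 - G z * c' * ((c z)^-1 * (c z)^-1)).
Proof.
move=> c0 dG dc; have dV := derivableV c0 (@ex_derive _ _ _ _ _ _ _ dc).
have vV := deriveV c0 (@ex_derive _ _ _ _ _ _ _ dc).
have hV : is_derive z 1 (fun w => (c w)^-1) (- (c z ^- 2) *: c').
  by apply: DeriveDef; [exact: dV|rewrite vV (@derive_val _ _ _ _ _ _ _ dc)].
apply: is_derive_eq (is_deriveM dG hV) _.
rewrite /GRing.scale /= expr2; field; exact: c0.
Qed.

(** Allows division by the Cauchy integral of 1 near the centre. Its continuity at 0 does the work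
    of its being constant. *)
Lemma cauchy_near0 : exists2 e : R, 0 < e &
  forall w, n1 w < e -> in_square w /\ n1 (cauchy1 (fun=> 1) 0) / 2 < n1 (cauchy1 (fun=> 1) w).
Proof.
have c1 : square_cont (fun=> 1) by split; split; exact: ccont_cst.
have c0 := n1_gt0 cauchy1_one_neq0.
have [dc _] := cauchy1_derive c1 in_square0.
have c20 : 0 < n1 (cauchy1 (fun=> 1) 0) / 2 by rewrite divr_gt0.
have [d d0 dh] := (contCP _ _).1 (derivable_cont dc) _ c20.
exists (Num.min d r); first by rewrite lt_min d0.
move=> w; rewrite lt_min => /andP[wd wr]; split.
  by split; [exact: le_lt_trans (re_le_n1 _) wr|exact: le_lt_trans (im_le_n1 _) wr].
have := dh w; rewrite subr0 => /(_ wd).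
have := n1D (cauchy1 (fun=> 1) w) (cauchy1 (fun=> 1) 0 - cauchy1 (fun=> 1) w).
have -> : cauchy1 (fun=> 1) w + (cauchy1 (fun=> 1) 0 - cauchy1 (fun=> 1) w) =
  cauchy1 (fun=> 1) 0 by ring.
rewrite (n1_sym (cauchy1 (fun=> 1) 0) (cauchy1 (fun=> 1) w)); lra.
Qed.

(** Near 0 the function is the quotient of the Cauchy integrals of [f] and of 1. The quotient rule
    expresses its derivative by [cauchy1] and [cauchy2], which are differentiable again. *)
Lemma derivable_derive1_square f : continuous f ->
  (forall z, in_csquare z -> derivable f z 1) -> derivable (derive1 f) 0 1.
Proof.
move=> cf df; have [e e0 eP] := cauchy_near0.
pose c := cauchy1 (fun=> 1).
have one : square_cont (fun=> 1) by split; split; exact: ccont_cst.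
have sf : square_cont f by exact: rect_cont_cont.
have c0 w : n1 w < e -> c w != 0.
  move=> /eP [_ H]; apply/eqP => cw; move: H.
  by rewrite [X in _ < n1 X]cw n1_0 ltNge divr_ge0// n1_ge0.
have fE w : n1 w < e -> f w = cauchy1 f w * (c w)^-1.
  by move=> we; have [iw _] := eP w we; rewrite (cauchy_formula cf df iw) mulfK// c0.
have near0 w : n1 w < e -> \forall w' \near w, n1 w' < e.
  move=> we; apply/nbhsCP; exists (e - n1 w); first by rewrite subr_gt0.
  move=> w' w'w; have := n1D (w' - w) w; have -> : w' - w + w = w' by ring.
  lra.
pose D w := cauchy2 f w * (c w)^-1 - cauchy1 f w * cauchy2 (fun=> 1) w * ((c w)^-1 * (c w)^-1).
have dE w : n1 w < e -> derive1 f w = D w.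
  move=> we; have [iw _] := eP w we.
  have h := is_deriveC_quot (c0 w we) (cauchy1_derive sf iw) (cauchy1_derive one iw).
  have h' : is_derive w 1 f (D w).
    apply: near_eq_is_derive h; apply: filterS (near0 w we) => w' /fE; exact: esym.
  by rewrite derive1E; exact: derive_val.
have e00 : n1 (0 : C R) < e by rewrite n1_0.
have d1 : derivable (cauchy1 f) 0 1 by have [] := cauchy1_derive sf in_square0.
have d2 : derivable (cauchy2 f) 0 1 by have [] := cauchy2_derive sf in_square0.
have d3 : derivable c 0 1 by have [] := cauchy1_derive one in_square0.
have d4 : derivable (cauchy2 (fun=> 1)) 0 1 by have [] := cauchy2_derive one in_square0.
have d5 : derivable (fun w => (c w)^-1) 0 1 by apply: cderivableV => //; exact: c0.
have dD : derivable D 0 1.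
  have -> : D = (fun w => cauchy2 f w * (c w)^-1 +
      (-1 * cauchy1 f w) * cauchy2 (fun=> 1) w * ((c w)^-1 * (c w)^-1)).
    by apply/funext => w; rewrite /D; ring.
  apply: cderivableD; first exact: cderivableM.
  apply: cderivableM; last exact: cderivableM.
  by apply: cderivableM; [apply: cderivableM; [exact: cderivable_cst|exact: d1]|exact: d4].
by apply: near_eq_derivable dD; apply: filterS (near0 0 e00) => w /dE; exact: esym.
Qed.

(** The constants do not depend on [f]; this uniformity is what lets [accumulating_zeros] apply the
    estimate to all iterated quotients at once. *)
Lemma cauchy_estimate : exists e : R, exists2 K : R, 0 < e & forall f M, continuous f ->
  (forall z, in_csquare z -> derivable f z 1) ->
  (forall z, in_csquare z -> on_square z -> n1 (f z) <= M) ->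
  forall w, n1 w < e -> n1 (f w) <= K * M.
Proof.
have [e e0 eP] := cauchy_near0.
have c0 := n1_gt0 cauchy1_one_neq0.
set c := n1 (cauchy1 (fun=> 1) 0) in eP c0.
(* [16 * r] comes from [square_int_le], [4 / r] bounds the kernel at depth at least [r / 2], and
   [2 / (c / 2)] bounds the inverse of the Cauchy integral of 1. *)
exists (Num.min e (r / 2)), (16 * (4 / r) * r * (2 / (c / 2))); first by rewrite lt_min e0 divr_gt0.
move=> f M cf df fM w; rewrite lt_min => /andP[we wr].
have [iw cw] := eP w we.
have M0 : 0 <= M.
  apply: le_trans (fM (hor r 0) _ _); first exact: n1_ge0.
  - by split; rewrite ?re_hor ?im_hor; apply/andP; split => //; have := r0; lra.
  - by left; right; rewrite im_hor.
have dep : r / 2 <= depth w.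
  have := re_le_n1 w; have := im_le_n1 w.
  by rewrite /depth le_min => h1 h2; apply/andP; split; lra.
have kf : n1 (cauchy1 f w) <= 16 * (M * (4 / r)) * r.
  apply: square_int_le; first by apply: rect_contM; [exact: rect_cont_cont|exact: square_cont_inv].
  move=> z iz oz; apply: (le_trans (n1M _ _)); apply: ler_pM; rewrite ?n1_ge0//; first exact: fM.
  apply: (le_trans (n1_inv_le iw oz)).
  have -> : 4 / r = 2 / (r / 2) by field; rewrite gt_eqF.
  by rewrite ler_pM2l// lef_pV2// posrE ?divr_gt0//; exact: depth_gt0.
have cw0 : cauchy1 (fun=> 1) w != 0.
  apply: contraTneq cw => ->; rewrite n1_0 -leNgt; lra.
have -> : f w = cauchy1 f w * (cauchy1 (fun=> 1) w)^-1 by rewrite (cauchy_formula cf df iw) mulfK.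
apply: (le_trans (n1M _ _)).
have -> : 16 * (4 / r) * r * (2 / (c / 2)) * M = 16 * (M * (4 / r)) * r * (2 / (c / 2)) by ring.
apply: ler_pM; rewrite ?n1_ge0//; apply: (le_trans (n1V _)).
by rewrite ler_pM2l// lef_pV2 ?posrE ?divr_gt0// ?(ltW cw)//; apply: lt_trans cw; rewrite divr_gt0.
Qed.

End CauchySquare.

(** * Removable singularities and isolated zeros *)

Section Holomorphic.
Variable R : realType.
Implicit Types (z w p u h : C R) (f g : C R -> C R).

Lemma is_derive_translate f p z D :
  is_derive (p + z) 1 f D <-> is_derive z 1 (fun w => f (p + w)) D.
Proof.
split=> /isCdP H; apply/isCdP => e /H[d d0 dh]; exists d => // h /dh.
- by rewrite addrA.
- by rewrite addrA.
Qed.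

Lemma derivable_translate f p z :
  derivable f (p + z) 1 <-> derivable (fun w => f (p + w)) z 1.
Proof.
split=> /derivable_isCd H.
- by have [] := (is_derive_translate _ _ _ _).1 H.
- by have [] := (is_derive_translate _ _ _ _).2 H.
Qed.

(** The lemmas on squares ask for continuity in the whole plane. Composing [f] with the 1-Lipschitz
    retraction onto a square of half-side [e / 4] provides it, and nothing changes near the closed
    square of half-side [e / 8]. *)
Lemma near_square f p : (\forall z \near p, derivable f z 1) ->
  exists r : R, exists2 F : C R -> C R, 0 < r &
    [/\ continuous F, forall z, in_csquare r z -> derivable F z 1 &
        forall z, n1 z < r -> F z = f (p + z)].
Proof.
move=> /nbhsCP[e e0 He].
pose s := e / 4; pose r := e / 8.
have s0 : 0 < s by rewrite divr_gt0.
have r0 : 0 < r by rewrite divr_gt0.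
pose cl (t : R) := Num.max (- s) (Num.min t s).
have clE t : `|t| <= s -> cl t = t.
  rewrite ler_norml => /andP[t1 t2]; rewrite /cl (min_idPl t2).
  exact/max_idPr.
have clb t : `|cl t| <= s.
  rewrite ler_norml /cl le_max lexx /= ge_max ge_min lexx orbT andbT; lra.
have cll t t' : `|cl t - cl t'| <= `|t - t'|.
  have clc x : [\/ x <= - s /\ cl x = - s, (- s <= x <= s) /\ cl x = x | s <= x /\ cl x = s].
    have [x1|x1] := leP x (- s).
      by apply: Or31; split=> //; rewrite /cl (min_idPl _); [exact/max_idPl|lra].
    have [x2|x2] := leP x s; last by apply: Or33; rewrite /cl (min_idPr (ltW x2)); split; [exact: ltW|apply/max_idPr; lra].
    have xs : - s <= x <= s by rewrite x2 ltW.
    have xn : `|x| <= s by rewrite ler_norml.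
    by apply: Or32; split; [rewrite (ltW x1)|exact: clE].
  have := ler_norm (t - t'); have := ler_norm (t' - t); rewrite (distrC t' t) => k1 k2.
  by case: (clc t) => -[+ ->]; case: (clc t') => -[+ ->] => h1 h2;
    rewrite ler_norml; apply/andP; split; lra.
pose clC z : C R := Complex (cl (re z)) (cl (im z)).
have clCb z : n1 (clC z) < e.
  by have := clb (re z); have := clb (im z); rewrite /n1 /clC /= /s; lra.
have clCl z w : n1 (clC z - clC w) <= n1 (z - w).
  by rewrite /n1 !reD !imD !reN !imN /=; apply: lerD; exact: cll.
have clCE z : `|re z| <= s -> `|im z| <= s -> clC z = z.
  by move=> z1 z2; apply: complex_eqP => /=; exact: clE.
have dF z : derivable f (p + clC z) 1.
  by apply: He; have -> : p + clC z - p = clC z by ring.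
exists r, (fun z => f (p + clC z)); first exact: r0.
split.
- move=> z; apply/contCP => e1 e10.
  have [d d0 dh] := (contCP _ _).1 (derivable_cont (dF z)) _ e10.
  exists d => // w wz; apply: dh.
  have -> : p + clC w - (p + clC z) = clC w - clC z by ring.
  exact: le_lt_trans (clCl _ _) wz.
- move=> z [/andP[z1 z2] /andP[z3 z4]].
  have zs w : n1 (w - z) < r -> clC w = w.
    move=> wz; have := re_le_n1 (w - z); have := im_le_n1 (w - z).
    rewrite reD imD reN imN !ler_norml => /andP[i1 i2] /andP[i3 i4].
    by move: wz z1 z2 z3 z4; rewrite /r => wz z1 z2 z3 z4;
      apply: clCE; rewrite ler_norml /s; apply/andP; split; lra.
  have dz : derivable (fun w => f (p + w)) z 1.
    apply/derivable_translate; rewrite -[in p + z](zs z); [exact: dF|by rewrite subrr n1_0].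
  apply: near_eq_derivable dz; apply/nbhsCP; exists r => // w /zs -> //.
- move=> z zr; rewrite clCE//.
  + by have := re_le_n1 z; rewrite /s; move: zr; rewrite /r; lra.
  + by have := im_le_n1 z; rewrite /s; move: zr; rewrite /r; lra.
Qed.

Lemma near_derive1_translate f F p (r : R) : 0 < r ->
  (forall z, n1 z < r -> F z = f (p + z)) ->
  forall z, n1 z < r -> derivable f (p + z) 1 -> derive1 F z = derive1 f (p + z).
Proof.
move=> r0 FE z zr df.
have h := (is_derive_translate f p z _).1 (derivable_isCd df).
rewrite [LHS]derive1E; apply: derive_val; apply: near_eq_is_derive h.
apply/nbhsCP; exists (r - n1 z); first by rewrite subr_gt0.
move=> w wz; rewrite FE//; have := n1D (w - z) z; have -> : w - z + z = w by ring.
lra.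
Qed.

Lemma derivable_derive1 f p : (\forall z \near p, derivable f z 1) ->
  derivable (derive1 f) p 1.
Proof.
move=> nf; have [r [F r0 [cF dF FE]]] := near_square nf.
have dF1 := derivable_derive1_square r0 cF dF.
move: nf => /nbhsCP[e e0 He].
rewrite -[p]addr0; apply/derivable_translate.
apply: near_eq_derivable dF1; apply/nbhsCP; exists (Num.min r e); first by rewrite lt_min r0.
move=> z; rewrite subr0 lt_min => /andP[zr ze]; apply: (near_derive1_translate r0) => //.
by apply: He; have -> : p + z - p = z by ring.
Qed.

Lemma taylor2 f p : (\forall z \near p, derivable f z 1) ->
  forall e : R, 0 < e -> exists2 d : R, 0 < d & forall h, n1 h < d ->
    n1 (f (p + h) - f p - derive1 f p * h - derive1 (derive1 f) p / 2 * (h * h))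
      <= e * (n1 h * n1 h).
Proof.
move=> nf e e0.
have e20 : 0 < e / 2 by rewrite divr_gt0.
have [d1 d10 dh1] := (isCdP _ _ _).1 (derivable_isCd (derivable_derive1 nf)) _ e20.
move: nf => /nbhsCP[d2 d20 dh2].
exists (Num.min d1 d2); first by rewrite lt_min d10.
move=> h; rewrite lt_min => /andP[h1 h2].
(* With this [k] the affine function [k + l * w] is the linearisation of the derivative of [f] at
   [p]. So [F] has derivative [o(h)] along the segment, and the mean value inequality integrates
   it. *)
set l := derive1 (derive1 f) p; pose k := derive1 f p - l * p.
pose F w := f w - (k * w + l / 2 * (w * w)).
have dF w : n1 (w - p) < d2 -> is_derive w 1 F (derive1 f w - (k + l * w)).
  move=> /dh2 dw; exact: (is_deriveB (derivable_isCd dw) (is_derive_quadratic k l w)).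
have scal t : 0 <= t <= 1 -> n1 (h * toC t) <= n1 h.
  move=> /andP[t0 t1]; apply: (le_trans (n1M _ _)).
  by rewrite n1_toC ger0_norm// ler_piMr ?n1_ge0.
have H := @cder_MVT R (fun t => F (p + h * toC t))
  (fun t => (derive1 f (p + h * toC t) - (k + l * (p + h * toC t))) * h) 0 1 (e / 2 * n1 h * n1 h) ler01.
have -> : f (p + h) - f p - derive1 f p * h - l / 2 * (h * h) =
    F (p + h * toC 1) - F (p + h * toC 0).
  by rewrite toC1 toC0 mulr1 mulr0 addr0 /F /k; field.
have -> : e * (n1 h * n1 h) = 2 * (e / 2 * n1 h * n1 h) * (1 - 0) by field.
apply: H => t t01.
- apply: (@cder_comp _ F) (cder_line _ _ _); apply: dF.
  have -> : p + h * toC t - p = h * toC t by ring.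
  exact: le_lt_trans (scal t t01) h2.
- apply: (le_trans (n1M _ _)); rewrite ler_wpM2r ?n1_ge0//.
  have alg (a b c : C R) : a - (b - c * p + c * (p + h * toC t)) = a - b - c * (h * toC t) by ring.
  rewrite /k alg.
  apply: (le_trans (dh1 _ (le_lt_trans (scal t t01) h1))).
  by rewrite ler_wpM2l ?scal// ltW.
Qed.

(** The product [H w = (w - p) * f w] is differentiable at [p] too, with derivative [f p], hence
    holomorphic near [p]. Its second-order Taylor expansion divided by [h] is the first-order
    expansion of [f]. *)
Lemma removable_singularity f p : {for p, continuous f} ->
  (\forall z \near p, z != p -> derivable f z 1) -> derivable f p 1.
Proof.
move=> cf nf; pose H w := (w - p) * f w.
have dsub z : derivable (fun w => w - p) z 1.
  by apply: cderivableD; [exact: cderivable_id|exact: cderivable_cst].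
have Hp : is_derive p 1 H (f p).
  apply/isCdP => e e0; have [d d0 dh] := (contCP _ _).1 cf _ e0.
  exists d => // h hd; have -> : H (p + h) - H p - f p * h = (f (p + h) - f p) * h by rewrite /H; ring.
  apply: (le_trans (n1M _ _)); rewrite ler_wpM2r ?n1_ge0//; apply: ltW; apply: dh.
  by have -> : p + h - p = h by ring.
have nH : \forall z \near p, derivable H z 1.
  apply: filterS nf => z fz; have [->|zp] := eqVneq z p; first by case: Hp.
  by apply: cderivableM; [exact: dsub|exact: fz].
have H1 : derive1 H p = f p by rewrite derive1E; exact: derive_val.
have T := taylor2 nH; rewrite H1 in T.
set l := derive1 (derive1 H) p / 2 in T.
suff : is_derive p 1 f l by case.
apply/isCdP => e e0; have e20 : 0 < e / 2 by rewrite divr_gt0.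
have [d d0 dh] := T _ e20; exists d => // h hd.
have [->|h0] := eqVneq h 0.
  by rewrite addr0 mulr0 subrr subr0 n1_0 mulr0.
have -> : f (p + h) - f p - l * h = (H (p + h) - H p - f p * h - l * (h * h)) * h^-1.
  by rewrite /H; field.
have n0 := n1_gt0 h0.
apply: (le_trans (n1M _ _)).
apply: (@le_trans _ _ (e / 2 * (n1 h * n1 h) * (2 / n1 h))).
  by apply: ler_pM; rewrite ?n1_ge0//; [exact: dh|exact: n1V].
by rewrite le_eqVlt; apply/orP; left; apply/eqP; field; rewrite gt_eqF.
Qed.

Section IsolatedZeros.
Variables (r : R).
Hypothesis r0 : 0 < r.

Let zeros_cluster g := [/\ continuous g, forall z, in_csquare r z -> derivable g z 1 &
  forall d : R, 0 < d -> exists w, [/\ w != 0, n1 w < d & g w = 0]].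

Let acc_eq0 g : {for 0, continuous g} ->
  (forall d : R, 0 < d -> exists w, [/\ w != 0, n1 w < d & g w = 0]) -> g 0 = 0.
Proof.
move=> /contCP cg ag; apply: n1_small => e e0; have [d d0 dh] := cg _ e0.
have [w [_ wd gw]] := ag _ d0.
by have := dh w; rewrite subr0 => /(_ wd); rewrite gw sub0r n1N => /ltW.
Qed.

(** Division by [z] keeps the nonzero zeros and, by [removable_singularity], the holomorphy at 0, so
    it can be repeated without end. *)
Let divide g : zeros_cluster g -> exists2 g', zeros_cluster g' & forall z, g z = z * g' z.
Proof.
move=> [cg dg ag]; have g0 := acc_eq0 (cg 0) ag.
have i0 : in_csquare r 0 by split; rewrite ?re0 ?im0; apply/andP; split; have := r0; lra.
have d0 := dg 0 i0.
pose Q z := if z == 0 then derive1 g 0 else g z * z^-1.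
have nearQ z : z != 0 -> \forall z' \near z, g z' * z'^-1 = Q z'.
  move=> z0; apply/nbhsCP; exists (n1 z); first exact: n1_gt0.
  move=> z' z'z; rewrite /Q ifF//; apply/negbTE; apply: contraTN z'z => /eqP ->.
  by rewrite sub0r n1N ltxx.
have gQ z : g z = z * Q z.
  rewrite /Q; have [->|z0] := eqVneq z 0; first by rewrite mul0r.
  by rewrite mulrCA mulfV// mulr1.
have dQ z : in_csquare r z -> z != 0 -> derivable Q z 1.
  move=> iz z0; apply: near_eq_derivable (nearQ z z0) _.
  apply: cderivableM; first exact: dg.
  by apply: cderivableV; [exact: z0|exact: cderivable_id].
have cQ : continuous Q.
  move=> z; have [->|z0] := eqVneq z 0.
  - apply/contCP => e e0; have e30 : 0 < e / 3 by rewrite divr_gt0.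
    have [d dd0 dh] := (isCdP g 0 _).1 (derivable_isCd d0) _ e30.
    exists d => // z'; rewrite subr0 => z'd; rewrite /Q eqxx.
    have [z'0|z'0] := eqVneq z' 0; first by rewrite subrr n1_0.
    have := dh _ z'd; rewrite add0r g0 subr0 => H.
    have -> : g z' * z'^-1 - derive1 g 0 = (g z' - derive1 g 0 * z') * z'^-1 by field.
    have n0 := n1_gt0 z'0.
    apply: (le_lt_trans (n1M _ _)); apply: (le_lt_trans (ler_wpM2l (n1_ge0 _) (n1V _))).
    apply: (le_lt_trans (ler_wpM2r _ H)); first by rewrite divr_ge0// ltW.
    have -> : e / 3 * n1 z' * (2 / n1 z') = e * 2 / 3 by field; rewrite gt_eqF.
    lra.
  - by apply: cont_near (nearQ z z0) _; apply: contM; [exact: cg|apply: contV; [exact: z0|exact: cont_id]].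
exists Q; last exact: gQ.
split; first exact: cQ.
- move=> z iz; have [->|z0] := eqVneq z 0; last exact: dQ.
  apply: removable_singularity; first exact: cQ.
  apply/nbhsCP; exists r; first exact: r0.
  move=> w; rewrite subr0 => wr; apply: dQ.
  have := re_le_n1 w; have := im_le_n1 w; rewrite !ler_norml => /andP[w1 w2] /andP[w3 w4].
  by split; apply/andP; split; lra.
- move=> d /ag[w [w0 wd gw]]; exists w; split; [exact: w0|exact: wd|].
  by rewrite /Q (negbTE w0) gw mul0r.
Qed.

Let n1_inv_bdry z : on_square r z -> n1 z^-1 <= 2 / r.
Proof.
have := @n1_inv_le R r r0 z 0; rewrite subr0 /depth re0 im0 !normr0 !subr0 minxx.
by apply; exact: in_square0.
Qed.

(** After [m] divisions by [z] the bound on the boundary has grown to [M * (2 / r) ^ m]. The uniform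
    Cauchy estimate for the quotient then gives [K * M * (2 / r * n1 w) ^ m] for [g w], which tends
    to 0. *)
Lemma accumulating_zeros g : continuous g ->
  (forall z, in_csquare r z -> derivable g z 1) ->
  (forall d : R, 0 < d -> exists w, [/\ w != 0, n1 w < d & g w = 0]) ->
  \forall w \near 0, g w = 0.
Proof.
move=> cg dg ag.
have [e [K e0 est]] := cauchy_estimate r0.
have bound (m : nat) : forall g M, zeros_cluster g ->
    (forall z, in_csquare r z -> on_square r z -> n1 (g z) <= M) ->
    forall w, n1 w < e -> n1 (g w) <= K * M * (2 / r * n1 w) ^+ m.
  elim: m => [|m IH] g' M acc gM w we.
    by rewrite expr0 mulr1; case: acc => cg' dg' _; exact: est.
  have [q aq gq] := divide acc.
  have qM z : in_csquare r z -> on_square r z -> n1 (q z) <= M * (2 / r).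
    move=> iz oz; have z0 : z != 0 by have := on_square_neq r0 (in_square0 r0) oz; rewrite subr0.
    have -> : q z = g' z * z^-1 by rewrite gq mulrAC mulfV// mul1r.
    apply: (le_trans (n1M _ _)); apply: ler_pM; rewrite ?n1_ge0//; first exact: gM.
    exact: n1_inv_bdry.
  have := IH q _ aq qM w we => qw.
  rewrite gq; apply: (le_trans (n1M _ _)); apply: (le_trans (ler_wpM2l (n1_ge0 _) qw)).
  by rewrite exprS le_eqVlt; apply/orP; left; apply/eqP; ring.
have [M M0 gM] := @square_bounded R r r0 g (rect_cont_cont _ _ _ _ cg).
(* Below [r / 4] the ratio [2 / r * n1 w] is at most one half. *)
apply/nbhsCP; exists (Num.min e (r / 4)); first by rewrite lt_min e0 divr_gt0.
move=> w; rewrite subr0 lt_min => /andP[we wr].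
apply: n1_small => d d0.
have [n nP] := @half_powers_lt R (`|K * M|) d (normr_ge0 _) d0.
apply: le_trans (ltW nP); apply: (le_trans (bound n g M _ gM w we)); first by split.
apply: (@le_trans _ _ (`|K * M| * (2 / r * n1 w) ^+ n)).
  by rewrite ler_wpM2r ?ler_norm// exprn_ge0// mulr_ge0 ?n1_ge0// divr_ge0// ltW.
rewrite ler_wpM2l// -exprVn lerXn2r ?nnegrE ?invr_ge0//.
- by rewrite mulr_ge0 ?n1_ge0// divr_ge0// ltW.
- rewrite mulrAC ler_pdivrMr//; lra.
Qed.

End IsolatedZeros.

Lemma isolated_zeros f p : (\forall z \near p, derivable f z 1) ->
  (\forall z \near p, f z = 0) \/ (\forall z \near p, z != p -> f z != 0).
Proof.
move=> nf; have [r [F r0 [cF dF FE]]] := near_square nf.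
have [acc|nacc] := pselect (forall d : R, 0 < d -> exists w, [/\ w != 0, n1 w < d & F w = 0]).
- left; have /nbhsCP[d d0 dh] := accumulating_zeros r0 cF dF acc.
  apply/nbhsCP; exists (Num.min d r); first by rewrite lt_min d0.
  move=> w; rewrite lt_min => /andP[wd wr].
  have := dh (w - p); rewrite subr0 => /(_ wd); rewrite FE//.
  by have -> : p + (w - p) = w by ring.
- right; move/existsNP: nacc => [d /not_implyP [d0 nd]].
  apply/nbhsCP; exists (Num.min d r); first by rewrite lt_min d0.
  move=> w; rewrite lt_min => /andP[wd wr] wp; apply/eqP => fw; apply: nd.
  exists (w - p); split=> //; first by rewrite subr_eq0.
  by rewrite FE//; have -> : p + (w - p) = w by ring.
Qed.

End Holomorphic.

(** * Wirtinger derivatives *)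

Section Wirtinger.
Variable R : realType.
Implicit Types (z w p u h v : C R) (F G f g : C R -> C R) (U V : set (C R)).

(** [P] and [Q] are the Wirtinger derivatives. Only derivatives along the two coordinate lines are
    required, so every calculus rule reduces to the one for curves. *)
Definition isD F z (P Q : C R) : Prop :=
  cder (fun t => F (z + 1 * toC t)) 0 (P + Q) /\
  cder (fun t => F (z + imag R * toC t)) 0 (imag R * (P - Q)).

Lemma cder_partialC F z v (D : C R) :
  cder (fun t => F (z + v * toC t)) 0 D -> partialC v F z = D.
Proof.
move=> [h1 h2]; rewrite [RHS]complexE; congr (toC _ + imag R * toC _);
  by rewrite /partial derive1E; exact: derive_val.
Qed.

Lemma isD_dz F z P Q : isD F z P Q -> dz F z = P.
Proof.
move=> [/cder_partialC h1 /cder_partialC h2]; rewrite /dz h1 h2 mulrA imag2.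
by field.
Qed.

Lemma isD_dzb F z P Q : isD F z P Q -> dzb F z = Q.
Proof.
move=> [/cder_partialC h1 /cder_partialC h2]; rewrite /dzb h1 h2 mulrA imag2.
by field.
Qed.

Lemma partialC1E F z : partialC 1 F z = dz F z + dzb F z.
Proof. by rewrite /dz /dzb; field. Qed.

Lemma partialCiE F z : partialC (imag R) F z = imag R * (dz F z - dzb F z).
Proof.
rewrite /dz /dzb; set a := partialC 1 F z; set b := partialC _ F z.
have -> : (a - imag R * b) / 2 - (a + imag R * b) / 2 = - (imag R * b) by field.
by rewrite mulrN mulrA imag2 mulN1r opprK.
Qed.

Lemma isD_of_derivable F z :
  derivable (line (fun w => re (F w)) z 1) 0 1 ->
  derivable (line (fun w => re (F w)) z (imag R)) 0 1 ->
  derivable (line (fun w => im (F w)) z 1) 0 1 ->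
  derivable (line (fun w => im (F w)) z (imag R)) 0 1 ->
  isD F z (dz F z) (dzb F z).
Proof.
move=> h1 h2 h3 h4; rewrite /isD -partialC1E -partialCiE.
have der (u : R -> R) : derivable u 0 1 -> is_derive (0 : R) (1 : R) u (derive1 u 0).
  by move=> du; rewrite derive1E; exact: derivableP.
have reE (a b : R) : re (toC a + imag R * toC b) = a by rewrite reD reM /=; ring.
have imE (a b : R) : im (toC a + imag R * toC b) = b by rewrite imD imM /=; ring.
have cderE (a b : R -> R) : derivable a 0 1 -> derivable b 0 1 ->
    is_derive (0 : R) (1 : R) a (re (toC (derive1 a 0) + imag R * toC (derive1 b 0))) /\
    is_derive (0 : R) (1 : R) b (im (toC (derive1 a 0) + imag R * toC (derive1 b 0))).
  by move=> da db; rewrite reE imE; split; exact: der.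
by split; [exact: (cderE _ _ h1 h3)|exact: (cderE _ _ h2 h4)].
Qed.

Lemma isD_ext F G z P Q : (\forall w \near z, F w = G w) -> isD F z P Q -> isD G z P Q.
Proof.
move=> /nbhsCP[e e0 FG].
have near v : n1 v <= 1 -> \forall t \near (0 : R), F (z + v * toC t) = G (z + v * toC t).
  move=> v1; apply/nbhs_ballP; exists e => //= t; rewrite /ball /= sub0r normrN => te.
  apply: FG; have -> : z + v * toC t - z = v * toC t by ring.
  apply: (le_lt_trans (n1M _ _)); rewrite n1_toC.
  by apply: le_lt_trans te; rewrite ler_piMl.
have i1 : n1 (imag R) <= 1 by rewrite /n1 re_imag im_imag normr0 normr1 add0r.
have o1 : n1 (1 : C R) <= 1 by rewrite /n1 re1 im1 normr0 normr1 addr0.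
by move=> [[h1 h2] [h3 h4]]; split; split;
  [apply: near_eq_is_derive h1|apply: near_eq_is_derive h2|
   apply: near_eq_is_derive h3|apply: near_eq_is_derive h4];
  [apply: filterS (near _ o1)|apply: filterS (near _ o1)|
   apply: filterS (near _ i1)|apply: filterS (near _ i1)] => t /= ->.
Qed.

Lemma cder_cast (Phi : R -> C R) (t : R) (a b : C R) : a = b -> cder Phi t a -> cder Phi t b.
Proof. by move=> ->. Qed.

Lemma cderM (Phi Psi : R -> C R) (t : R) (a b : C R) : cder Phi t a -> cder Psi t b ->
  cder (fun s => Phi s * Psi s) t (a * Psi t + Phi t * b).
Proof.
move=> [p1 p2] [q1 q2]; split.
- rewrite (_ : (fun s => _) = (fun s => re (Phi s) * re (Psi s) - im (Phi s) * im (Psi s))).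
    apply: is_derive_eq (is_deriveB (is_deriveM p1 q1) (is_deriveM p2 q2)) _.
    by rewrite /GRing.scale /= reD !reM; ring.
  by apply/funext => s; rewrite reM.
- rewrite (_ : (fun s => _) = (fun s => re (Phi s) * im (Psi s) + im (Phi s) * re (Psi s))).
    apply: is_derive_eq (is_deriveD (is_deriveM p1 q2) (is_deriveM p2 q1)) _.
    by rewrite /GRing.scale /= imD !imM; ring.
  by apply/funext => s; rewrite imM.
Qed.

Lemma cder_conj (Phi : R -> C R) (t : R) (a : C R) : cder Phi t a ->
  cder (fun s => (Phi s)^*) t a^*.
Proof.
move=> [p1 p2]; split.
- by rewrite re_conj; rewrite (_ : (fun s => _) = (fun s => re (Phi s)));
    [exact: p1|apply/funext => s; rewrite re_conj].
- by rewrite im_conj; rewrite (_ : (fun s => _) = (fun s => - im (Phi s)));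
    [exact: is_deriveN|apply/funext => s; rewrite im_conj].
Qed.

Lemma is_deriveC_inv z : z != 0 -> is_derive z 1 (fun w : C R => w^-1) (- (z^-1 * z^-1)).
Proof.
move=> z0; have h1 := is_derive_cst (1 : C R) z (1 : C R).
have h := @is_deriveC_quot R (fun=> 1) (fun w => w) 0 1 z z0 h1 (is_derive_id z 1).
apply: near_eq_is_derive (is_derive_eq h _); last by ring.
by near=> w; rewrite mul1r.
Unshelve. all: by end_near. Qed.

Lemma line0 (F : C R -> C R) z v : F (z + v * toC 0) = F z.
Proof. by rewrite toC0 mulr0 addr0. Qed.

Lemma imag_conj : (imag R)^* = - imag R.
Proof. by apply: complex_eqP; rewrite ?re_conj ?im_conj ?reN ?imN /= ?oppr0. Qed.

Lemma isDD F G z P Q P' Q' : isD F z P Q -> isD G z P' Q' ->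
  isD (fun w => F w + G w) z (P + P') (Q + Q').
Proof.
move=> [h1 h2] [k1 k2]; split.
- by apply: cder_cast (cderD h1 k1); ring.
- by apply: cder_cast (cderD h2 k2); ring.
Qed.

Lemma isDM F G z P Q P' Q' : isD F z P Q -> isD G z P' Q' ->
  isD (fun w => F w * G w) z (P * G z + F z * P') (Q * G z + F z * Q').
Proof.
move=> [h1 h2] [k1 k2]; split.
- by apply: cder_cast (cderM h1 k1); rewrite !line0; ring.
- by apply: cder_cast (cderM h2 k2); rewrite !line0; ring.
Qed.

Lemma isD_conj F z P Q : isD F z P Q -> isD (fun w => (F w)^*) z Q^* P^*.
Proof.
move=> [h1 h2]; split.
- by apply: cder_cast (cder_conj h1); rewrite rmorphD addrC.
- apply: cder_cast (cder_conj h2); rewrite rmorphM rmorphB /= imag_conj; ring.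
Qed.

Lemma isDV F z P Q : F z != 0 -> isD F z P Q ->
  isD (fun w => (F w)^-1) z (- (P * ((F z)^-1 * (F z)^-1))) (- (Q * ((F z)^-1 * (F z)^-1))).
Proof.
move=> F0 [h1 h2]; split.
- apply: cder_cast (cder_comp (f := fun w => w^-1) _ h1); last first.
    by rewrite line0; exact: is_deriveC_inv.
  by ring.
- apply: cder_cast (cder_comp (f := fun w => w^-1) _ h2); last first.
    by rewrite line0; exact: is_deriveC_inv.
  by ring.
Qed.

Lemma isD_cst (k : C R) z : isD (fun=> k) z 0 0.
Proof. by split; apply: cder_cast (cder_cst k 0); ring. Qed.

Lemma isDZ (k : C R) F z P Q : isD F z P Q -> isD (fun w => k * F w) z (k * P) (k * Q).
Proof.
by move=> h; have := isDM (isD_cst k z) h; rewrite !mul0r !add0r.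
Qed.

Lemma isDN F z P Q : isD F z P Q -> isD (fun w => - F w) z (- P) (- Q).
Proof.
move=> /(isDZ (-1)); rewrite !mulN1r; apply: isD_ext.
by near=> w; rewrite mulN1r.
Unshelve. all: by end_near. Qed.

Lemma isD_holo f z D : is_derive z 1 f D -> isD f z D 0.
Proof.
move=> fD.
have line v : cder (fun t => f (z + v * toC t)) 0 (D * v).
  by apply: (@cder_comp _ f) (cder_line _ _ _); rewrite toC0 mulr0 addr0.
split; [apply: cder_cast (line 1)|apply: cder_cast (line (imag R))]; ring.
Qed.

(** The class [C^k] in terms of [dz] and [dzb], for which the Leibniz rules are short; continuity is
    recorded at every order. On open sets [smoothCP] identifies the intersection over [k] with
    [smoothC]. *)
Fixpoint SC (k : nat) U F : Prop :=
  (forall z, U z -> {for z, continuous F}) /\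
  match k with
  | 0 => True
  | k'.+1 => (forall z, U z -> isD F z (dz F z) (dzb F z)) /\
             (SC k' U (dz F) /\ SC k' U (dzb F))
  end.

Lemma SC_cont k U F z : SC k U F -> U z -> {for z, continuous F}.
Proof. by case: k => [|k] [h _]; exact: h. Qed.

Lemma SCS k U F : SC k.+1 U F -> SC k U F.
Proof.
elim: k F => [|k IH] F; first by move=> [cF _]; split.
move=> [cF [dF [h1 h2]]]; split; first exact: cF.
by split; [exact: dF|split; exact: IH].
Qed.

Lemma open_near U z : open U -> U z -> \forall w \near z, U w.
Proof. by move=> oU Uz; exact: open_nbhs_nbhs. Qed.

Lemma SC_ext k U F G : open U -> (forall z, U z -> F z = G z) -> SC k U F -> SC k U G.
Proof.
move=> oU; elim: k F G => [|k IH] F G FG SF.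
- split=> // z Uz; apply: cont_near (SC_cont SF Uz).
  by apply: filterS (open_near oU Uz) => w; exact: FG.
- have near z : U z -> \forall w \near z, F w = G w.
    by move=> Uz; apply: filterS (open_near oU Uz) => w; exact: FG.
  case: SF => [cF [dF [h1 h2]]].
  have dG z : U z -> isD G z (dz F z) (dzb F z).
    by move=> Uz; apply: isD_ext (near z Uz) _; exact: dF.
  split; first by move=> z Uz; apply: cont_near (near z Uz) _; exact: cF.
  split; first by move=> z Uz; rewrite (isD_dz (dG z Uz)) (isD_dzb (dG z Uz)); exact: dG.
  split; [apply: IH h1|apply: IH h2] => z Uz; [rewrite (isD_dz (dG z Uz))|rewrite (isD_dzb (dG z Uz))] => //.
Qed.

Lemma SC_intro k U F (P Q : C R -> C R) : open U ->
  (forall z, U z -> {for z, continuous F}) -> (forall z, U z -> isD F z (P z) (Q z)) ->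
  SC k U P -> SC k U Q -> SC k.+1 U F.
Proof.
move=> oU cF dF SP SQ; split; first exact: cF.
split; first by move=> z Uz; rewrite (isD_dz (dF z Uz)) (isD_dzb (dF z Uz)); exact: dF.
split; [apply: (SC_ext oU _ SP)|apply: (SC_ext oU _ SQ)] => z Uz.
- by rewrite (isD_dz (dF z Uz)).
- by rewrite (isD_dzb (dF z Uz)).
Qed.

Lemma SC_cst k U (a : C R) : open U -> SC k U (fun=> a).
Proof.
move=> oU; elim: k a => [|k IH] a; first by split=> // z _; exact: cont_cst.
by apply: (@SC_intro k U _ (fun=> 0) (fun=> 0) oU); [move=> z _; exact: cont_cst|move=> z _; exact: isD_cst|exact: (IH 0)|exact: (IH 0)].
Qed.

Lemma SCD k U F G : open U -> SC k U F -> SC k U G -> SC k U (fun z => F z + G z).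
Proof.
move=> oU; elim: k F G => [|k IH] F G SF SG.
- by split=> // z Uz; apply: contD; [exact: SC_cont SF Uz|exact: SC_cont SG Uz].
- case: SF SG => [cF [dF [h1 h2]]] [cG [dG [k1 k2]]].
  apply: (@SC_intro k U _ (fun z => dz F z + dz G z) (fun z => dzb F z + dzb G z) oU).
  + by move=> z Uz; apply: contD; [exact: cF|exact: cG].
  + by move=> z Uz; apply: isDD; [exact: dF|exact: dG].
  + exact: (IH _ _ h1 k1).
  + exact: (IH _ _ h2 k2).
Qed.

Lemma SCM k U F G : open U -> SC k U F -> SC k U G -> SC k U (fun z => F z * G z).
Proof.
move=> oU; elim: k F G => [|k IH] F G SF SG.
- by split=> // z Uz; apply: contM; [exact: SC_cont SF Uz|exact: SC_cont SG Uz].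
- have SF' := SCS SF; have SG' := SCS SG.
  case: SF SG => [cF [dF [h1 h2]]] [cG [dG [k1 k2]]].
  apply: (@SC_intro k U _ (fun z => dz F z * G z + F z * dz G z)
    (fun z => dzb F z * G z + F z * dzb G z) oU).
  + by move=> z Uz; apply: contM; [exact: cF|exact: cG].
  + by move=> z Uz; apply: isDM; [exact: dF|exact: dG].
  + exact: (SCD oU (IH _ _ h1 SG') (IH _ _ SF' k1)).
  + exact: (SCD oU (IH _ _ h2 SG') (IH _ _ SF' k2)).
Qed.

Lemma cont_conj F z : {for z, continuous F} -> {for z, continuous (fun w => (F w)^*)}.
Proof.
move=> /contCP H; apply/contCP => e /H[d d0 dh]; exists d => // w /dh.
by rewrite /n1 !(reD, imD, reN, imN, re_conj, im_conj) -opprD normrN.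
Qed.

Lemma SC_conj k U F : open U -> SC k U F -> SC k U (fun z => (F z)^*).
Proof.
move=> oU; elim: k F => [|k IH] F SF.
- by split=> // z Uz; apply: cont_conj; exact: SC_cont SF Uz.
- case: SF => [cF [dF [h1 h2]]].
  apply: (@SC_intro k U _ (fun z => (dzb F z)^*) (fun z => (dz F z)^*) oU).
  + by move=> z Uz; apply: cont_conj; exact: cF.
  + by move=> z Uz; apply: isD_conj; exact: dF.
  + exact: (IH _ h2).
  + exact: (IH _ h1).
Qed.

Lemma SCN k U F : open U -> SC k U F -> SC k U (fun z => - F z).
Proof.
move=> oU SF; apply: (SC_ext oU _ (SCM oU (SC_cst k (-1) oU) SF)) => z _.
by rewrite mulN1r.
Qed.

Lemma SCV k U F : open U -> (forall z, U z -> F z != 0) -> SC k U F ->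
  SC k U (fun z => (F z)^-1).
Proof.
move=> oU F0; elim: k => [|k IH] SF.
- by split=> // z Uz; apply: contV; [exact: F0|exact: SC_cont SF Uz].
- have SF' := IH (SCS SF).
  case: SF => [cF [dF [h1 h2]]].
  apply: (@SC_intro k U _ (fun z => - (dz F z * ((F z)^-1 * (F z)^-1)))
     (fun z => - (dzb F z * ((F z)^-1 * (F z)^-1))) oU).
  + by move=> z Uz; apply: contV; [exact: F0|exact: cF].
  + by move=> z Uz; apply: isDV; [exact: F0|exact: dF].
  + exact: (SCN oU (SCM oU h1 (SCM oU SF' SF'))).
  + exact: (SCN oU (SCM oU h2 (SCM oU SF' SF'))).
Qed.

(** Cauchy's formula enters the smooth calculus here: by [derivable_derive1] the derivative of a
    holomorphic function is holomorphic, which drives the induction. *)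
Lemma SC_holo k U f : open U -> (forall z, U z -> derivable f z 1) -> SC k U f.
Proof.
move=> oU; elim: k f => [|k IH] f df.
- by split; [move=> z Uz; exact: derivable_cont (df z Uz)|].
- apply: (@SC_intro k U _ (derive1 f) (fun=> 0) oU).
  + by move=> z Uz; exact: derivable_cont (df z Uz).
  + by move=> z Uz; apply: isD_holo; exact: derivable_isCd (df z Uz).
  + apply: IH => z Uz; apply: derivable_derive1.
    by apply: filterS (open_near oU Uz) => w Uw; exact: (df w Uw).
  + exact: (SC_cst k 0 oU).
Qed.

End Wirtinger.

(** * Smooth functions: closure properties, total differentiability, the chain rule *)

Section SmoothFunctions.
Variable R : realType.
Implicit Types (z w p u h v : C R) (F G f g : C R -> C R) (U V : set (C R)).

Lemma line_near U z v : open U -> U z -> \forall t \near (0 : R), U (z + v * toC t).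
Proof.
move=> oU Uz; have /nbhsCP[e e0 He] := open_near oU Uz.
have K0 : 0 < n1 v + 1 by have := n1_ge0 v; lra.
apply/nbhs_ballP; exists (e / (n1 v + 1)) => /=; first by rewrite divr_gt0.
move=> t; rewrite /ball /= sub0r normrN ltr_pdivlMr// => te; apply: He.
have -> : z + v * toC t - z = v * toC t by ring.
apply: (le_lt_trans (n1M _ _)); rewrite n1_toC; apply: le_lt_trans te.
by rewrite mulrC ler_wpM2l// lerDl.
Qed.

Lemma line_ext (a b : C R -> R) U z v : open U -> (forall z, U z -> a z = b z) -> U z ->
  \forall t \near (0 : R), line a z v t = line b z v t.
Proof. by move=> oU ab Uz; apply: filterS (line_near v oU Uz) => t; exact: ab. Qed.

Lemma partial_ext (a b : C R -> R) U z v : open U -> (forall z, U z -> a z = b z) -> U z ->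
  partial v a z = partial v b z.
Proof.
move=> oU ab Uz; rewrite /partial !derive1E.
by apply: near_eq_derive; exact: line_ext ab Uz.
Qed.

Lemma Ck_ext k U (a b : C R -> R) : open U -> (forall z, U z -> a z = b z) ->
  Ck k U a -> Ck k U b.
Proof.
move=> oU; elim: k a b => [|k IH] a b ab /=.
  move=> ca z Uz; have h := ca z Uz; apply/contRP => e e0.
  have [d d0 dh] := (contRP _ _).1 h _ e0.
  have /nbhsCP[d' d'0 d'h] := open_near oU Uz.
  exists (Num.min d d'); first by rewrite lt_min d0.
  by move=> w; rewrite lt_min => /andP[/dh + /d'h Uw]; rewrite !ab.
move=> [da [c1 c2]]; split.
  move=> z Uz; have [d1 d2] := da z Uz; split.
  - by apply: near_eq_derivable d1; exact: line_ext ab Uz.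
  - by apply: near_eq_derivable d2; exact: line_ext ab Uz.
by split; [apply: IH c1|apply: IH c2] => z Uz; exact: (partial_ext _ oU ab Uz).
Qed.

Lemma Ck_lin k U (a b : C R -> R) (c : R) : open U -> Ck k U a -> Ck k U b ->
  Ck k U (fun z => a z + c * b z).
Proof.
move=> oU; elim: k a b => [|k IH] a b /=.
  move=> ca cb z Uz.
  have cc : {for z, continuous (fun _ : C R => c)} by exact: cst_continuous.
  have cM := @continuousM R (C R) (fun=> c) b z cc (cb z Uz).
  exact: (@continuousD R R (C R) a (fun z => c * b z) z (ca z Uz) cM).
move=> [da [a1 a2]] [db [b1 b2]].
have der z v : derivable (line a z v) 0 1 -> derivable (line b z v) 0 1 ->
    is_derive (0 : R) (1 : R) (line (fun z => a z + c * b z) z v) (partial v a z + c * partial v b z).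
  move=> /derivableP ha /derivableP hb.
  by rewrite /partial !derive1E; exact: (is_deriveD ha (is_deriveZ c hb)).
have pE z v : derivable (line a z v) 0 1 -> derivable (line b z v) 0 1 ->
   partial v a z + c * partial v b z = partial v (fun z => a z + c * b z) z.
  by move=> ha hb; rewrite [RHS]/partial derive1E; symmetry; apply: derive_val; exact: der.
split.
  move=> z Uz; have [da1 da2] := da z Uz; have [db1 db2] := db z Uz; split.
  - by have [] := der _ _ da1 db1.
  - by have [] := der _ _ da2 db2.
split; [apply: (Ck_ext oU _ (IH _ _ a1 b1))|apply: (Ck_ext oU _ (IH _ _ a2 b2))] => z Uz;
  have [da1 da2] := da z Uz; have [db1 db2] := db z Uz; exact: pE.
Qed.

Lemma Ck_scale k U (a : C R -> R) (c : R) : open U -> Ck k U a -> Ck k U (fun z => c * a z).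
Proof.
move=> oU ca; apply: (Ck_ext oU _ (Ck_lin (c - 1) oU ca ca)) => z _; ring.
Qed.

Lemma smoothC_wirtinger U F : open U -> smoothC U F -> smoothC U (dz F) /\ smoothC U (dzb F).
Proof.
move=> oU [sr si].
have half (a b : C R) : (a - imag R * b) / 2 = (a - imag R * b) * toC (2^-1) /\
    (a + imag R * b) / 2 = (a + imag R * b) * toC (2^-1).
  by rewrite fmorphV rmorph_nat.
have c k : [/\ Ck k U (partial 1 (fun w => re (F w))), Ck k U (partial (imag R) (fun w => re (F w))),
    Ck k U (partial 1 (fun w => im (F w))) & Ck k U (partial (imag R) (fun w => im (F w)))].
  by have [_ [h1 h2]] := sr k.+1; have [_ [h3 h4]] := si k.+1.
split; split=> k; have [c1 c2 c3 c4] := c k.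
- have := Ck_scale (2^-1) oU (Ck_lin 1 oU c1 c4); apply: (Ck_ext oU) => z _.
  rewrite /dz /partialC (half _ _).1 !(reM, imM, reD, imD, reN, imN) /=; ring.
- have := Ck_scale (2^-1) oU (Ck_lin (-1) oU c3 c2); apply: (Ck_ext oU) => z _.
  rewrite /dz /partialC (half _ _).1 !(reM, imM, reD, imD, reN, imN) /=; ring.
- have := Ck_scale (2^-1) oU (Ck_lin (-1) oU c1 c4); apply: (Ck_ext oU) => z _.
  rewrite /dzb /partialC (half _ _).2 !(reM, imM, reD, imD, reN, imN) /=; ring.
- have := Ck_scale (2^-1) oU (Ck_lin 1 oU c3 c2); apply: (Ck_ext oU) => z _.
  rewrite /dzb /partialC (half _ _).2 !(reM, imM, reD, imD, reN, imN) /=; ring.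
Qed.

Lemma SC_Ck k U F : open U -> SC k U F ->
  Ck k U (fun z => re (F z)) /\ Ck k U (fun z => im (F z)).
Proof.
move=> oU; elim: k F => [|k IH] F.
  by move=> [cF _]; split=> z Uz; have [] := (cont_reim F z).1 (cF z Uz).
move=> [cF [dF [h1 h2]]].
have [r1 i1] := IH _ (SCD oU h1 h2).
have [r2 i2] := IH _ (SCM oU (SC_cst k (imag R) oU) (SCD oU h1 (SCN oU h2))).
have reE (a b : R) : re (toC a + imag R * toC b) = a by rewrite reD reM /=; ring.
have imE (a b : R) : im (toC a + imag R * toC b) = b by rewrite imD imM /=; ring.
split; split.
- move=> z Uz; have [[d1 _] [d2 _]] := dF z Uz.
  by split; [case: d1|case: d2].
- split; [apply: (Ck_ext oU _ r1)|apply: (Ck_ext oU _ r2)] => z Uz.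
  + by rewrite -partialC1E /partialC reE.
  + by rewrite -partialCiE /partialC reE.
- move=> z Uz; have [[_ d1] [_ d2]] := dF z Uz.
  by split; [case: d1|case: d2].
- split; [apply: (Ck_ext oU _ i1)|apply: (Ck_ext oU _ i2)] => z Uz.
  + by rewrite -partialC1E /partialC imE.
  + by rewrite -partialCiE /partialC imE.
Qed.

Lemma smoothC_cont U F z : smoothC U F -> U z -> {for z, continuous F}.
Proof. by move=> [sr si] Uz; apply/cont_reim; split; [exact: (sr 0%N)|exact: (si 0%N)]. Qed.

Lemma smoothC_isD U F z : smoothC U F -> U z -> isD F z (dz F z) (dzb F z).
Proof.
move=> [sr si] Uz; have [h _] := sr 1%N; have [k _] := si 1%N.
by have [h1 h2] := h z Uz; have [k1 k2] := k z Uz; exact: isD_of_derivable.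
Qed.

Lemma smoothCP U F : open U -> smoothC U F <-> forall k, SC k U F.
Proof.
move=> oU; split=> [sF k|SF]; last by split=> k; have [] := SC_Ck oU (SF k).
elim: k F sF => [|k IH] F sF.
  by split; [move=> z Uz; exact: smoothC_cont sF Uz|].
have [s1 s2] := smoothC_wirtinger oU sF.
split; first by move=> z Uz; exact: smoothC_cont sF Uz.
split; first by move=> z Uz; exact: smoothC_isD sF Uz.
by split; [exact: (IH _ s1)|exact: (IH _ s2)].
Qed.

Section Closure.
Variable U : set (C R).
Hypothesis oU : open U.

Lemma smoothC_dz F : smoothC U F -> smoothC U (dz F).
Proof. by move=> /(smoothC_wirtinger oU)[]. Qed.
Lemma smoothC_dzb F : smoothC U F -> smoothC U (dzb F).
Proof. by move=> /(smoothC_wirtinger oU)[]. Qed.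
Lemma smoothC_ext F G : (forall z, U z -> F z = G z) -> smoothC U F -> smoothC U G.
Proof. by move=> FG /(smoothCP _ oU) SF; apply/(smoothCP _ oU) => k; exact: (SC_ext oU FG (SF k)). Qed.
Lemma smoothCD F G : smoothC U F -> smoothC U G -> smoothC U (fun z => F z + G z).
Proof.
move=> /(smoothCP _ oU) SF /(smoothCP _ oU) SG; apply/(smoothCP _ oU) => k.
exact: (SCD oU (SF k) (SG k)).
Qed.
Lemma smoothCM F G : smoothC U F -> smoothC U G -> smoothC U (fun z => F z * G z).
Proof.
move=> /(smoothCP _ oU) SF /(smoothCP _ oU) SG; apply/(smoothCP _ oU) => k.
exact: (SCM oU (SF k) (SG k)).
Qed.
Lemma smoothCN F : smoothC U F -> smoothC U (fun z => - F z).
Proof. by move=> /(smoothCP _ oU) SF; apply/(smoothCP _ oU) => k; exact: (SCN oU (SF k)). Qed.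
Lemma smoothC_conj F : smoothC U F -> smoothC U (fun z => (F z)^*).
Proof. by move=> /(smoothCP _ oU) SF; apply/(smoothCP _ oU) => k; exact: (SC_conj oU (SF k)). Qed.
Lemma smoothCV F : (forall z, U z -> F z != 0) -> smoothC U F -> smoothC U (fun z => (F z)^-1).
Proof. by move=> F0 /(smoothCP _ oU) SF; apply/(smoothCP _ oU) => k; exact: (SCV oU F0 (SF k)). Qed.
Lemma smoothC_cst (a : C R) : smoothC U (fun=> a).
Proof. by apply/(smoothCP _ oU) => k; exact: (SC_cst k a oU). Qed.
Lemma smoothC_holo f : (forall z, U z -> derivable f z 1) -> smoothC U f.
Proof. by move=> df; apply/(smoothCP _ oU) => k; exact: (SC_holo k oU df). Qed.
Lemma smoothCZ (a : C R) F : smoothC U F -> smoothC U (fun z => a * F z).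
Proof. exact: (smoothCM (smoothC_cst a)). Qed.
Lemma smoothC_sum (I : finType) (F : I -> C R -> C R) :
  (forall i, smoothC U (F i)) -> smoothC U (fun z => \sum_i F i z).
Proof.
move=> sF; elim: (index_enum I) => [|i s IH].
  by apply: smoothC_ext (smoothC_cst 0) => z _; rewrite big_nil.
by apply: smoothC_ext (smoothCD (sF i) IH) => z _; rewrite big_cons.
Qed.
End Closure.

Lemma isD_sum (I : finType) (F : I -> C R -> C R) (P Q : I -> C R) z :
  (forall i, isD (F i) z (P i) (Q i)) ->
  isD (fun w => \sum_i F i w) z (\sum_i P i) (\sum_i Q i).
Proof.
move=> dF; elim: (index_enum I) => [|i s IH].
  rewrite !big_nil; apply: isD_ext (isD_cst 0 z).
  by near=> w; rewrite big_nil.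
rewrite !big_cons; apply: isD_ext (isDD (dF i) IH).
by near=> w; rewrite big_cons.
Unshelve. all: by end_near. Qed.

Lemma Ck_sub k U V (a : C R -> R) : V `<=` U -> Ck k U a -> Ck k V a.
Proof.
move=> VU; elim: k a => [|k IH] a /=; first by move=> ca z /VU; exact: ca.
move=> [da [c1 c2]]; split; first by move=> z /VU; exact: da.
by split; exact: IH.
Qed.

Lemma Ck_local k U (a : C R -> R) : (forall z, U z -> exists2 V, V z & Ck k V a) -> Ck k U a.
Proof.
elim: k a => [|k IH] a H.
  by move=> z /H[V Vz cV]; exact: cV.
split; first by move=> z /H[V Vz [dV _]]; exact: dV.
by split; apply: IH => z /H[V Vz [_ [c1 c2]]]; exists V.
Qed.

Lemma smoothC_sub U V F : V `<=` U -> smoothC U F -> smoothC V F.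
Proof. by move=> VU [h1 h2]; split=> k; exact: (Ck_sub VU). Qed.

Lemma smoothC_local U F : (forall z, U z -> exists2 V, V z & smoothC V F) -> smoothC U F.
Proof.
by move=> H; split=> k; apply: Ck_local => z /H[V Vz [h1 h2]]; exists V.
Qed.

Lemma cder_shift (Phi : R -> C R) (s : R) (v : C R) :
  cder (fun t => Phi (s + t)) 0 v -> cder Phi s v.
Proof.
move=> /cderP H; apply/cderP => e /H[d d0 dh]; exists d => // h /dh.
by rewrite add0r addr0.
Qed.

Lemma cder_scale (Phi : R -> C R) (b t : R) (v : C R) :
  cder Phi (b * t) v -> cder (fun s => Phi (b * s)) t (v * toC b).
Proof.
have hb : is_derive t (1 : R) (fun s : R => b * s) b.
  by have := is_deriveZ b (is_derive_id t (1 : R)); rewrite /GRing.scale /= mulr1.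
move=> [h1 h2]; split.
- rewrite reM re_toC im_toC mulr0 subr0.
  exact: (@is_derive1_comp R (fun s => re (Phi s)) (fun s => b * s) t _ _ h1 hb).
- rewrite imM re_toC im_toC mulr0 add0r.
  exact: (@is_derive1_comp R (fun s => im (Phi s)) (fun s => b * s) t _ _ h2 hb).
Qed.

(** Total real differentiability, with differential [P h + Q conj h]. Partial derivatives as in
    [isD] are too weak for the Cauchy-Riemann criterion and for changes of coordinate. *)
Definition frechet F z (P Q : C R) : Prop :=
  forall e : R, 0 < e -> exists2 d : R, 0 < d & forall h, n1 h < d ->
    n1 (F (z + h) - F z - (P * h + Q * h^*)) <= e * n1 h.

Lemma frechet_cder F (Phi : R -> C R) (t : R) (P Q v : C R) :
  frechet F (Phi t) P Q -> cder Phi t v ->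
  cder (fun s => F (Phi s)) t (P * v + Q * v^*).
Proof.
move=> FF cP.
(* Removing the real-linear part leaves a function with complex derivative 0 at the point, to which
   [cder_comp] applies although [F] need not be holomorphic. *)
pose E w := F w - (P * w + Q * w^*).
have dE : is_derive (Phi t) 1 E 0.
  apply/isCdP => e /FF[d d0 dh]; exists d => // h /dh.
  have -> // : E (Phi t + h) - E (Phi t) - 0 * h =
     F (Phi t + h) - F (Phi t) - (P * h + Q * h^*).
  by rewrite /E rmorphD /=; ring.
have h1 := cder_comp dE cP.
have h2 := cderD (cderZ P cP) (cderZ Q (cder_conj cP)).
apply: cder_cast (cder_ext _ (cderD h1 h2)); first by ring.
by move=> s; rewrite /E; ring.
Qed.

Lemma cder_segment F z v (A : R -> C R) (B : C R) (eta : R) :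
  (forall t, 0 <= t <= 1 -> cder (fun s => F (z + v * toC s)) t (A t)) ->
  (forall t, 0 <= t <= 1 -> n1 (A t - B) <= eta) ->
  n1 (F (z + v) - F z - B) <= 2 * eta.
Proof.
move=> dF AB.
have := @cder_MVT R (fun t => F (z + v * toC t) + - B * toC t)
  (fun t => A t + - B) 0 1 eta ler01.
rewrite toC0 toC1 !mulr1 !mulr0 !addr0 subr0 mulr1.
have -> : F (z + v) + - B - F z = F (z + v) - F z - B by ring.
apply=> [t t01|t t01]; last exact: AB.
apply: cderD; first exact: dF.
have := cder_line 0 (- B) t; apply: cder_ext => s; by rewrite add0r.
Qed.

(** The increment is split along a horizontal and a vertical segment, and continuity of the partial
    derivatives controls each. *)
Lemma smoothC_frechet U F z : open U -> smoothC U F -> U z -> frechet F z (dz F z) (dzb F z).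
Proof.
move=> oU sF Uz e e0.
have cz := smoothC_cont (smoothC_dz oU sF) Uz.
have cb := smoothC_cont (smoothC_dzb oU sF) Uz.
(* Two Wirtinger derivatives, each off by [e / 8], give [e / 4] on a segment; [cder_segment] doubles
   this, and there are two segments. *)
have e80 : 0 < e / 8 by rewrite divr_gt0.
have [d1 d10 H1] := (contCP _ _).1 cz _ e80.
have [d2 d20 H2] := (contCP _ _).1 cb _ e80.
have /nbhsCP[d3 d30 H3] := open_near oU Uz.
exists (Num.min (Num.min d1 d2) d3); first by rewrite !lt_min d10 d20.
move=> h; rewrite !lt_min => /andP[/andP[h1 h2] h3].
set P := dz F z in H1 *; set Q := dzb F z in H2 *.
pose a := toC (re h); pose b := toC (im h).
have hE : h = a + imag R * b by rewrite -complexE.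
have a1 : n1 a <= n1 h by rewrite n1_toC re_le_n1.
have b1 : n1 b <= n1 h by rewrite n1_toC im_le_n1.
have near w : n1 (w - z) <= n1 h ->
    [/\ isD F w (dz F w) (dzb F w), n1 (dz F w - P) < e / 8 & n1 (dzb F w - Q) < e / 8].
  move=> wz; split; [|exact: (H1 _ (le_lt_trans wz h1))|exact: (H2 _ (le_lt_trans wz h2))].
  by apply: (smoothC_isD sF); apply: H3; exact: le_lt_trans wz h3.
have sc (k : R) t : 0 <= t <= 1 -> `|k * t| <= `|k|.
  by move=> /andP[t0 t1]; rewrite normrM (ger0_norm t0) ler_piMr.
have s1 : n1 (F (z + a) - F z - (P + Q) * a) <= 2 * (e / 4 * n1 h).
  apply: (@cder_segment F z a (fun t => (dz F (z + toC (re h * t)) + dzb F (z + toC (re h * t))) * a)).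
  - move=> t t01.
    have [|[D _] _ _] := near (z + toC (re h * t)).
      have -> : z + toC (re h * t) - z = toC (re h * t) by ring.
      by rewrite n1_toC (le_trans (sc _ _ t01))// re_le_n1.
    apply: cder_ext (cder_scale (Phi := fun s => F (z + 1 * toC s)) (cder_shift _)).
      by move=> s; rewrite mul1r toCM.
    by apply: cder_ext D => s; rewrite toCD !mul1r addrA.
  - move=> t t01.
    have [|_ p1 p2] := near (z + toC (re h * t)).
      have -> : z + toC (re h * t) - z = toC (re h * t) by ring.
      by rewrite n1_toC (le_trans (sc _ _ t01))// re_le_n1.
    move: p1 p2; generalize (dz F (z + toC (re h * t))) (dzb F (z + toC (re h * t))) => X Y p1 p2.
    have -> : (X + Y) * a - (P + Q) * a = ((X - P) + (Y - Q)) * a by ring.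
    apply: (le_trans (n1M _ _)); apply: ler_pM; rewrite ?n1_ge0//.
    by apply: (le_trans (n1D _ _)); lra.
have vert t : 0 <= t <= 1 -> n1 (z + a + imag R * toC (im h * t) - z) <= n1 h.
  move=> t01; have -> : z + a + imag R * toC (im h * t) - z = a + imag R * toC (im h * t) by ring.
  rewrite /n1 reD imD reM imM /= !(mul0r, mul1r, mulr0, addr0, add0r, subr0).
  by apply: lerD => //; exact: sc.
have s2 : n1 (F (z + a + imag R * b) - F (z + a) - imag R * (P - Q) * b) <= 2 * (e / 4 * n1 h).
  apply: (@cder_segment F (z + a) (imag R * b) (fun t =>
    imag R * (dz F (z + a + imag R * toC (im h * t)) - dzb F (z + a + imag R * toC (im h * t))) * b)).
  - move=> t t01.
    have [|[_ D] _ _] := near (z + a + imag R * toC (im h * t)).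
      exact: vert.
    apply: cder_ext (cder_scale (Phi := fun s => F (z + a + imag R * toC s)) (cder_shift _)).
      by move=> s; rewrite -mulrA -toCM.
    by apply: cder_ext D => s; rewrite toCD mulrDr addrA.
  - move=> t t01.
    have [|_ p1 p2] := near (z + a + imag R * toC (im h * t)).
      exact: vert.
    move: p1 p2; generalize (dz F (z + a + imag R * toC (im h * t)))
      (dzb F (z + a + imag R * toC (im h * t))) => X Y p1 p2.
    have -> : imag R * (X - Y) * b - imag R * (P - Q) * b = imag R * (((X - P) + - (Y - Q)) * b) by ring.
    rewrite n1_imagM; apply: (le_trans (n1M _ _)); apply: ler_pM; rewrite ?n1_ge0//.
    by apply: (le_trans (n1D _ _)); rewrite n1N; lra.
have hc : h^* = a - imag R * b.
  by apply: complex_eqP; rewrite ?re_conj ?im_conj !(reD, imD, reN, imN, reM, imM) /=; ring.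
have -> : F (z + h) - F z - (P * h + Q * h^*) =
  (F (z + a + imag R * b) - F (z + a) - imag R * (P - Q) * b) +
  (F (z + a) - F z - (P + Q) * a).
  by rewrite hc {1 2}hE addrA; ring.
by apply: (le_trans (n1D _ _)); lra.
Qed.

Lemma smoothC_holomorphic U F : open U -> smoothC U F -> (forall z, U z -> dzb F z = 0) ->
  forall z, U z -> is_derive z 1 F (dz F z).
Proof.
move=> oU sF F0 z Uz; apply/isCdP => e e0.
have [d d0 dh] := smoothC_frechet oU sF Uz e0.
by exists d => // h /dh; rewrite F0// mul0r addr0.
Qed.

Lemma isD_comp_holo U F f z (D : C R) : open U -> smoothC U F -> U (f z) -> is_derive z 1 f D ->
  isD (fun w => F (f w)) z (dz F (f z) * D) (dzb F (f z) * D^*).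
Proof.
move=> oU sF Uz df; have [h1 h2] := isD_holo df; have FF := smoothC_frechet oU sF Uz.
have line v : f z = f (z + v * toC 0) by rewrite toC0 mulr0 addr0.
split.
- apply: cder_cast (frechet_cder (Phi := fun t => f (z + 1 * toC t)) _ h1); last first.
    by rewrite -line; exact: FF.
  by rewrite addr0.
- apply: cder_cast (frechet_cder (Phi := fun t => f (z + imag R * toC t)) _ h2); last first.
    by rewrite -line; exact: FF.
  rewrite subr0 rmorphM /= imag_conj; ring.
Qed.

Lemma isD_real F z P Q : (\forall w \near z, im (F w) = 0) -> isD F z P Q -> Q = P^*.
Proof.
move=> nF dF.
have FC : \forall w \near z, (F w)^* = F w.
  by apply: filterS nF => w w0; apply: complex_eqP; rewrite ?re_conj ?im_conj ?w0 ?oppr0.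
have h := isD_ext FC (isD_conj dF).
by rewrite -(isD_dzb dF) -(isD_dzb h).
Qed.

End SmoothFunctions.

(** * Square roots and calculus of vector-valued maps *)

Section VectorCalculus.
Variable R : realType.
Implicit Types (z w : C R) (U : set (C R)).

Lemma isD_sqrt (f : C R -> R) z P Q : 0 < f z -> isD (fun w => toC (f w)) z P Q ->
  isD (fun w => toC (Num.sqrt (f w))) z (P / (2 * toC (Num.sqrt (f z))))
    (Q / (2 * toC (Num.sqrt (f z)))).
Proof.
move=> f0; set s := Num.sqrt (f z).
have s0 : 0 < s by rewrite sqrtr_gt0.
have key v (D : C R) : cder (fun t => toC (f (z + v * toC t))) 0 D ->
    cder (fun t => toC (Num.sqrt (f (z + v * toC t)))) 0 (D / (2 * toC s)).
  move=> [h1 h2].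
  have D0 : im D = 0.
    by rewrite -(@derive_val _ _ _ _ _ _ _ h2) (@derive_val _ _ _ _ _ _ _ (is_derive_cst (0 : R) (0 : R) (1 : R))).
  have DE : D / (2 * toC s) = toC (re D / (2 * s)).
    rewrite [in LHS](complexE D) D0 rmorphM fmorphV rmorphM rmorph_nat /= toC0; ring.
  rewrite DE; split; last exact: is_derive_cst.
  have sq : is_derive (f (z + v * toC 0)) 1 Num.sqrt (2 * s)^-1.
    by rewrite toC0 mulr0 addr0; exact: is_derive1_sqrt.
  have := @is_derive1_comp R Num.sqrt (fun t => f (z + v * toC t)) 0 _ _ sq h1.
  by rewrite [_^-1 * _]mulrC.
move=> [h1 h2]; split; [apply: cder_cast (key _ _ h1)|apply: cder_cast (key _ _ h2)]; ring.
Qed.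

Lemma cont_sqrt (f : C R -> R) z : 0 < f z -> {for z, continuous (fun w => toC (f w))} ->
  {for z, continuous (fun w => toC (Num.sqrt (f w)))}.
Proof.
move=> f0 /cont_reim[h _]; apply/cont_reim; split; last exact: cst_continuous.
exact: (@continuous_comp _ _ _ f Num.sqrt z h (@sqrt_continuous R (f z))).
Qed.

(** The derivatives of the root are those of [f] over twice the root, so its being [C^k] makes it
    [C^(k+1)]. *)
Lemma smoothC_sqrt U (f : C R -> R) : open U -> (forall z, U z -> 0 < f z) ->
  smoothC U (fun w => toC (f w)) -> smoothC U (fun w => toC (Num.sqrt (f w))).
Proof.
move=> oU f0 sf; apply/(smoothCP _ oU) => k.
set G := (fun w => _).
have G0 z : U z -> 2 * G z != 0.
  move=> Uz; rewrite mulf_neq0 ?pnatr_eq0//; apply/eqP => /(congr1 (@re R)) /= s0.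
  by have := sqrtr_gt0 (f z); rewrite f0// s0 ltxx.
elim: k => [|k IH].
  split=> [z Uz|//]; apply: cont_sqrt; [exact: f0|exact: smoothC_cont sf Uz].
have sV : SC k U (fun z => (2 * G z)^-1).
  exact: (SCV oU G0 (SCM oU (SC_cst k 2 oU) IH)).
have s1 := (smoothCP _ oU).1 (smoothC_dz oU sf) k.
have s2 := (smoothCP _ oU).1 (smoothC_dzb oU sf) k.
apply: (@SC_intro R k U G (fun z => dz (fun w => toC (f w)) z * (2 * G z)^-1)
  (fun z => dzb (fun w => toC (f w)) z * (2 * G z)^-1) oU).
- by move=> z Uz; apply: cont_sqrt; [exact: f0|exact: smoothC_cont sf Uz].
- by move=> z Uz; apply: isD_sqrt; [exact: f0|exact: smoothC_isD sf Uz].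
- exact: (SCM oU s1 sV).
- exact: (SCM oU s2 sV).
Qed.

Definition isDv m (F : C R -> 'rV[C R]_m) z (P Q : 'rV[C R]_m) : Prop :=
  forall j, isD (fun w => F w 0 j) z (P 0 j) (Q 0 j).

Lemma DzE m (F : C R -> 'rV[C R]_m) z j : Dz F z 0 j = dz (fun w => F w 0 j) z.
Proof. by rewrite mxE. Qed.
Lemma DzbE m (F : C R -> 'rV[C R]_m) z j : Dzb F z 0 j = dzb (fun w => F w 0 j) z.
Proof. by rewrite mxE. Qed.

Lemma isDv_Dz m (F : C R -> 'rV[C R]_m) z P Q : isDv F z P Q -> Dz F z = P.
Proof. by move=> h; apply/rowP => j; rewrite mxE (isD_dz (h j)). Qed.
Lemma isDv_Dzb m (F : C R -> 'rV[C R]_m) z P Q : isDv F z P Q -> Dzb F z = Q.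
Proof. by move=> h; apply/rowP => j; rewrite mxE (isD_dzb (h j)). Qed.

Lemma smoothV_isDv m U (F : C R -> 'rV[C R]_m) z : smoothV U F -> U z ->
  isDv F z (Dz F z) (Dzb F z).
Proof. by move=> sF Uz j; rewrite !mxE; exact: (smoothC_isD (sF j) Uz). Qed.

Lemma isDv_ext m (F G : C R -> 'rV[C R]_m) z P Q : (\forall w \near z, F w = G w) ->
  isDv F z P Q -> isDv G z P Q.
Proof. by move=> FG h j; apply: isD_ext (h j); apply: filterS FG => w ->. Qed.

Lemma isDv_cst m (k : 'rV[C R]_m) z : isDv (fun=> k) z 0 0.
Proof. by move=> j; rewrite mxE; exact: isD_cst. Qed.

Lemma isDvD m (F G : C R -> 'rV[C R]_m) z P Q P' Q' : isDv F z P Q -> isDv G z P' Q' ->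
  isDv (fun w => F w + G w) z (P + P') (Q + Q').
Proof.
move=> h k j; rewrite !mxE; apply: isD_ext (isDD (h j) (k j)).
by near=> w; rewrite mxE.
Unshelve. all: by end_near. Qed.

Lemma isDvZ m (a : C R -> C R) (F : C R -> 'rV[C R]_m) z p q P Q : isD a z p q ->
  isDv F z P Q -> isDv (fun w => a w *: F w) z (p *: F z + a z *: P) (q *: F z + a z *: Q).
Proof.
move=> h k j; rewrite !mxE; apply: isD_ext (isDM h (k j)).
by near=> w; rewrite mxE.
Unshelve. all: by end_near. Qed.

Lemma isD_dot m (F G : C R -> 'rV[C R]_m) z P Q P' Q' : isDv F z P Q -> isDv G z P' Q' ->
  isD (fun w => dot (F w) (G w)) z (dot P (G z) + dot (F z) P') (dot Q (G z) + dot (F z) Q').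
Proof.
move=> h k; rewrite /dot -!big_split /=; apply: isD_sum => j.
exact: isDM (h j) (k j).
Qed.

Lemma isDv_row_mx m1 m2 (F : C R -> 'rV[C R]_m1) (G : C R -> 'rV[C R]_m2) z P Q P' Q' :
  isDv F z P Q -> isDv G z P' Q' ->
  isDv (fun w => row_mx (F w) (G w)) z (row_mx P P') (row_mx Q Q').
Proof.
move=> h k j; rewrite !mxE.
have -> : (fun w => (row_mx (F w) (G w) : 'rV_(m1 + m2)) 0 j) =
  (fun w => match fintype.split j with inl j1 => F w 0 j1 | inr j2 => G w 0 j2 end).
  by apply/funext => w; rewrite mxE.
by case: (fintype.split j) => j'; [exact: h|exact: k].
Qed.

Lemma isDv_scalar (a : C R -> C R) z p q : isD a z p q ->
  isDv (fun w => (a w)%:M : 'rV[C R]_1) z p%:M q%:M.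
Proof.
move=> h j; rewrite !ord1 !mxE eqxx !mulr1n; apply: isD_ext h.
by near=> w; rewrite mxE eqxx mulr1n.
Unshelve. all: by end_near. Qed.

Definition vconj m (v : 'rV[C R]_m) : 'rV[C R]_m := map_mx (fun a : C R => a^*) v.

Lemma isDv_conj m (F : C R -> 'rV[C R]_m) z P Q : isDv F z P Q ->
  isDv (fun w => vconj (F w)) z (vconj Q) (vconj P).
Proof.
move=> h j; rewrite !mxE; apply: isD_ext (isD_conj (h j)).
by near=> w; rewrite mxE.
Unshelve. all: by end_near. Qed.

Section SmoothVectors.
Variable U : set (C R).
Hypothesis oU : open U.

Lemma smoothV_ext m (F G : C R -> 'rV[C R]_m) : (forall z, U z -> F z = G z) ->
  smoothV U F -> smoothV U G.
Proof. by move=> FG sF j; apply: (smoothC_ext oU _ (sF j)) => z Uz; rewrite FG. Qed.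

Lemma smoothV_Dz m (F : C R -> 'rV[C R]_m) : smoothV U F -> smoothV U (Dz F).
Proof.
move=> sF j; apply: (smoothC_ext oU _ (smoothC_dz oU (sF j))) => z Uz.
by rewrite mxE.
Qed.

Lemma smoothVD m (F G : C R -> 'rV[C R]_m) : smoothV U F -> smoothV U G ->
  smoothV U (fun z => F z + G z).
Proof.
move=> sF sG j; apply: (smoothC_ext oU _ (smoothCD oU (sF j) (sG j))) => z Uz.
by rewrite mxE.
Qed.

Lemma smoothVZ m (a : C R -> C R) (F : C R -> 'rV[C R]_m) : smoothC U a -> smoothV U F ->
  smoothV U (fun z => a z *: F z).
Proof.
move=> sa sF j; apply: (smoothC_ext oU _ (smoothCM oU sa (sF j))) => z Uz.
by rewrite mxE.
Qed.

Lemma smoothV_cst m (v : 'rV[C R]_m) : smoothV U (fun=> v).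
Proof. by move=> j; exact: smoothC_cst. Qed.

Lemma smoothV_conj m (F : C R -> 'rV[C R]_m) : smoothV U F -> smoothV U (fun z => vconj (F z)).
Proof.
move=> sF j; apply: (smoothC_ext oU _ (smoothC_conj oU (sF j))) => z Uz.
by rewrite mxE.
Qed.

Lemma smoothC_dot m (F G : C R -> 'rV[C R]_m) : smoothV U F -> smoothV U G ->
  smoothC U (fun z => dot (F z) (G z)).
Proof. by move=> sF sG; apply: (smoothC_sum oU) => j; exact: (smoothCM oU (sF j) (sG j)). Qed.

Lemma smoothV_row_mx m1 m2 (F : C R -> 'rV[C R]_m1) (G : C R -> 'rV[C R]_m2) :
  smoothV U F -> smoothV U G -> smoothV U (fun z => row_mx (F z) (G z)).
Proof.
move=> sF sG j.
have -> : (fun w => (row_mx (F w) (G w) : 'rV_(m1 + m2)) 0 j) =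
  (fun w => match fintype.split j with inl j1 => F w 0 j1 | inr j2 => G w 0 j2 end).
  by apply/funext => w; rewrite mxE.
by case: (fintype.split j) => j'; [exact: sF|exact: sG].
Qed.

Lemma smoothV_scalar (a : C R -> C R) : smoothC U a -> smoothV U (fun z => (a z)%:M : 'rV[C R]_1).
Proof.
move=> sa j; rewrite ord1; apply: (smoothC_ext oU _ sa) => z _.
by rewrite mxE eqxx mulr1n.
Qed.

End SmoothVectors.

Lemma smoothV_sub m U V (F : C R -> 'rV[C R]_m) : V `<=` U -> smoothV U F -> smoothV V F.
Proof. by move=> VU sF j; exact: (smoothC_sub VU (sF j)). Qed.

End VectorCalculus.

(** * Bilinear algebra of the dot and Minkowski products *)

Section DotMink.
Variable K : comNzRingType.
Implicit Types (m : nat) (a b c d : K).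

Lemma dotC m (u v : 'rV[K]_m) : dot u v = dot v u.
Proof. by apply: eq_bigr => i _; rewrite mulrC. Qed.
Lemma dotDl m (u v w : 'rV[K]_m) : dot (u + v) w = dot u w + dot v w.
Proof. by rewrite /dot -big_split /=; apply: eq_bigr => i _; rewrite mxE mulrDl. Qed.
Lemma dotZl m a (u w : 'rV[K]_m) : dot (a *: u) w = a * dot u w.
Proof. by rewrite /dot big_distrr /=; apply: eq_bigr => i _; rewrite mxE mulrA. Qed.
Lemma dotDr m (u v w : 'rV[K]_m) : dot w (u + v) = dot w u + dot w v.
Proof. by rewrite dotC dotDl !(dotC w). Qed.
Lemma dotZr m a (u w : 'rV[K]_m) : dot w (a *: u) = a * dot w u.
Proof. by rewrite dotC dotZl (dotC w). Qed.
Lemma dot0l m (w : 'rV[K]_m) : dot 0 w = 0.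
Proof. by rewrite -(scale0r 0) dotZl mul0r. Qed.
Lemma dot0r m (w : 'rV[K]_m) : dot w 0 = 0.
Proof. by rewrite dotC dot0l. Qed.
Lemma dot_row_mx m1 m2 (u u' : 'rV[K]_m1) (v v' : 'rV[K]_m2) :
  dot (row_mx u v) (row_mx u' v') = dot u u' + dot v v'.
Proof.
rewrite /dot big_split_ord /=; congr (_ + _); apply: eq_bigr => i _.
  by rewrite !row_mxEl.
by rewrite !row_mxEr.
Qed.
Lemma dot_scalar a b : dot (a%:M : 'rV[K]_1) b%:M = a * b.
Proof. by rewrite /dot big_ord1 !mxE eqxx !mulr1n. Qed.

(** Coordinates of the Minkowski space: the Euclidean part, the direction of the pole of the sphere,
    and time. *)
Definition mk3 m (u : 'rV[K]_m) a b : 'rV[K]_(m + 1 + 1) :=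
  row_mx (row_mx u a%:M) b%:M.

Lemma mink_mk3 m (u v : 'rV[K]_m) a b c d :
  mink (mk3 u a b) (mk3 v c d) = dot u v + a * c - b * d.
Proof.
rewrite /mink /mk3 !row_mxKl dot_row_mx dot_scalar !row_mxEr !mxE eqxx !mulr1n.
by [].
Qed.

Lemma mk3D m (u v : 'rV[K]_m) a b c d :
  mk3 u a b + mk3 v c d = mk3 (u + v) (a + c) (b + d).
Proof. by rewrite /mk3 !add_row_mx -!raddfD. Qed.
Lemma mk3Z m (u : 'rV[K]_m) a b c : c *: mk3 u a b = mk3 (c *: u) (c * a) (c * b).
Proof. by rewrite /mk3 !scale_row_mx !scale_scalar_mx. Qed.

Lemma minkE m (u v : 'rV[K]_(m + 1)) :
  mink u v = dot u v - (u 0 (rshift m ord0) * v 0 (rshift m ord0)) *+ 2.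
Proof.
rewrite -[u]hsubmxK -[v]hsubmxK dot_row_mx /mink !row_mxKl !row_mxEr /dot big_ord1; ring.
Qed.
Lemma minkC m (u v : 'rV[K]_(m + 1)) : mink u v = mink v u.
Proof. by rewrite !minkE dotC mulrC. Qed.
Lemma minkDl m (u v w : 'rV[K]_(m + 1)) : mink (u + v) w = mink u w + mink v w.
Proof. rewrite !minkE dotDl mxE; ring. Qed.
Lemma minkZl m a (u w : 'rV[K]_(m + 1)) : mink (a *: u) w = a * mink u w.
Proof. rewrite !minkE dotZl mxE; ring. Qed.
Lemma minkDr m (u v w : 'rV[K]_(m + 1)) : mink w (u + v) = mink w u + mink w v.
Proof. by rewrite minkC minkDl !(minkC w). Qed.
Lemma minkZr m a (u w : 'rV[K]_(m + 1)) : mink w (a *: u) = a * mink w u.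
Proof. by rewrite minkC minkZl (minkC w). Qed.
Lemma mk3P m (v : 'rV[K]_(m + 1 + 1)) : exists u a b, v = mk3 u a b.
Proof.
exists (lsubmx (lsubmx v)), (rsubmx (lsubmx v) 0 0), (rsubmx v 0 0).
by rewrite /mk3 -!mx11_scalar !hsubmxK.
Qed.
End DotMink.

(* Keeps unification from unfolding derivatives down to limits. *)
#[global] Opaque dz dzb Dz Dzb.

(** * The light-cone lift in a chart *)

Lemma mink_subZ m (K : comNzRingType) (a : K) (u v w : 'rV[K]_(m + 1)) :
  mink (u - a *: v) w = mink u w - a * mink v w.
Proof. by rewrite -scaleNr minkDl minkZl mulNr. Qed.

(** The multiple of [T] is chosen to kill the pairing with [Tb]. It disturbs no other pairing, since
    [T] is null and orthogonal to [L], [P] and [Z]. *)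
Lemma nrm_pairings m (K : fieldType) (L T Tb P Z : 'rV[K]_(m + 1)) (r q : K) : r != 0 ->
  mink Z L = 0 -> mink Z T = 0 -> mink Z Tb = q -> mink Z P = 0 -> mink Z Z = 0 ->
  mink L T = 0 -> mink T T = 0 -> mink T Tb = r -> mink T P = 0 ->
  let k := Z - (q * r^-1) *: T in
  [/\ mink k L = 0, mink k T = 0, mink k Tb = 0, mink k P = 0 & mink k k = 0].
Proof.
move=> r0 ZL ZT ZTb ZP ZZ LT TT TTb TP k.
have kE w : mink k w = mink Z w - q * r^-1 * mink T w by exact: mink_subZ.
have Tk : mink T k = 0 by rewrite minkC kE ZT TT mulr0 subrr.
split; first by rewrite kE ZL minkC LT mulr0 subrr.
- by rewrite kE ZT TT mulr0 subrr.
- by rewrite kE ZTb TTb mulfVK// subrr.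
- by rewrite kE ZP TP mulr0 subrr.
- by rewrite kE Tk mulr0 subr0 minkC kE ZZ minkC ZT mulr0 subrr.
Qed.

Section LocalGeometry.
Variables (R : realType) (n : nat) (U : set (C R)) (x : C R -> 'rV[R]_n).
Let X (z : C R) : 'rV[C R]_n := cvec (x z).
Hypothesis oU : open U.
Hypothesis sX : smoothV U X.
Hypothesis conf : forall z, U z -> dot (Dz X z) (Dz X z) = 0 /\ 0 < dot (Dz X z) (Dzb X z).
Hypothesis minimal : forall z, U z -> Dzb (Dz X) z = 0.
Hypothesis superconf : forall z, U z -> dot (Dz (Dz X) z) (Dz (Dz X) z) = 0.
Implicit Types (z w : C R).

Lemma isDv_mk3 m (F : C R -> 'rV[C R]_m) (a b : C R -> C R) z P Q p q p' q' :
  isDv F z P Q -> isD a z p q -> isD b z p' q' ->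
  isDv (fun w => mk3 (F w) (a w) (b w)) z (mk3 P p p') (mk3 Q q q').
Proof.
by move=> dF da db; apply: isDv_row_mx; [apply: isDv_row_mx => //|]; exact: isDv_scalar.
Qed.

Lemma vconjK m (v : 'rV[C R]_m) : vconj (vconj v) = v.
Proof. by apply/rowP => j; rewrite !mxE conjCK. Qed.
Lemma vconj_cvec m (v : 'rV[R]_m) : vconj (cvec v) = cvec v.
Proof.
by apply/rowP => j; rewrite !mxE; apply: complex_eqP; rewrite ?re_conj ?im_conj //= oppr0.
Qed.
Lemma conj_dot m (u v : 'rV[C R]_m) : (dot u v)^* = dot (vconj u) (vconj v).
Proof.
by rewrite /dot rmorph_sum /=; apply: eq_bigr => i _; rewrite rmorphM !mxE.
Qed.

Definition imm_z z := Dz X z.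
Definition imm_zz z := Dz imm_z z.
(** [metric] and [supp] are [rho] and [b]. The conjugate of [imm_z] stands for [x_zbar], with which
    it agrees on [U] by [Dzb_X]; being algebraic, it spares side conditions. *)
Definition metric z := dot (imm_z z) (vconj (imm_z z)).
Definition metric_z z := dot (imm_zz z) (vconj (imm_z z)).
Definition supp z := dot (X z) (imm_z z).
Definition supp_z z := dot (X z) (imm_zz z).

(* [clift] is the lift of [x] to the light cone with [<clift, cone_pt> = -1], where [cone_pt] represents the point at infinity. *)
Definition cone_pt : 'rV[C R]_(n + 1 + 1) := mk3 0 1 1.
Definition clift z : 'rV[C R]_(n + 1 + 1) :=
  mk3 (X z) ((dot (X z) (X z) + -1) / 2) ((dot (X z) (X z) + 1) / 2).
Definition clift_z z : 'rV[C R]_(n + 1 + 1) := mk3 (imm_z z) (supp z) (supp z).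
Definition clift_zb z := vconj (clift_z z).
Definition clift_zz z : 'rV[C R]_(n + 1 + 1) := mk3 (imm_zz z) (supp_z z) (supp_z z).

Local Notation A := imm_z.
Local Notation A2 := imm_zz.
Local Notation rho := metric.
Local Notation T := clift_z.
Local Notation Tb := clift_zb.

Lemma vconjX z : vconj (X z) = X z.
Proof. exact: vconj_cvec. Qed.

Lemma real_dv m (F : C R -> 'rV[C R]_m) z P Q : (forall w, vconj (F w) = F w) ->
  isDv F z P Q -> Q = vconj P.
Proof.
move=> Fr dF; apply/rowP => j; rewrite mxE; apply: isD_real (dF j).
near=> w; have := congr1 (fun v : 'rV[C R]_m => im (v 0 j)) (Fr w); rewrite mxE im_conj; lra.
Unshelve. all: by end_near. Qed.

Lemma isDv_X z : U z -> isDv X z (A z) (vconj (A z)).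
Proof.
move=> Uz; have h := smoothV_isDv sX Uz.
by rewrite -(real_dv (@vconjX) h).
Qed.

Lemma Dzb_X z : U z -> Dzb X z = vconj (A z).
Proof. by move=> /isDv_X/isDv_Dzb. Qed.

Lemma smooth_A : smoothV U A.
Proof. exact: (smoothV_Dz oU sX). Qed.
Lemma smooth_A2 : smoothV U A2.
Proof. exact: (smoothV_Dz oU smooth_A). Qed.

Lemma isDv_A z : U z -> isDv A z (A2 z) 0.
Proof. by move=> Uz; have := smoothV_isDv smooth_A Uz; rewrite minimal. Qed.

Lemma isDv_Ab z : U z -> isDv (fun w => vconj (A w)) z 0 (vconj (A2 z)).
Proof.
move=> Uz; have := isDv_conj (isDv_A Uz).
by have -> : vconj (0 : 'rV[C R]_n) = 0 by apply/rowP => j; rewrite !mxE conjC0.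
Qed.

Lemma A_derivable j z : U z -> derivable (fun w => A w 0 j) z 1.
Proof.
move=> Uz; have H w : U w -> dzb (fun w => A w 0 j) w = 0.
  by move=> Uw; rewrite (isD_dzb (isDv_A Uw j)) mxE.
by have [] := smoothC_holomorphic oU (smooth_A j) H Uz.
Qed.

(** No interchange of derivatives is used: the coordinates of [x_z] are holomorphic, hence so are
    their complex derivatives, the coordinates of [x_zz]. *)
Lemma isDv_A2 z : U z -> isDv A2 z (Dz A2 z) 0.
Proof.
move=> Uz; have h := smoothV_isDv smooth_A2 Uz.
suff E : Dzb A2 z = 0 by rewrite -E.
apply/rowP => j; rewrite DzbE mxE.
have dA : derivable (derive1 (fun w => A w 0 j)) z 1.
  by apply: derivable_derive1; apply: filterS (open_near oU Uz) => w; exact: A_derivable.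
have nE : \forall w \near z, derive1 (fun w => A w 0 j) w = A2 w 0 j.
  apply: filterS (open_near oU Uz) => w Uw.
  by rewrite /imm_zz DzE; symmetry; exact: isD_dz (isD_holo (derivable_isCd (@A_derivable j w Uw))).
by rewrite (isD_dzb (isD_ext nE (isD_holo (derivable_isCd dA)))).
Qed.

Lemma dot_A_A z : U z -> dot (A z) (A z) = 0.
Proof. by move=> /conf[]. Qed.
Lemma dot_Ab_Ab z : U z -> dot (vconj (A z)) (vconj (A z)) = 0.
Proof. by move=> /dot_A_A h; rewrite -conj_dot h conjC0. Qed.
Lemma dot_A2_A2 z : U z -> dot (A2 z) (A2 z) = 0.
Proof. exact: superconf. Qed.

Lemma dot_null_dz m (F : C R -> 'rV[C R]_m) z P Q : (\forall w \near z, dot (F w) (F w) = 0) ->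
  isDv F z P Q -> dot P (F z) = 0.
Proof.
move=> nE dF; have := isD_dz (isD_ext nE (isD_dot dF dF)).
rewrite (isD_dz (isD_cst 0 z)) (dotC (F z)) => /esym/eqP.
by rewrite -mulr2n mulrn_eq0 => /eqP.
Qed.

Lemma dot_A2_A z : U z -> dot (A2 z) (A z) = 0.
Proof.
move=> Uz; apply: (dot_null_dz _ (isDv_A Uz)).
by apply: filterS (open_near oU Uz) => w; exact: dot_A_A.
Qed.

Lemma rho_gt0 z : U z -> 0 < rho z.
Proof. by move=> Uz; have [_] := conf Uz; rewrite Dzb_X. Qed.
Lemma rho_neq0 z : U z -> rho z != 0.
Proof. by move=> /rho_gt0; rewrite lt0r => /andP[]. Qed.
Lemma rho_conj z : (rho z)^* = rho z.
Proof. by rewrite conj_dot vconjK dotC. Qed.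
Lemma supp_conj z : (supp z)^* = dot (X z) (vconj (A z)).
Proof. by rewrite conj_dot vconjX. Qed.

Lemma lift_zbE z : Tb z = mk3 (vconj (A z)) (supp z)^* (supp z)^*.
Proof.
apply/rowP => j; rewrite /clift_zb /clift_z /mk3 !mxE.
case: fintype.split => j'; rewrite !mxE; last by rewrite rmorphMn.
by case: fintype.split => j''; rewrite !mxE// rmorphMn.
Qed.

Lemma isD_supp z : U z -> isD supp z (supp_z z) (rho z).
Proof.
move=> Uz; have := isD_dot (isDv_X Uz) (isDv_A Uz).
by rewrite dot_A_A// add0r dot0r addr0 (dotC (vconj _)).
Qed.

Lemma isD_supp_z z : U z -> isD supp_z z (dz supp_z z) (metric_z z).
Proof.
move=> Uz; have h := isD_dot (isDv_X Uz) (isDv_A2 Uz).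
have E := isD_dz h; rewrite E; move: h.
by rewrite dot0r addr0 (dotC (vconj _)).
Qed.

Lemma isD_half_dot m (F : C R -> 'rV[C R]_m) (c : C R) z P Q : isDv F z P Q ->
  isD (fun w => (dot (F w) (F w) + c) / 2) z (dot (F z) P) (dot (F z) Q).
Proof.
move=> dF; have := isDM (isDD (isD_dot dF dF) (isD_cst c z)) (isD_cst 2^-1 z).
rewrite !mulr0 !addr0 (dotC P) (dotC Q).
have hh (a : C R) : (a + a) / 2 = a by field.
by rewrite !hh.
Qed.

Lemma isDv_lift z : U z -> isDv clift z (T z) (Tb z).
Proof.
move=> Uz; have dX := isDv_X Uz; rewrite lift_zbE supp_conj.
by apply: (isDv_mk3 dX); exact: isD_half_dot dX.
Qed.

Lemma cone_ptZ (a : C R) : a *: cone_pt = mk3 0 a a.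
Proof. by rewrite mk3Z scaler0 mulr1. Qed.

Lemma isDv_lift_z z : U z -> isDv T z (clift_zz z) (rho z *: cone_pt).
Proof.
move=> Uz; rewrite cone_ptZ.
by apply: isDv_mk3; [exact: isDv_A|exact: isD_supp|exact: isD_supp].
Qed.

Lemma isDv_lift_zz z : U z -> isDv clift_zz z (Dz clift_zz z) (metric_z z *: cone_pt).
Proof.
move=> Uz.
have h : isDv clift_zz z (mk3 (Dz A2 z) (dz supp_z z) (dz supp_z z)) (mk3 0 (metric_z z) (metric_z z)).
  by apply: isDv_mk3; [exact: isDv_A2|exact: isD_supp_z|exact: isD_supp_z].
by rewrite cone_ptZ (isDv_Dz h).
Qed.

Lemma isD_dot_holo m (F G : C R -> 'rV[C R]_m) z P Q : isDv F z P 0 -> isDv G z 0 Q ->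
  isD (fun w => dot (F w) (G w)) z (dot P (G z)) (dot (F z) Q).
Proof. by move=> dF dG; have := isD_dot dF dG; rewrite dot0l dot0r addr0 add0r. Qed.

Lemma metric_z_conj z : (metric_z z)^* = dot (A z) (vconj (A2 z)).
Proof. by rewrite /metric_z conj_dot vconjK dotC. Qed.

Lemma isD_rho z : U z -> isD rho z (metric_z z) (metric_z z)^*.
Proof. by move=> Uz; rewrite metric_z_conj; exact: isD_dot_holo (isDv_A Uz) (isDv_Ab Uz). Qed.

Lemma isD_dot_dz m (F G : C R -> 'rV[C R]_m) z P Q : isDv F z P 0 -> isDv G z 0 Q ->
  isD (fun w => dot (F w) (G w)) z (dz (fun w => dot (F w) (G w)) z) (dot (F z) Q).
Proof. by move=> dF dG; have h := isD_dot_holo dF dG; rewrite (isD_dz h). Qed.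

Lemma isD_metric_z z : U z -> isD metric_z z (dz metric_z z) (dot (A2 z) (vconj (A2 z))).
Proof. by move=> Uz; exact: isD_dot_dz (isDv_A2 Uz) (isDv_Ab Uz). Qed.

Definition phi z := metric_z z * (rho z)^-1.

Lemma smooth_rho : smoothC U rho.
Proof. exact: (smoothC_dot oU smooth_A (smoothV_conj oU smooth_A)). Qed.
Lemma smooth_phi : smoothC U phi.
Proof.
apply: (smoothCM oU); first exact: (smoothC_dot oU smooth_A2 (smoothV_conj oU smooth_A)).
by apply: (smoothCV oU); [exact: rho_neq0|exact: smooth_rho].
Qed.
Lemma smooth_supp : smoothC U supp.
Proof. exact: (smoothC_dot oU sX smooth_A). Qed.

(** The mixed second derivative of [log rho], which is why it is real. *)
Definition phi_zb z := dot (A2 z) (vconj (A2 z)) * (rho z)^-1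
  - metric_z z * (metric_z z)^* * ((rho z)^-1 * (rho z)^-1).

Lemma isD_div_dz (F G : C R -> C R) z p q p' q' : G z != 0 -> isD F z p q -> isD G z p' q' ->
  isD (fun w => F w * (G w)^-1) z (dz (fun w => F w * (G w)^-1) z)
    (q * (G z)^-1 - F z * q' * ((G z)^-1 * (G z)^-1)).
Proof.
move=> G0 dF dG; have h := isDM dF (isDV G0 dG); rewrite (isD_dz h).
by have -> : q * (G z)^-1 - F z * q' * ((G z)^-1 * (G z)^-1) =
  q * (G z)^-1 + F z * - (q' * ((G z)^-1 * (G z)^-1)) by ring.
Qed.

Lemma isD_phi z : U z -> isD phi z (dz phi z) (phi_zb z).
Proof. by move=> Uz; exact: isD_div_dz (rho_neq0 Uz) (isD_metric_z Uz) (isD_rho Uz). Qed.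

Lemma dot_vconj_real m (u : 'rV[C R]_m) : (dot u (vconj u))^* = dot u (vconj u).
Proof. by rewrite conj_dot vconjK dotC. Qed.

Lemma phi_zb_conj z : (phi_zb z)^* = phi_zb z.
Proof.
have gen (a m r : C R) : a^* = a -> r^* = r ->
    (a * r^-1 - m * m^* * (r^-1 * r^-1))^* = a * r^-1 - m * m^* * (r^-1 * r^-1).
  by move=> a1 r1; rewrite rmorphB !rmorphM !fmorphV /= a1 r1 conjCK (mulrC m^*).
by apply: gen; [exact: dot_vconj_real|exact: rho_conj].
Qed.

Lemma mink_lift_lift z : mink (clift z) (clift z) = 0.
Proof. by rewrite mink_mk3; field. Qed.
Lemma mink_lift_T z : mink (clift z) (T z) = 0.
Proof. by rewrite mink_mk3 -/(supp z); field. Qed.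
Lemma mink_lift_Tb z : mink (clift z) (Tb z) = 0.
Proof. by rewrite lift_zbE mink_mk3 -supp_conj; field. Qed.
Lemma mink_lift_pt z : mink (clift z) cone_pt = -1.
Proof. by rewrite mink_mk3 dot0r; field. Qed.
Lemma mink_T_T z : U z -> mink (T z) (T z) = 0.
Proof. by move=> Uz; rewrite mink_mk3 dot_A_A// add0r subrr. Qed.
Lemma mink_Tb_Tb z : U z -> mink (Tb z) (Tb z) = 0.
Proof. by move=> Uz; rewrite lift_zbE mink_mk3 dot_Ab_Ab// add0r subrr. Qed.
Lemma mink_T_Tb z : mink (T z) (Tb z) = rho z.
Proof. by rewrite lift_zbE mink_mk3 addrK. Qed.
Lemma mink_T_pt z : mink (T z) cone_pt = 0.
Proof. by rewrite mink_mk3 dot0r; ring. Qed.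
Lemma mink_Tb_pt z : mink (Tb z) cone_pt = 0.
Proof. by rewrite lift_zbE mink_mk3 dot0r; ring. Qed.
Lemma mink_pt_pt : mink cone_pt cone_pt = 0.
Proof. by rewrite mink_mk3 dot0r; ring. Qed.

Lemma mink_zz_lift z : mink (clift_zz z) (clift z) = 0.
Proof. by rewrite minkC mink_mk3 -/(supp_z z); field. Qed.
Lemma mink_zz_T z : U z -> mink (clift_zz z) (T z) = 0.
Proof. by move=> Uz; rewrite mink_mk3 dot_A2_A//; ring. Qed.
Lemma mink_zz_Tb z : mink (clift_zz z) (Tb z) = metric_z z.
Proof. by rewrite lift_zbE mink_mk3 addrK. Qed.
Lemma mink_zz_pt z : mink (clift_zz z) cone_pt = 0.
Proof. by rewrite mink_mk3 dot0r; ring. Qed.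
Lemma mink_zz_zz z : U z -> mink (clift_zz z) (clift_zz z) = 0.
Proof. by move=> Uz; rewrite mink_mk3 dot_A2_A2//; ring. Qed.

(** The second derivative of the lift without its tangential part; [kappa] is a real multiple of
    it. *)
Definition nrm z := clift_zz z - phi z *: T z.

Lemma nrm_table z : U z ->
  [/\ mink (nrm z) (clift z) = 0, mink (nrm z) (T z) = 0, mink (nrm z) (Tb z) = 0,
      mink (nrm z) cone_pt = 0 & mink (nrm z) (nrm z) = 0].
Proof.
move=> Uz; apply: (nrm_pairings (rho_neq0 Uz)).
- exact: mink_zz_lift.
- exact: mink_zz_T.
- exact: mink_zz_Tb.
- exact: mink_zz_pt.
- exact: mink_zz_zz.
- exact: mink_lift_T.
- exact: mink_T_T.
- exact: mink_T_Tb.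
- exact: mink_T_pt.
Qed.

End LocalGeometry.

(** * Frames of the conformal subbundle *)

Section ConformalSubbundle.
Variables (R : realType) (n : nat) (Y : C R -> 'rV[R]_(n + 1 + 1)) (z : C R).
Let Yc (w : C R) : 'rV[C R]_(n + 1 + 1) := cvec (Y w).
Variables (Y1 Y2 : 'rV[C R]_(n + 1 + 1)).
Hypothesis dY : Dz Yc z = Y1.
Hypothesis dY2 : Dzb (Dz Yc) z = Y2.
Hypothesis Y2r : vconj Y2 = Y2.

Lemma cvecK m (v : 'rV[C R]_m) : vconj v = v -> cvec (map_mx (@re R) v) = v.
Proof.
move=> vr; apply/rowP => j; rewrite !mxE.
have := congr1 (fun u : 'rV[C R]_m => im (u 0 j)) vr; rewrite mxE im_conj => v0.
by apply: complex_eqP => //=; lra.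
Qed.

Lemma cvec_re m (v : 'rV[C R]_m) : cvec (map_mx (@re R) v) = 2^-1 *: (v + vconj v).
Proof.
apply/rowP => j; rewrite !mxE.
have -> : 2^-1 = toC (2^-1 : R) by rewrite fmorphV rmorph_nat.
by apply: complex_eqP; rewrite !(reM, imM, reD, imD, re_conj, im_conj) /=; field.
Qed.

Lemma cvec_im m (v : 'rV[C R]_m) : cvec (map_mx (@im R) v) = (- (imag R / 2)) *: (v - vconj v).
Proof.
apply/rowP => j; rewrite !mxE.
have -> : imag R / 2 = imag R * toC (2^-1 : R) by rewrite fmorphV rmorph_nat.
by apply: complex_eqP; rewrite !(reM, imM, reD, imD, reN, imN, re_conj, im_conj) /=; field.
Qed.

Lemma Vmx_rows (i : 'I_4) : row i (map_mx (@toC R) (Vmx Y z)) =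
  [:: Yc z; 2^-1 *: (Y1 + vconj Y1); (- (imag R / 2)) *: (Y1 - vconj Y1); Y2]`_i.
Proof.
have -> : row i (map_mx (@toC R) (Vmx Y z)) = cvec (row i (Vmx Y z)).
  by apply/rowP => j; rewrite !mxE.
rewrite /Vmx rowK -/Yc dY dY2; case: i => -[|[|[|[|//]]]] /= _.
- by [].
- exact: cvec_re.
- exact: cvec_im.
- exact: cvecK.
Qed.

Lemma in_VC_add u v : in_VC Y z u -> in_VC Y z v -> in_VC Y z (u + v).
Proof. exact: addmx_sub. Qed.
Lemma in_VC_scale a u : in_VC Y z u -> in_VC Y z (a *: u).
Proof. exact: scalemx_sub. Qed.

Lemma in_VC_Y : in_VC Y z (Yc z).
Proof. by have := row_sub (0 : 'I_4) (map_mx (@toC R) (Vmx Y z)); rewrite Vmx_rows. Qed.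
Lemma in_VC_Y2 : in_VC Y z Y2.
Proof. by have := row_sub (3 : 'I_4) (map_mx (@toC R) (Vmx Y z)); rewrite Vmx_rows. Qed.
Lemma in_VC_reim : in_VC Y z (2^-1 *: (Y1 + vconj Y1)) /\
  in_VC Y z ((- (imag R / 2)) *: (Y1 - vconj Y1)).
Proof.
by split; [have := row_sub (1 : 'I_4) (map_mx (@toC R) (Vmx Y z))|
  have := row_sub (2 : 'I_4) (map_mx (@toC R) (Vmx Y z))]; rewrite Vmx_rows.
Qed.
Lemma in_VC_Y1 : in_VC Y z Y1.
Proof.
have [h1 h2] := in_VC_reim.
have := in_VC_add h1 (in_VC_scale (imag R) h2).
have -> // : 2^-1 *: (Y1 + vconj Y1) + imag R *: (- (imag R / 2) *: (Y1 - vconj Y1)) = Y1.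
move: (vconj Y1) => V; apply/rowP => j; rewrite !mxE.
have -> : imag R * (- (imag R / 2) * (Y1 0 j - V 0 j)) =
  - (imag R * imag R) / 2 * (Y1 0 j - V 0 j) by ring.
by rewrite imag2 opprK; field.
Qed.

Lemma in_V_cvec v : in_V Y z v <-> in_VC Y z (cvec v).
Proof. by rewrite /in_V /in_VC /cvec map_submx. Qed.

Lemma in_VCP u : in_VC Y z u -> exists a b c d,
  u = a *: Yc z + b *: Y1 + c *: vconj Y1 + d *: Y2.
Proof.
move=> /submxP[D ->]; rewrite mulmx_sum_row !big_ord_recl big_ord0 !Vmx_rows /=.
move: (D 0 _) (D 0 _) (D 0 _) (D 0 _) => d c b a.
exists a, (b / 2 - c * (imag R / 2)), (b / 2 + c * (imag R / 2)), d.
by move: (vconj Y1) (Yc z) => V W; apply/rowP => j; rewrite !mxE; field.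
Qed.

End ConformalSubbundle.

(** * The frame of the canonical lift, from the derivatives and pairings of a null frame *)

Section AbstractFrame.
Variables (R : realType) (n : nat) (U : set (C R)).
Variables (L T Tb Z : C R -> 'rV[C R]_(n + 1 + 1)) (P : 'rV[C R]_(n + 1 + 1)).
Variables (rho phi phib : C R -> C R).
Implicit Types (z w : C R).
Hypothesis oU : open U.
Hypothesis sL : smoothV U L.
Hypothesis srho : smoothC U rho.
Hypothesis dL : forall z, U z -> isDv L z (T z) (Tb z).
Hypothesis dT : forall z, U z -> isDv T z (Z z) (rho z *: P).
Hypothesis dZ : forall z, U z -> isDv Z z (Dz Z z) ((phi z * rho z) *: P).
Hypothesis drho : forall z, U z -> isD rho z (phi z * rho z) (phi z * rho z)^*.
Hypothesis dphi : forall z, U z -> isD phi z (dz phi z) (phib z).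
Hypothesis phibr : forall z, (phib z)^* = phib z.
Hypothesis rho0 : forall z, U z -> 0 < rho z.
Hypothesis Lr : forall z, vconj (L z) = L z.
Hypothesis Pr : vconj P = P.
Hypothesis Tr : forall z, vconj (T z) = Tb z.
Hypothesis LL : forall z, mink (L z) (L z) = 0.
Hypothesis LT : forall z, mink (L z) (T z) = 0.
Hypothesis LTb : forall z, mink (L z) (Tb z) = 0.
Hypothesis LP : forall z, mink (L z) P = -1.
Hypothesis TT : forall z, U z -> mink (T z) (T z) = 0.
Hypothesis TbTb : forall z, U z -> mink (Tb z) (Tb z) = 0.
Hypothesis TTb : forall z, mink (T z) (Tb z) = rho z.
Hypothesis TP : forall z, mink (T z) P = 0.
Hypothesis TbP : forall z, mink (Tb z) P = 0.
Hypothesis PP : mink P P = 0.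

Definition frm_k z := Z z - phi z *: T z.
Local Notation k := frm_k.
Hypothesis ktable : forall z, U z ->
  [/\ mink (k z) (L z) = 0, mink (k z) (T z) = 0, mink (k z) (Tb z) = 0,
      mink (k z) P = 0 & mink (k z) (k z) = 0].

(** The positive factor with [lam ^ 2 * rho = 1 / 2], the normalisation [<Y_z, Y_zbar> = 1 / 2] of
    the canonical lift [lam L]. *)
Definition lamR z : R := (Num.sqrt (2 * re (rho z)))^-1.
Definition lam z : C R := toC (lamR z).

Lemma rhoE z : U z -> rho z = toC (re (rho z)) /\ 0 < re (rho z).
Proof.
move=> /rho0; rewrite ltC => /andP[/eqP i0 r0]; split=> //.
by apply: complex_eqP; rewrite ?im_toC -?i0.
Qed.

Lemma rho_neq z : U z -> rho z != 0.
Proof. by move=> /rho0; rewrite lt0r => /andP[]. Qed.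

Lemma lamR_gt0 z : U z -> 0 < lamR z.
Proof. by move=> /rhoE[_ r0]; rewrite invr_gt0 sqrtr_gt0 mulr_gt0. Qed.
Lemma lam_neq0 z : U z -> lam z != 0.
Proof.
move=> /lamR_gt0 l0; apply/eqP => /(congr1 (@re R)) /= l1.
by rewrite l1 ltxx in l0.
Qed.
Lemma lam2 z : U z -> lam z * lam z = (2 * rho z)^-1.
Proof.
move=> Uz; have [rE r0] := rhoE Uz.
rewrite /lam -rmorphM /= /lamR -invfM -expr2 sqr_sqrtr; last by rewrite mulr_ge0// ltW.
by rewrite fmorphV rmorphM rmorph_nat /= -rE.
Qed.

(** As [lam] is [(2 rho) ^ (- 1 / 2)] and [rho_z = phi rho], its logarithmic derivative is
    [- phi / 2]. *)
Lemma smooth_isD_lam : smoothC U lam /\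
  forall z, U z -> isD lam z (- (phi z / 2) * lam z) (- ((phi z)^* / 2) * lam z).
Proof.
have pos z : U z -> 0 < 2 * re (rho z) by move=> /rhoE[_ r0]; rewrite mulr_gt0.
have two z : U z -> 2 * rho z = toC (2 * re (rho z)).
  by move=> /rhoE[rE _]; rewrite rmorphM rmorph_nat /= -rE.
have s2 : smoothC U (fun z => toC (2 * re (rho z))).
  exact: (smoothC_ext oU two (smoothCZ oU 2 srho)).
have ss := smoothC_sqrt oU pos s2.
have lamE z : (toC (Num.sqrt (2 * re (rho z))))^-1 = lam z by rewrite /lam /lamR fmorphV.
have S0 z : U z -> toC (Num.sqrt (2 * re (rho z))) != 0.
  move=> /pos p0; apply/eqP => /(congr1 (@re R)) /= s0.
  by have := sqrtr_gt0 (2 * re (rho z)); rewrite p0 s0 ltxx.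
split; first exact: (smoothC_ext oU (fun z _ => lamE z) (smoothCV oU S0 ss)).
move=> z Uz.
have nE : \forall w \near z, 2 * rho w = toC (2 * re (rho w)).
  by apply: filterS (open_near oU Uz) => w; exact: two.
have d1 := isD_ext nE (isDZ 2 (drho Uz)).
have d2 := isDV (S0 z Uz) (isD_sqrt (pos z Uz) d1).
have nE' : \forall w \near z, (toC (Num.sqrt (2 * re (rho w))))^-1 = lam w.
  by near=> w.
have := isD_ext nE' d2.
have l2 := lam2 Uz; have r0 := rho_neq Uz; have s0 := S0 z Uz.
have lE := lamE z.
move: lE s0 l2; move: (toC (Num.sqrt _)) (lam z) => S l <- s0 l2.
have S2 : S * S = 2 * rho z by rewrite -[LHS]invrK invfM l2 invrK.
have gen (q : C R) : - (2 * (q * rho z) / (2 * S) * (S^-1 / S)) = - (q / 2) / S.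
  have -> : 2 * (q * rho z) = q * (S * S) by rewrite S2; ring.
  by field.
have rr : (rho z)^* = rho z.
  by have [rE _] := rhoE Uz; rewrite rE; apply: complex_eqP; rewrite ?re_conj ?im_conj /= ?oppr0.
by rewrite rmorphM /= rr !gen.
Unshelve. all: by end_near. Qed.

Definition smooth_lam := smooth_isD_lam.1.
Lemma isD_lam z : U z -> isD lam z (- (phi z / 2) * lam z) (- ((phi z)^* / 2) * lam z).
Proof. exact: smooth_isD_lam.2. Qed.

(** The logarithmic derivative of [lam]; written with it, the derivatives of [lam L] keep the common
    factor [lam]. *)
Definition th z := - (phi z / 2).
Definition thz z := - (dz phi z / 2).
Definition thzb z := - (phib z / 2).

Lemma isD_th z : U z -> isD th z (thz z) (thzb z).
Proof.
move=> Uz; have := isDZ (- 2^-1) (dphi Uz); rewrite /thz /thzb.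
have -> : - 2^-1 * dz phi z = - (dz phi z / 2) by move: (dz phi z) => a; ring.
have -> : - 2^-1 * phib z = - (phib z / 2) by ring.
by apply: isD_ext; near=> w; rewrite /th; ring.
Unshelve. all: by end_near. Qed.

Lemma conj_half (a : C R) : (a / 2)^* = a^* / 2.
Proof. by rewrite rmorphM fmorphV rmorph_nat. Qed.

Lemma th_conj z : (th z)^* = - ((phi z)^* / 2).
Proof. by rewrite /th rmorphN /= conj_half. Qed.
Lemma thzb_conj z : (thzb z)^* = thzb z.
Proof. by rewrite /thzb rmorphN /= conj_half phibr. Qed.

Definition Yc z := lam z *: L z.
Definition Yz z := lam z *: (th z *: L z + T z).
Definition Yzb z := lam z *: ((th z)^* *: L z + Tb z).
Definition Yzzb z := lam z *: ((th z * (th z)^* + thzb z) *: L z + th z *: Tb z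
  + (th z)^* *: T z + rho z *: P).
Definition kap z := lam z *: k z.
Definition sch z := dz phi z - phi z * phi z / 2.

Lemma smooth_Yc : smoothV U Yc.
Proof. exact: (smoothVZ oU smooth_lam sL). Qed.

Lemma isDv_Yc z : U z -> isDv Yc z (Yz z) (Yzb z).
Proof.
move=> Uz; have := isDvZ (isD_lam Uz) (dL Uz); rewrite -/(th z) -th_conj.
have gen (t l : C R) (v w : 'rV[C R]_(n + 1 + 1)) : (t * l) *: v + l *: w = l *: (t *: v + w).
  by rewrite scalerDr scalerA mulrC.
by rewrite !gen.
Qed.

Lemma isDv_Yz z : U z -> isDv Yz z (- (sch z / 2) *: Yc z + kap z) (Yzzb z).
Proof.
move=> Uz.
have := isDvZ (isD_lam Uz) (isDvD (isDvZ (isD_th Uz) (dL Uz)) (dT Uz)).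
rewrite -/(th z) -th_conj /Yzzb /kap /frm_k /Yc.
have -> : - (sch z / 2) = th z * th z + thz z.
  by rewrite /sch /th /thz; move: (dz phi z) => a; field.
have phE : phi z = - (2 * th z) by rewrite /th; field.
rewrite phE.
have g1 (t tz l : C R) (v a c : 'rV[C R]_(n + 1 + 1)) :
   (t * l) *: (t *: v + a) + l *: (tz *: v + t *: a + c) =
   (t * t + tz) *: (l *: v) + l *: (c - (- (2 * t)) *: a).
  by apply/rowP => j; rewrite !mxE; ring.
have g2 (t tb tzb l r : C R) (v a b p : 'rV[C R]_(n + 1 + 1)) :
   (tb * l) *: (t *: v + a) + l *: (tzb *: v + t *: b + r *: p) =
   l *: ((t * tb + tzb) *: v + t *: b + tb *: a + r *: p).
  by apply/rowP => j; rewrite !mxE; ring.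
by rewrite g1 g2.
Qed.

Lemma vconjD m (u v : 'rV[C R]_m) : vconj (u + v) = vconj u + vconj v.
Proof. by apply/rowP => j; rewrite !mxE rmorphD. Qed.
Lemma vconjZ m (a : C R) (v : 'rV[C R]_m) : vconj (a *: v) = a^* *: vconj v.
Proof. by apply/rowP => j; rewrite !mxE rmorphM. Qed.

Lemma Tbr z : vconj (Tb z) = T z.
Proof. by rewrite -Tr; apply/rowP => j; rewrite !mxE conjCK. Qed.
Lemma lam_conj z : (lam z)^* = lam z.
Proof. by apply: complex_eqP; rewrite ?re_conj ?im_conj /= ?oppr0. Qed.
Lemma rhor z : U z -> (rho z)^* = rho z.
Proof.
by move=> /rhoE[rE _]; rewrite rE; apply: complex_eqP; rewrite ?re_conj ?im_conj /= ?oppr0.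
Qed.

Lemma Yz_conj z : vconj (Yz z) = Yzb z.
Proof. by rewrite /Yz /Yzb !(vconjZ, vconjD) lam_conj Lr Tr. Qed.
Lemma Yzzb_conj z : U z -> vconj (Yzzb z) = Yzzb z.
Proof.
move=> Uz; rewrite /Yzzb !(vconjZ, vconjD) lam_conj Lr Tr Tbr Pr rhor//.
rewrite rmorphD rmorphM /= conjCK thzb_conj (mulrC (th z)^*).
by congr (_ *: (_ + _)); rewrite -!addrA; congr (_ + _); rewrite addrC.
Qed.

(* [N] is determined by its pairings with [Y], [Y_z] and itself inside the span of [L], [T], [Tb], [P]. *)
Definition Nc z := lam z *: ((2 * (th z * (th z)^*)) *: L z + (2 * (th z)^*) *: T z
  + (2 * th z) *: Tb z + (2 * rho z) *: P).

(** Shows at once that [N] lies in [V] and that it is real. *)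
Lemma Nc_Yzzb z : Nc z = 2 *: Yzzb z + (- (2 * thzb z)) *: Yc z.
Proof.
rewrite /Nc /Yzzb /Yc; move: (th z) (th z)^* (thzb z) (lam z) (rho z) => t tb c l r.
move: (L z) (T z) (Tb z) => v a b.
by apply/rowP => j; rewrite !mxE; ring.
Qed.

Lemma vconj_lin m (a b : C R) (u v : 'rV[C R]_m) :
  vconj (a *: u + b *: v) = a^* *: vconj u + b^* *: vconj v.
Proof. by rewrite vconjD !vconjZ. Qed.

Lemma Yc_conj z : vconj (Yc z) = Yc z.
Proof. by rewrite vconjZ Lr lam_conj. Qed.

Lemma Nc_conj z : U z -> vconj (Nc z) = Nc z.
Proof.
move=> Uz; rewrite Nc_Yzzb vconj_lin (Yzzb_conj Uz) Yc_conj.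
have c2 : (2 : C R)^* = 2 by rewrite rmorph_nat.
have ce (a : C R) : a^* = a -> (- (2 * a))^* = - (2 * a) by move=> ar; rewrite rmorphN rmorphM /= c2 ar.
by rewrite c2 (ce _ (thzb_conj z)).
Qed.

(** The Minkowski form in the frame [L], [T], [Tb], [P], whose only nonzero pairings are
    [<T, Tb> = rho] and [<L, P> = -1]. *)
Definition mink_cmb (K : comNzRingType) (r : K) (a b c d a' b' c' d' : K) : K :=
  r * (b * c' + c * b') - (a * d' + d * a').

Lemma mink_cmbE z a b c d a' b' c' d' : U z ->
  mink (a *: L z + b *: T z + c *: Tb z + d *: P) (a' *: L z + b' *: T z + c' *: Tb z + d' *: P)
  = mink_cmb (rho z) a b c d a' b' c' d'.
Proof.
move=> Uz; rewrite !(minkDl, minkDr, minkZl, minkZr).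
rewrite LL LT LTb LP TT// TTb TP TbTb// TbP PP.
rewrite (minkC (T z) (L z)) LT (minkC (Tb z) (L z)) LTb (minkC P (L z)) LP.
by rewrite (minkC (Tb z) (T z)) TTb (minkC P (T z)) TP (minkC P (Tb z)) TbP /mink_cmb; ring.
Qed.

Lemma mink_cmbP z u v a b c d a' b' c' d' : U z ->
  u = a *: L z + b *: T z + c *: Tb z + d *: P ->
  v = a' *: L z + b' *: T z + c' *: Tb z + d' *: P ->
  mink u v = mink_cmb (rho z) a b c d a' b' c' d'.
Proof. by move=> Uz -> ->; exact: mink_cmbE. Qed.

Lemma cmbE z (l a b c d : C R) : l *: (a *: L z + b *: T z + c *: Tb z + d *: P) =
  (l * a) *: L z + (l * b) *: T z + (l * c) *: Tb z + (l * d) *: P.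
Proof. by rewrite !scalerDr !scalerA. Qed.

Lemma Yc_cmb z : Yc z = lam z *: L z + 0 *: T z + 0 *: Tb z + 0 *: P.
Proof. by rewrite !scale0r !addr0. Qed.
Lemma Yz_cmb z : Yz z = (lam z * th z) *: L z + lam z *: T z + 0 *: Tb z + 0 *: P.
Proof. by rewrite /Yz scalerDr scalerA !scale0r !addr0. Qed.
Lemma Yzb_cmb z : Yzb z = (lam z * (th z)^*) *: L z + 0 *: T z + lam z *: Tb z + 0 *: P.
Proof. by rewrite /Yzb scalerDr scalerA !scale0r !addr0. Qed.

Lemma mink_Yz_Yzb z : U z -> mink (Yz z) (Yzb z) = 1 / 2.
Proof.
move=> Uz; rewrite (mink_cmbP Uz (Yz_cmb z) (Yzb_cmb z)) /mink_cmb.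
have l2 := lam2 Uz; have r0 := rho_neq Uz.
have -> : rho z * (lam z * lam z + 0 * 0) - (lam z * th z * 0 + 0 * (lam z * (th z)^*)) =
  rho z * (lam z * lam z) by ring.
by rewrite l2; field.
Qed.

Lemma mink_Nc z : U z ->
  [/\ mink (Nc z) (Nc z) = 0, mink (Nc z) (Yc z) = -1 & mink (Nc z) (Yz z) = 0].
Proof.
move=> Uz; have l2 := lam2 Uz; have r0 := rho_neq Uz.
have ll : 2 * rho z * (lam z * lam z) = 1 by rewrite l2; field.
have NE : Nc z = _ := cmbE _ _ _ _ _ _.
rewrite (mink_cmbP Uz NE NE) (mink_cmbP Uz NE (Yc_cmb z)) (mink_cmbP Uz NE (Yz_cmb z)) /mink_cmb.
move: (th z) (th z)^* (lam z) (rho z) ll => t tb l r ll.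
split; [by ring| |by ring].
by transitivity (- (2 * r * (l * l))); [ring|rewrite ll].
Qed.

Lemma k_perp z (a b c d e : C R) : U z ->
  mink (e *: k z) (a *: L z + b *: T z + c *: Tb z + d *: P) = 0.
Proof.
move=> Uz; have [h1 h2 h3 h4 _] := ktable Uz.
by rewrite minkZl !minkDr !minkZr h1 h2 h3 h4; ring.
Qed.

(** The pairing with [Y] gives [d], that with [Y_z] gives [c], its conjugate, available because [v]
    is real, gives [b], and nullity then gives [a]. *)
Lemma Nc_unique z (v : 'rV[C R]_(n + 1 + 1)) (a b c d : C R) : U z ->
  v = a *: L z + b *: T z + c *: Tb z + d *: P -> vconj v = v ->
  mink v v = 0 -> mink v (Yc z) = -1 -> mink v (Yz z) = 0 -> v = Nc z.
Proof.
move=> Uz vE vr vv vY vYz.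
have vYzb : mink v (Yzb z) = 0.
  rewrite -Yz_conj -vr; have := congr1 (fun q : C R => q^*) vYz; rewrite conjC0 => <-.
  rewrite !minkE rmorphB rmorphMn rmorphM /= conj_dot !mxE.
  by rewrite vr -[in X in dot X _]vr.
have l0 := lam_neq0 Uz; have r0 := rho_neq Uz; have l2 := lam2 Uz.
have ll : 2 * rho z * (lam z * lam z) = 1 by rewrite l2; field.
move: vv vY vYz vYzb; rewrite (mink_cmbP Uz vE vE) (mink_cmbP Uz vE (Yc_cmb z)).
rewrite (mink_cmbP Uz vE (Yz_cmb z)) (mink_cmbP Uz vE (Yzb_cmb z)) vE /Nc cmbE /mink_cmb.
move: (th z) (th z)^* (lam z) (rho z) (L z) (T z) (Tb z) l0 r0 ll => t tb l r VL VT VTb l0 r0 ll.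
move=> e1 e2 e3 e4.
have dE : d = l * (2 * r).
  apply: (mulfI l0).
  have -> : l * d = - (r * (b * 0 + c * 0) - (a * 0 + d * l)) by ring.
  rewrite e2 opprK; transitivity (2 * r * (l * l)); [by rewrite ll|ring].
have rl0 : r * l != 0 by rewrite mulf_neq0.
have cE : c = l * (2 * t).
  apply: (mulfI rl0); have : r * l * c = d * (l * t) + (r * (b * 0 + c * l) - (a * 0 + d * (l * t))) by ring.
  by move=> ->; rewrite e3 dE; ring.
have bE : b = l * (2 * tb).
  apply: (mulfI rl0); have : r * l * b = d * (l * tb) + (r * (b * l + c * 0) - (a * 0 + d * (l * tb))) by ring.
  by move=> ->; rewrite e4 dE; ring.
have d0 : 2 * d != 0 by rewrite dE !mulf_neq0// pnatr_eq0.
have aE : a = l * (2 * (t * tb)).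
  apply: (mulfI d0); have : 2 * d * a = 2 * r * (b * c) - (r * (b * c + c * b) - (a * d + d * a)) by ring.
  by move=> ->; rewrite e1 bE cE dE; ring.
by rewrite -aE -bE -cE -dE.
Qed.

(** The [P] terms of [Z_zbar] and [phi T_zbar] cancel. What survives is a multiple of [T], hence
    tangent to [V], so that [D_zbar kappa] only sees the derivative of the factor [lam]. *)
Lemma isDv_k z : U z -> isDv k z (Dz k z) (- phib z *: T z).
Proof.
move=> Uz; have h1 := isDvZ (dphi Uz) (dT Uz).
have h2 := isDvD (dZ Uz) (isDvZ (isD_cst (-1) z) h1).
have h3 : isDv k z (Dz Z z + (0 *: (phi z *: T z) + -1 *: (dz phi z *: T z + phi z *: Z z)))
   (- phib z *: T z).
  move: h2; have -> : (phi z * rho z) *: P + (0 *: (phi z *: T z) +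
     -1 *: (phib z *: T z + phi z *: (rho z *: P))) = - phib z *: T z.
    by move: (T z) => v; apply/rowP => j; rewrite !mxE; ring.
  by apply: isDv_ext; near=> w; rewrite /frm_k scaleN1r.
by rewrite (isDv_Dz h3).
Unshelve. all: by end_near. Qed.

Lemma isDv_kap z : U z ->
  isDv kap z (Dz kap z) ((th z)^* *: kap z + (- (lam z * phib z)) *: T z).
Proof.
move=> Uz; have h := isDvZ (isD_lam Uz) (isDv_k Uz).
have E := isDv_Dz h; rewrite -/kap in E; rewrite E.
have -> // : (th z)^* *: kap z + (- (lam z * phib z)) *: T z =
  (- ((phi z)^* / 2) * lam z) *: k z + lam z *: (- phib z *: T z).
by rewrite th_conj /kap !scalerA mulrN.
Qed.

(** The first and second normal derivatives of [kappa]: by [isDv_kap] and [isDv_kap1] the full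
    derivatives differ from them by multiples of [T]. *)
Definition kap1 z := (th z)^* *: kap z.
Definition kap2 z := ((thz z)^* + (th z)^* * (th z)^*) *: kap z.

Lemma isDv_kap1 z : U z ->
  isDv kap1 z (Dz kap1 z) (kap2 z + (- ((th z)^* * (lam z * phib z))) *: T z).
Proof.
move=> Uz; have h := isDvZ (isD_conj (isD_th Uz)) (isDv_kap Uz).
have E := isDv_Dz h; rewrite -/kap1 in E; rewrite E; move: h.
have -> // : (thz z)^* *: kap z + (th z)^* *: ((th z)^* *: kap z + (- (lam z * phib z)) *: T z) =
  kap2 z + (- ((th z)^* * (lam z * phib z))) *: T z.
rewrite /kap2; move: (kap z) (T z) (thz z)^* (th z)^* => u v a b.
by apply/rowP => j; rewrite !mxE; ring.
Qed.

(** The Willmore equation is the conjugate of [th_z + th ^ 2 = - s / 2], the relation read off from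
    the [Y] component of [Y_zz]. *)
Lemma kap2_eq z : kap2 z + ((sch z)^* / 2) *: kap z = 0.
Proof.
have -> : (sch z)^* / 2 = - ((thz z)^* + (th z)^* * (th z)^*).
  rewrite -conj_half -rmorphM -rmorphD -rmorphN /=; congr (_^*).
  by rewrite /sch /th /thz; move: (dz phi z) => a; field.
by rewrite /kap2 -scalerDl subrr scale0r.
Qed.

Section Lifted.
Variable Yr : C R -> 'rV[R]_(n + 1 + 1).
Hypothesis YrE : forall z, U z -> cvec (Yr z) = Yc z.

Lemma isDv_Yr z : U z -> isDv (fun w => cvec (Yr w)) z (Yz z) (Yzb z).
Proof.
move=> Uz; apply: isDv_ext (isDv_Yc Uz).
by apply: filterS (open_near oU Uz) => w Uw; rewrite YrE.
Qed.

Lemma Dz_Yr z : U z -> Dz (fun w => cvec (Yr w)) z = Yz z.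
Proof. by move=> Uz; exact: isDv_Dz (isDv_Yr Uz). Qed.
Lemma Dzb_Yr z : U z -> Dzb (fun w => cvec (Yr w)) z = Yzb z.
Proof. by move=> Uz; exact: isDv_Dzb (isDv_Yr Uz). Qed.

Lemma isDv_Dz_Yr z : U z -> isDv (Dz (fun w => cvec (Yr w))) z
  (- (sch z / 2) *: Yc z + kap z) (Yzzb z).
Proof.
move=> Uz; apply: isDv_ext (isDv_Yz Uz).
by apply: filterS (open_near oU Uz) => w Uw; rewrite Dz_Yr.
Qed.

Lemma DzDz_Yr z : U z ->
  Dz (Dz (fun w => cvec (Yr w))) z = - (sch z / 2) *: Yc z + kap z.
Proof. by move=> Uz; exact: isDv_Dz (isDv_Dz_Yr Uz). Qed.
Lemma DzbDz_Yr z : U z -> Dzb (Dz (fun w => cvec (Yr w))) z = Yzzb z.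
Proof. by move=> Uz; exact: isDv_Dzb (isDv_Dz_Yr Uz). Qed.

Lemma Yc_in_VC z : U z -> in_VC Yr z (Yc z).
Proof.
move=> Uz; have := in_VC_Y (Dz_Yr Uz) (DzbDz_Yr Uz) (Yzzb_conj Uz).
by rewrite YrE.
Qed.

Lemma T_in_VC z a : U z -> in_VC Yr z (a *: T z).
Proof.
move=> Uz; apply: in_VC_scale; have l0 := lam_neq0 Uz.
have h := in_VC_Y1 (Dz_Yr Uz) (DzbDz_Yr Uz) (Yzzb_conj Uz).
have := in_VC_add (in_VC_scale (lam z)^-1 h) (in_VC_scale (- (th z / lam z)) (Yc_in_VC Uz)).
have -> // : (lam z)^-1 *: Yz z + - (th z / lam z) *: Yc z = T z.
rewrite /Yz /Yc; move: (lam z) l0 (T z) (L z) => l l0 u v.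
by apply/rowP => j; rewrite !mxE; field.
Qed.

Lemma VC_cmb z u : U z -> in_VC Yr z u -> exists a b c d,
  u = a *: L z + b *: T z + c *: Tb z + d *: P.
Proof.
move=> Uz /(in_VCP (Dz_Yr Uz) (DzbDz_Yr Uz) (Yzzb_conj Uz))[a [b [c [d ->]]]].
rewrite YrE// Yz_conj /Yc /Yz /Yzb /Yzzb.
move: (lam z) (th z) (th z)^* (thzb z) (rho z) (L z) (T z) (Tb z) => l t tb s r v1 v2 v3.
exists (a * l + b * l * t + c * l * tb + d * l * (t * tb + s)), (b * l + d * l * tb),
  (c * l + d * l * t), (d * l * r).
by apply/rowP => j; rewrite !mxE; ring.
Qed.

Lemma kap_perp z e : U z -> in_VperpC Yr z (e *: kap z).
Proof.
move=> Uz v /(in_V_cvec Yr z v)/(VC_cmb Uz)[a [b [c [d ->]]]].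
by rewrite /kap scalerA k_perp.
Qed.

Lemma normal_dzb_kap : normal_dzb U Yr kap kap1.
Proof.
move=> z Uz; split; first exact: kap_perp.
rewrite (isDv_Dzb (isDv_kap Uz)) /kap1 addrC addKr.
exact: T_in_VC.
Qed.

Lemma normal_dzb_kap1 : normal_dzb U Yr kap1 kap2.
Proof.
move=> z Uz; split; first exact: kap_perp.
rewrite (isDv_Dzb (isDv_kap1 Uz)) addrC addKr.
exact: T_in_VC.
Qed.

Lemma mink_cvec m (u v : 'rV[R]_(m + 1)) : mink (cvec u) (cvec v) = toC (mink u v).
Proof.
rewrite !minkE rmorphB rmorphMn rmorphM /= !mxE; congr (_ - _).
by rewrite /dot rmorph_sum; apply: eq_bigr => i _; rewrite !mxE rmorphM.
Qed.

Lemma toC_inj (a b : R) : toC a = toC b -> a = b.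
Proof. by move=> /(congr1 (@re R)). Qed.

Definition Nr z : 'rV[R]_(n + 1 + 1) := map_mx (@re R) (Nc z).

Lemma NrE z : U z -> cvec (Nr z) = Nc z.
Proof. by move=> Uz; apply: cvecK; exact: Nc_conj. Qed.

Lemma frame_N_Nr z : U z -> [/\ in_V Yr z (Nr z), mink (Nr z) (Nr z) = 0,
  mink (Nr z) (Yr z) = -1 & mink (cvec (Nr z)) (Dz (fun w => cvec (Yr w)) z) = 0].
Proof.
move=> Uz; have [h1 h2 h3] := mink_Nc Uz; split.
- apply/in_V_cvec; rewrite NrE// Nc_Yzzb; apply: in_VC_add; apply: in_VC_scale.
    exact: (in_VC_Y2 (Dz_Yr Uz) (DzbDz_Yr Uz) (Yzzb_conj Uz)).
  exact: Yc_in_VC.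
- by apply: toC_inj; rewrite -mink_cvec (NrE Uz) h1.
- by apply: toC_inj; rewrite -mink_cvec (NrE Uz) (YrE Uz) h2 rmorphN1.
- by rewrite (NrE Uz) (Dz_Yr Uz) h3.
Qed.

Lemma frame_kappa_kap z : U z -> in_VperpC Yr z (kap z) /\
  Dz (Dz (fun w => cvec (Yr w))) z = - (sch z / 2) *: cvec (Yr z) + kap z.
Proof.
move=> Uz; split; last by rewrite (DzDz_Yr Uz) (YrE Uz).
by have := kap_perp 1 Uz; rewrite scale1r.
Qed.

Lemma mink_lin2 m (a : C R) (u v w : 'rV[C R]_(m + 1)) :
  mink (a *: u + v) w = a * mink u w + mink v w.
Proof. by rewrite minkDl minkZl. Qed.

(** Pairing [Y_zz] with [N] kills any admissible [kappa], since [N] lies in [V], and isolates [s]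
    because [<Y, N> = -1]. *)
Lemma frame_unique z (v : 'rV[R]_(n + 1 + 1)) (s : C R) (k1 : 'rV[C R]_(n + 1 + 1)) : U z ->
  [/\ in_V Yr z v, mink v v = 0, mink v (Yr z) = -1 &
    mink (cvec v) (Dz (fun w => cvec (Yr w)) z) = 0] ->
  in_VperpC Yr z k1 /\ Dz (Dz (fun w => cvec (Yr w))) z = - (s / 2) *: cvec (Yr z) + k1 ->
  cvec v = Nc z /\ s = sch z.
Proof.
move=> Uz [Vv vv vY vYz] [kperp E].
have vE : cvec v = Nc z.
  have /(VC_cmb Uz)[a [b [c [d cE]]]] := (in_V_cvec Yr z v).1 Vv.
  apply: (Nc_unique Uz cE (vconj_cvec v)).
  - by rewrite mink_cvec vv.
  - by rewrite -YrE// mink_cvec vY rmorphN1.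
  - by rewrite -(Dz_Yr Uz).
split=> //.
have [_ NY _] := mink_Nc Uz.
have k0 : mink (kap z) (Nc z) = 0 by rewrite -vE; have := kap_perp 1 Uz Vv; rewrite scale1r.
have k10 : mink k1 (Nc z) = 0 by rewrite -vE; exact: kperp.
have := congr1 (fun u => mink u (Nc z)) E; rewrite (DzDz_Yr Uz) (YrE Uz).
rewrite !mink_lin2 k0 k10 (minkC (Yc z)) NY !addr0 => h.
apply/eqP; rewrite -subr_eq0; apply/eqP.
have -> : s - sch z = 2 * (- (sch z / 2) * -1 - - (s / 2) * -1) * -1 by move: (sch z) => q; field.
by rewrite h; ring.
Qed.

(** Since [phi = - 2 th], passing from [Y], [Y_z], [Y_zbar], [N] to [L], [T], [Tb], [P] completes a
    square: [mu] enters only through [mu - phi]. *)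
Lemma adjoint_liftE z (N : C R -> 'rV[R]_(n + 1 + 1)) (mu : C R -> C R) : U z ->
  cvec (N z) = Nc z ->
  adjoint_lift Yr N mu z = lam z *: (((mu z - phi z) * (mu z - phi z)^* / 2) *: L z +
    (mu z - phi z)^* *: T z + (mu z - phi z) *: Tb z + (2 * rho z) *: P).
Proof.
move=> Uz NE; rewrite /adjoint_lift NE Dz_Yr// Dzb_Yr// YrE// normCK.
have -> : phi z = - (2 * th z) by rewrite /th; field.
rewrite !opprK /Yc /Yz /Yzb /Nc rmorphD rmorphM rmorph_nat /=.
move: (lam z) (th z) (th z)^* (mu z) (mu z)^* (rho z) (L z) (T z) (Tb z) => l t tb m mb r v1 v2 v3.
by apply/rowP => j; rewrite !mxE; field.
Qed.

Lemma eta_null z (e : C R) : U z -> mink (kap1 z + e *: kap z) (kap1 z + e *: kap z) = 0.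
Proof.
move=> Uz; have [_ _ _ _ kk] := ktable Uz.
by rewrite /kap1 -scalerDl /kap !scalerA minkZl minkZr kk !mulr0.
Qed.

End Lifted.

(** Quantified over [Yr] because a canonical lift is determined on [U] only. The first half yields
    existence of a frame, the last clause evaluates the adjoint lift of any other frame. *)
Lemma frame_package :
  (forall z, U z -> 0 < lamR z /\ lam z * lam z = (2 * rho z)^-1) /\
  exists N kappa kappa1 kappa2, forall Yr, (forall z, U z -> cvec (Yr z) = lam z *: L z) ->
  [/\ smoothV U (fun z => cvec (Yr z)),
      forall z, U z -> mink (Dz (fun w => cvec (Yr w)) z) (Dzb (fun w => cvec (Yr w)) z) = 1 / 2,
      forall z, U z -> [/\ in_V Yr z (N z), mink (N z) (N z) = 0, mink (N z) (Yr z) = -1 &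
        mink (cvec (N z)) (Dz (fun w => cvec (Yr w)) z) = 0],
      forall z, U z -> in_VperpC Yr z (kappa z) /\
        Dz (Dz (fun w => cvec (Yr w))) z = - (sch z / 2) *: cvec (Yr z) + kappa z &
      normal_dzb U Yr kappa kappa1 /\ normal_dzb U Yr kappa1 kappa2] /\
  [/\ forall z, kappa2 z + ((sch z)^* / 2) *: kappa z = 0,
      forall z e, U z -> mink (kappa1 z + e *: kappa z) (kappa1 z + e *: kappa z) = 0 &
      forall N' s k1 mu z, U z ->
        [/\ in_V Yr z (N' z), mink (N' z) (N' z) = 0, mink (N' z) (Yr z) = -1 &
          mink (cvec (N' z)) (Dz (fun w => cvec (Yr w)) z) = 0] ->
        in_VperpC Yr z k1 /\ Dz (Dz (fun w => cvec (Yr w))) z = - (s / 2) *: cvec (Yr z) + k1 ->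
        s = sch z /\ adjoint_lift Yr N' mu z =
          lam z *: (((mu z - phi z) * (mu z - phi z)^* / 2) *: L z +
          (mu z - phi z)^* *: T z + (mu z - phi z) *: Tb z + (2 * rho z) *: P)].
Proof.
split; first by move=> z Uz; split; [exact: lamR_gt0|exact: lam2].
exists Nr, kap, kap1, kap2 => Yr YrE; split.
- split.
  + exact: (smoothV_ext oU (fun z Uz => esym (YrE z Uz)) smooth_Yc).
  + by move=> z Uz; rewrite (Dz_Yr YrE Uz) (Dzb_Yr YrE Uz); exact: mink_Yz_Yzb.
  + by move=> z Uz; exact: frame_N_Nr.
  + by move=> z Uz; exact: frame_kappa_kap.
  + by split; [exact: normal_dzb_kap|exact: normal_dzb_kap1].
- split; [exact: kap2_eq|by move=> z e; exact: eta_null|].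
  move=> N' s k1 mu z Uz h1 h2; have [e1 e2] := frame_unique YrE Uz h1 h2.
  by split; [exact: e2|exact: adjoint_liftE].
Qed.

End AbstractFrame.

(** * Stereographic projection in the light cone *)

Section StereographicLift.
Variables (R : realType).

(** The real counterpart of [clift]: the multiple of [light (inv_stereo (Some v))] whose pairing
    with the point at infinity is [-1]. *)
Definition xt n (v : 'rV[R]_n) : 'rV[R]_(n + 1 + 1) :=
  mk3 v ((dot v v + -1) / 2) ((dot v v + 1) / 2).

Lemma dot_ge0 n (v : 'rV[R]_n) : 0 <= dot v v.
Proof. by apply: sumr_ge0 => i _; rewrite -expr2 sqr_ge0. Qed.

Lemma dot1_neq0 n (v : 'rV[R]_n) : dot v v + 1 != 0.
Proof. by have h := dot_ge0 v; rewrite gt_eqF//; lra. Qed.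

Lemma light_stereo n (v : 'rV[R]_n) :
  light (inv_stereo (Some v)) = (2 / (dot v v + 1)) *: xt v.
Proof.
have d := dot1_neq0 v; rewrite /light /xt mk3Z /mk3 /inv_stereo.
by congr (row_mx (row_mx _ _%:M) _%:M); field.
Qed.

Lemma light_stereo_oo n : light (inv_stereo (None : option 'rV[R]_n)) = mk3 0 1 1.
Proof. by []. Qed.

Lemma cvec_row_mx m1 m2 (u : 'rV[R]_m1) (v : 'rV[R]_m2) :
  cvec (row_mx u v) = row_mx (cvec u) (cvec v).
Proof. exact: map_row_mx. Qed.

Lemma cvec_mk3 n (u : 'rV[R]_n) a b : cvec (mk3 u a b) = mk3 (cvec u) (toC a) (toC b).
Proof. by rewrite /mk3 !cvec_row_mx /cvec !map_scalar_mx. Qed.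

Lemma cvecZ m (a : R) (u : 'rV[R]_m) : cvec (a *: u) = toC a *: cvec u.
Proof. exact: map_mxZ. Qed.

Lemma dot_cvec m (u v : 'rV[R]_m) : dot (cvec u) (cvec v) = toC (dot u v).
Proof. by rewrite /dot rmorph_sum; apply: eq_bigr => i _; rewrite !mxE rmorphM. Qed.

Lemma cvec_xt n (v : 'rV[R]_n) : cvec (xt v) =
  mk3 (cvec v) ((dot (cvec v) (cvec v) + -1) / 2) ((dot (cvec v) (cvec v) + 1) / 2).
Proof.
by rewrite cvec_mk3 !dot_cvec !rmorphM !rmorphD !fmorphV rmorph_nat rmorphN1 rmorph1.
Qed.

Lemma light_null m (v : 'rV[R]_(m + 1)) : mink (light v) (light v) = dot v v - 1.
Proof.
rewrite /mink /light row_mxKl row_mxEr mxE eqxx mulr1n mulr1.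
by [].
Qed.

Lemma xt_null n (v : 'rV[R]_n) : mink (xt v) (xt v) = 0.
Proof. by rewrite mink_mk3; field. Qed.

Lemma inv_stereo_sphere n (v : option 'rV[R]_n) : in_sphere (inv_stereo v).
Proof.
rewrite /in_sphere; apply/eqP; rewrite -subr_eq0 -light_null; apply/eqP.
case: v => [v|]; first by rewrite light_stereo minkZl minkZr xt_null !mulr0.
by rewrite light_stereo_oo mink_mk3 dot0l; ring.
Qed.

Lemma cvec_light m (v : 'rV[R]_(m + 1)) : cvec (light v) = row_mx (cvec v) 1%:M.
Proof. by rewrite /light cvec_row_mx /cvec map_scalar_mx /= toC1. Qed.

(** Dividing by the last coordinate recovers the point of the sphere, so one smooth nonvanishing
    representative suffices; nothing is asked of the factor [t] itself. *)
Lemma smoothV_of_light m (V : set (C R)) (W : C R -> 'rV[C R]_(m + 1 + 1))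
    (y : C R -> 'rV[R]_(m + 1)) : open V -> smoothV V W ->
  (forall z, V z -> exists2 t : C R, t != 0 & W z = t *: cvec (light (y z))) ->
  smoothV V (fun z => cvec (y z)).
Proof.
move=> oV sW H j.
pose last z := W z 0 (rshift (m + 1) ord0).
have lastE z t : W z = t *: cvec (light (y z)) -> last z = t.
  by rewrite /last => ->; rewrite cvec_light mxE row_mxEr mxE eqxx mulr1.
have last0 z : V z -> last z != 0.
  by move=> /H[t t0 /lastE ->].
apply: (smoothC_ext oV _ (smoothCM oV (sW (lshift 1 j)) (smoothCV oV last0 (sW _)))) => z Vz.
have [t t0 E] := H z Vz.
by rewrite -/(last z) (lastE _ _ E) E cvec_light mxE row_mxEl mulrAC mulfV// mul1r.
Qed.

End StereographicLift.

(** * The frame of a super-conformal minimal surface in a chart *)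

Section ChartFrame.
Variables (R : realType) (M : riemannSurface R) (n : nat) (x : M -> 'rV[R]_n).
Hypothesis hx : superconformal_minimal x.
Variables (c : chart R M) (hc : atlas c).
Local Notation U := (chart_img c).
Definition xi (z : C R) : 'rV[R]_n := x (chart_inv c z).
Local Notation L := (clift xi).
Local Notation T := (clift_z xi).
Local Notation Tb := (clift_zb xi).
Local Notation P := (cone_pt R n).
Local Notation rho := (metric xi).
Local Notation ph := (phi xi).
Let y (p : M) := inv_stereo (Some (x p)).

Lemma chart_open : open U.
Proof. by case: (atlas_chart hc). Qed.

Let oU := chart_open.
Let sX : smoothV U (fun z => cvec (xi z)).
Proof. by case: hx => -[[+ _] _] _; apply. Qed.
Let conf : forall z, U z -> dot (Dz (fun z => cvec (xi z)) z) (Dz (fun z => cvec (xi z)) z) = 0 /\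
  0 < dot (Dz (fun z => cvec (xi z)) z) (Dzb (fun z => cvec (xi z)) z).
Proof. by case: hx => -[[_ +] _] _; apply. Qed.
Let minimal : forall z, U z -> Dzb (Dz (fun z => cvec (xi z))) z = 0.
Proof. by case: hx => -[_ +] _; apply. Qed.
Let superconf : forall z, U z ->
  dot (Dz (Dz (fun z => cvec (xi z))) z) (Dz (Dz (fun z => cvec (xi z))) z) = 0.
Proof. by case: hx => _; apply. Qed.

Lemma liftE z : L z = cvec (xt (xi z)).
Proof. by rewrite cvec_xt. Qed.

Let smooth_lift : smoothV U L.
Proof.
have sq := smoothC_dot oU sX sX.
apply: (smoothV_row_mx (smoothV_row_mx sX _)); apply: (smoothV_scalar oU);
  by apply: (smoothCM oU); [apply: (smoothCD oU sq); exact: smoothC_cst|exact: smoothC_cst].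
Qed.

Let phi_rho z : U z -> ph z * rho z = metric_z xi z.
Proof. by move=> Uz; rewrite /phi mulfVK// (rho_neq0 sX conf). Qed.

Let vconj_mk3 m (u : 'rV[C R]_m) (a b : C R) : vconj (mk3 u a b) = mk3 (vconj u) a^* b^*.
Proof.
apply/rowP => j; rewrite /mk3 !mxE.
case: fintype.split => j'; rewrite !mxE; last by rewrite rmorphMn.
by case: fintype.split => j''; rewrite !mxE// rmorphMn.
Qed.

Let P_real : vconj P = P.
Proof.
rewrite /cone_pt vconj_mk3 conjC1; congr mk3.
by apply/rowP => j; rewrite !mxE conjC0.
Qed.

Lemma chart_pairings :
  [/\ forall z, mink (L z) (L z) = 0, forall z, mink (L z) (T z) = 0,
      forall z, mink (L z) (Tb z) = 0 & forall z, mink (L z) P = -1] /\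
  [/\ forall z, U z -> mink (T z) (T z) = 0, forall z, U z -> mink (Tb z) (Tb z) = 0 &
      forall z, mink (T z) (Tb z) = rho z] /\
  [/\ forall z, mink (T z) P = 0, forall z, mink (Tb z) P = 0 & mink P P = 0].
Proof.
split; [|split].
- split; [exact: mink_lift_lift|exact: mink_lift_T|exact: mink_lift_Tb|exact: mink_lift_pt].
- split.
  + by move=> z Uz; apply: (mink_T_T conf).
  + by move=> z Uz; apply: (mink_Tb_Tb conf).
  + exact: mink_T_Tb.
- by split; [exact: mink_T_pt|exact: mink_Tb_pt|exact: mink_pt_pt].
Qed.

Lemma chart_L_real z : vconj (L z) = L z.
Proof. by rewrite liftE vconj_cvec. Qed.

Lemma chart_rho_gt0 z : U z -> 0 < rho z.
Proof. by move=> Uz; exact: (rho_gt0 sX conf Uz). Qed.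

Lemma chart_isDv_L z : U z -> isDv L z (T z) (Tb z).
Proof. by move=> Uz; exact: (isDv_lift sX Uz). Qed.

Lemma chart_isDv_T z : U z -> isDv T z (clift_zz xi z) (rho z *: P).
Proof. by move=> Uz; exact: (isDv_lift_z oU sX conf minimal Uz). Qed.

Lemma chart_isD_rho z : U z -> isD rho z (ph z * rho z) (ph z * rho z)^*.
Proof. by move=> Uz; rewrite phi_rho//; exact: (isD_rho oU sX minimal Uz). Qed.

Lemma chart_smooth_rho : smoothC U rho.
Proof. exact: (smooth_rho oU sX). Qed.

Lemma chart_smooth_phi : smoothC U ph.
Proof. exact: (smooth_phi oU sX conf). Qed.

Let isDv_Z z : U z -> isDv (clift_zz xi) z (Dz (clift_zz xi) z) ((ph z * rho z) *: P).
Proof. by move=> Uz; rewrite phi_rho//; exact: (isDv_lift_zz oU sX minimal Uz). Qed.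

Let packed :=
  let '(conj (And4 LL LT LTb LP) (conj (And3 TT TbTb TTb) (And3 TP TbP PP))) := chart_pairings in
  @frame_package R n U L T Tb (clift_zz xi) P rho ph (phi_zb xi) oU smooth_lift
    chart_smooth_rho chart_isDv_L chart_isDv_T isDv_Z chart_isD_rho
    (fun z Uz => isD_phi oU sX conf minimal Uz) (phi_zb_conj xi) chart_rho_gt0 chart_L_real P_real
    (fun z => erefl) LL LT LTb LP TT TbTb TTb TP TbP PP
    (fun z Uz => nrm_table oU sX conf minimal superconf Uz).

Definition conf_factor z : C R := 2 * (dot (cvec (xi z)) (cvec (xi z)) + 1)^-1.

Let factorE z : conf_factor z = toC (2 / (dot (xi z) (xi z) + 1)).
Proof. by rewrite rmorphM fmorphV rmorph_nat /= toCD toC1 -dot_cvec. Qed.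

Let factor_gt0 z : 0 < 2 / (dot (xi z) (xi z) + 1).
Proof. by have h := dot_ge0 (xi z); rewrite divr_gt0//; lra. Qed.

Lemma cvec_light_y z : cvec (light (y (chart_inv c z))) = conf_factor z *: L z.
Proof. by rewrite /y light_stereo cvecZ liftE factorE. Qed.

Let smooth_factor : smoothC U conf_factor.
Proof.
apply: (smoothCZ oU); apply: (smoothCV oU).
  move=> z _; rewrite dot_cvec -[1]toC1 -rmorphD /=.
  by apply/eqP => /(congr1 (@re R)) /= /eqP; rewrite (negbTE (dot1_neq0 _)).
by apply: (smoothCD oU (smoothC_dot oU sX sX)); exact: smoothC_cst.
Qed.

Let isDv_fL z : U z -> isDv (fun w => conf_factor w *: L w) z
  (dz conf_factor z *: L z + conf_factor z *: T z)
  (dzb conf_factor z *: L z + conf_factor z *: Tb z).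
Proof. by move=> Uz; exact: (isDvZ (smoothC_isD smooth_factor Uz) (chart_isDv_L Uz)). Qed.

Lemma smooth_y : smoothV U (loc c y).
Proof.
apply: (smoothV_of_light (W := fun z => conf_factor z *: L z) oU).
  exact: (smoothVZ oU smooth_factor smooth_lift).
move=> z Uz; exists 1; first exact: oner_neq0.
by rewrite scale1r -cvec_light_y.
Qed.

Let isDv_light_y z : U z ->
  Dz (fun w => cvec (light (y (chart_inv c w)))) z = row_mx (Dz (loc c y) z) 0 /\
  Dzb (fun w => cvec (light (y (chart_inv c w)))) z = row_mx (Dzb (loc c y) z) 0.
Proof.
move=> Uz.
have h : isDv (fun w => cvec (light (y (chart_inv c w)))) z
    (row_mx (Dz (loc c y) z) 0) (row_mx (Dzb (loc c y) z) 0).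
  have := isDv_row_mx (smoothV_isDv smooth_y Uz) (isDv_cst 1%:M z).
  by apply: isDv_ext; near=> w; rewrite cvec_light.
by rewrite (isDv_Dz h) (isDv_Dzb h).
Unshelve. all: by end_near. Qed.

Let mink_row0 m (u v : 'rV[C R]_m) : mink (row_mx u 0) (row_mx v 0) = dot u v.
Proof. by rewrite /mink !row_mxKl !row_mxEr !mxE mul0r subr0. Qed.

(** When a lift is rescaled, the derivatives of the factor multiply [l], which is null and
    orthogonal to [t] and [s]; they drop out and the metric is multiplied by the square of the
    factor. *)
Lemma mink_scaled_lift m (a b e g r : C R) (l t s : 'rV[C R]_(m + 1)) : mink l l = 0 ->
  mink l t = 0 -> mink l s = 0 -> mink t t = 0 -> mink t s = r ->
  mink (a *: l + e *: t) (a *: l + e *: t) = 0 /\ mink (a *: l + e *: t) (b *: l + g *: s) = e * g * r.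
Proof.
move=> ll lt ls tt ts; rewrite !(minkDl, minkDr, minkZl, minkZr) ll lt ls tt ts (minkC t l) lt.
by split; ring.
Qed.

Lemma conformal_y z : U z -> dot (Dz (loc c y) z) (Dz (loc c y) z) = 0 /\
  0 < dot (Dz (loc c y) z) (Dzb (loc c y) z).
Proof.
move=> Uz; have [[LL LT LTb LP] [[TT TbTb TTb] [TP TbP PP]]] := chart_pairings.
have [e1 e2] := isDv_light_y Uz.
have E : (fun w => cvec (light (y (chart_inv c w)))) = (fun w => conf_factor w *: L w).
  by apply/funext => w; exact: cvec_light_y.
have d := isDv_fL Uz; rewrite E (isDv_Dz d) in e1; rewrite E (isDv_Dzb d) in e2.
rewrite -!mink_row0 -e1 -e2.
have [-> ->] := mink_scaled_lift (dz conf_factor z) (dzb conf_factor z) (conf_factor z)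
  (conf_factor z) (LL z) (LT z) (LTb z) (TT z Uz) (TTb z).
split=> //; rewrite mulr_gt0 ?chart_rho_gt0// factorE -rmorphM -toC0 lt_toC.
by rewrite mulr_gt0// factor_gt0.
Qed.

Definition Y0 z : 'rV[R]_(n + 1 + 1) := lamR rho z *: xt (xi z).

Lemma Y0E z : U z -> cvec (Y0 z) = lam rho z *: L z.
Proof. by move=> _; rewrite /Y0 cvecZ -liftE. Qed.

Lemma canonical_lift_Y0 : canonical_lift c y Y0.
Proof.
have [lpos [N [k [k1 [k2 H]]]]] := packed.
have [[sY mY _ _ _] _] := H _ Y0E.
split; first exact: sY.
move=> z Uz; split; last exact: mY.
have [l0 _] := lpos z Uz.
exists (lamR rho z * ((dot (xi z) (xi z) + 1) / 2)).
  by have h := dot_ge0 (xi z); rewrite mulr_gt0// divr_gt0//; lra.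
rewrite /y light_stereo scalerA /Y0; congr (_ *: _).
by have d := dot1_neq0 (xi z); field; rewrite d.
Qed.

(** A lift is [g L] with [g = - <Y, P>], which is smooth and positive. The normalisation reads
    [g ^ 2 * rho = 1 / 2], so positivity forces [g = lam]. *)
Lemma canonical_unique Y : canonical_lift c y Y -> forall z, U z -> cvec (Y z) = lam rho z *: L z.
Proof.
move=> [sY HY]; have [[LL LT LTb LP] [[TT TbTb TTb] [TP TbP PP]]] := chart_pairings.
(* Negating the time coordinate of [P] turns the Minkowski pairing into a dot product, whose
   smoothness is known. *)
pose P' : 'rV[C R]_(n + 1 + 1) := mk3 0 1 (-1).
have PP' u : mink u P = dot u P'.
  have [v [a [b ->]]] := mk3P u.
  rewrite mink_mk3 /P' /mk3 !dot_row_mx !dot_scalar; ring.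
pose g z := -1 * dot (cvec (Y z)) P'.
have sg : smoothC U g.
  by apply: (smoothCZ oU); apply: (smoothC_dot oU sY); exact: smoothV_cst.
have gP z : U z -> exists2 a : R, 0 < a & g z = toC a /\ cvec (Y z) = toC a *: L z.
  move=> Uz; have [[l l0 E] _] := HY z Uz.
  exists (l * (2 / (dot (xi z) (xi z) + 1))); first by rewrite mulr_gt0// factor_gt0.
  have E' : cvec (Y z) = toC (l * (2 / (dot (xi z) (xi z) + 1))) *: L z.
    by rewrite E light_stereo scalerA cvecZ liftE.
  by split=> //; rewrite /g -PP' E' minkZl LP; ring.
have gLE w : U w -> g w *: L w = cvec (Y w) by move=> /gP[b _ [gb Yb]]; rewrite Yb gb.
move=> z Uz; have [a a0 [ga Ya]] := gP z Uz.
have d : isDv (fun w => cvec (Y w)) z (dz g z *: L z + g z *: T z) (dzb g z *: L z + g z *: Tb z).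
  apply: isDv_ext (isDvZ (smoothC_isD sg Uz) (chart_isDv_L Uz)).
  by apply: filterS (open_near oU Uz) => w; exact: gLE.
have [_] := HY z Uz; rewrite (isDv_Dz d) (isDv_Dzb d).
have [_ ->] := mink_scaled_lift (dz g z) (dzb g z) (g z) (g z) (LL z) (LT z) (LTb z) (TT z Uz) (TTb z).
have [lpos _] := packed; have [l0 l2] := lpos z Uz.
have r0 : rho z != 0 by have := chart_rho_gt0 Uz; rewrite lt0r => /andP[].
move=> gg; rewrite Ya; congr (_ *: _).
have : toC a * toC a = lam rho z * lam rho z.
  rewrite -ga l2; apply: (mulIf r0); rewrite gg; by field.
rewrite /lam -!rmorphM => /(congr1 (@re R)) /= aa.
by congr toC; apply/eqP; rewrite -(@eqrXn2 _ 2) ?ltW// !expr2 aa.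
Qed.

Lemma chart_frame_exists : exists Y N s kappa kappa1 kappa2,
  [/\ frame c y Y N s kappa kappa1, normal_dzb U Y kappa1 kappa2,
      forall z, U z -> kappa2 z + ((s z)^* / 2) *: kappa z = 0 &
      forall z e, U z -> mink (kappa1 z + e *: kappa z) (kappa1 z + e *: kappa z) = 0].
Proof.
have [_ [N [k [k1 [k2 H]]]]] := packed.
have [[_ _ fN fk [fk1 fk2]] [w1 w2 _]] := H _ Y0E.
exists Y0, N, (sch ph), k, k1, k2; split.
- split; [exact: canonical_lift_Y0|exact: fN|exact: fk|exact: fk1].
- exact: fk2.
- by move=> z _; exact: w1.
- exact: w2.
Qed.

(** An adjoint transform may come with any frame in a chart; this makes its lift and its Riccati
    equation explicit whatever the frame. *)
Lemma chart_frame_formula Y N s kappa kappa' : frame c y Y N s kappa kappa' ->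
  forall mu z, U z -> s z = sch ph z /\
    adjoint_lift Y N mu z = lam rho z *: (((mu z - ph z) * (mu z - ph z)^* / 2) *: L z +
      (mu z - ph z)^* *: T z + (mu z - ph z) *: Tb z + (2 * rho z) *: P).
Proof.
move=> [fl fN fk _] mu z Uz.
have [_ [N0 [k [k1 [k2 H]]]]] := packed.
have [_ [_ _ F]] := H _ (canonical_unique fl).
exact: (F N (s z) (kappa z) mu z Uz (fN z Uz) (fk z Uz)).
Qed.

Lemma chart_lam_gt0 z : U z -> 0 < lam rho z.
Proof.
by move=> Uz; have [lpos _] := packed; have [l0 _] := lpos z Uz; rewrite -toC0 lt_toC.
Qed.

Lemma chart_smooth_x : smoothV U (loc c x).
Proof. exact: sX. Qed.
Lemma chart_smooth_imm : smoothV U (imm_z xi).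
Proof. exact: (smooth_A oU sX). Qed.
Lemma chart_smooth_L : smoothV U L.
Proof. exact: smooth_lift. Qed.
Lemma chart_smooth_T : smoothV U T.
Proof.
by apply: (smoothV_row_mx (smoothV_row_mx chart_smooth_imm _)); apply: (smoothV_scalar oU);
  exact: (smooth_supp oU sX).
Qed.
Lemma chart_smooth_Tb : smoothV U Tb.
Proof. exact: (smoothV_conj oU chart_smooth_T). Qed.
Lemma chart_Dzb_x z : U z -> Dzb (loc c x) z = vconj (imm_z xi z).
Proof. by move=> Uz; exact: (Dzb_X sX Uz). Qed.
Lemma chart_isD_supp z : U z -> isD (supp xi) z (supp_z xi z) (rho z).
Proof. by move=> Uz; exact: (isD_supp oU sX conf minimal Uz). Qed.
Lemma chart_smooth_supp : smoothC U (supp xi).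
Proof. exact: (smooth_supp oU sX). Qed.
Lemma chart_dot_imm z : U z -> dot (imm_z xi z) (imm_z xi z) = 0.
Proof. by move=> Uz; exact: (dot_A_A conf Uz). Qed.
Lemma chart_rho_neq0 z : U z -> rho z != 0.
Proof. by move=> /chart_rho_gt0; rewrite lt0r => /andP[]. Qed.
Lemma chart_rho_conj z : (rho z)^* = rho z.
Proof. exact: rho_conj. Qed.
Lemma chart_invK p : chart_dom c p -> chart_inv c (c p) = p.
Proof. by move=> dp; case: (atlas_chart hc) => _ _ _ _; apply. Qed.
Lemma chart_near p (Q : set (C R)) : chart_dom c p -> (\forall z \near c p, Q z) ->
  \forall q \near p, chart_dom c q /\ Q (c q).
Proof.
move=> dp nQ; case: (atlas_chart hc) => od _ cc _ _.
apply: filterI; first exact: (open_nbhs_nbhs (conj od dp)).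
exact: (cc p dp) nQ.
Qed.
Lemma chart_inv_near z (Q : set M) : U z -> (\forall q \near chart_inv c z, Q q) ->
  \forall w \near z, Q (chart_inv c w).
Proof. by move=> Uz nQ; case: (atlas_chart hc) => _ _ _ ci _; exact: (ci z Uz). Qed.

End ChartFrame.

Lemma willmore_stereo (R : realType) (M : riemannSurface R) (n : nat) (x : M -> 'rV[R]_n) :
  superconformal_minimal x -> willmore (fun p => inv_stereo (Some (x p))).
Proof.
move=> hx; split.
- split; first by move=> p; exact: inv_stereo_sphere.
  split; first by move=> c hc; exact: (smooth_y hx hc).
  by move=> c hc z Uz; exact: (conformal_y hx hc Uz).
- move=> c hc; have [Y [N [s [k [k1 [k2 [h1 h2 h3 _]]]]]]] := chart_frame_exists hx hc.
  by exists Y, N, s, k, k1, k2.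
Qed.

(** * From forms to adjoint transforms *)

Section LocalPairs.
Variable R : realType.
Implicit Types (z w p : C R) (U : set (C R)).

Definition nball p (d : R) : set (C R) := [set w | n1 (w - p) < d].

Lemma nball_center p d : 0 < d -> nball p d p.
Proof. by move=> d0; rewrite /nball /= subrr n1_0. Qed.

Lemma open_nball p d : open (nball p d).
Proof.
rewrite openE => w wd; apply/nbhsCP; exists (d - n1 (w - p)); first by rewrite subr_gt0.
have wd' : n1 (w - p) < d := wd.
move=> w' h; rewrite /nball /=; have := n1D (w' - w) (w - p).
have -> : w' - w + (w - p) = w' - p by ring.
lra.
Qed.

Lemma nbhs_nball p (A : set (C R)) : nbhs p A -> exists2 d : R, 0 < d & nball p d `<=` A.
Proof. by move=> /nbhsCP[d d0 dA]; exists d => // w /dA. Qed.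

Lemma nball_nbhs p d : 0 < d -> nbhs p (nball p d).
Proof. by move=> d0; exact: (open_near (@open_nball p d) (nball_center p d0)). Qed.

Lemma dnbhs_near p (A : set (C R)) : (\forall w \near p^', A w) ->
  \forall w \near p, w != p -> A w.
Proof. by []. Qed.

(* Near [z] the function [gc] is the quotient [e / tau], with [tau = 0] exactly where [gc] is infinite. *)
Definition local_pair (gc : C R -> option (C R)) z : Prop :=
  exists e tau : C R -> C R, \forall w \near z, [/\ derivable e w 1, derivable tau w 1 &
    match gc w with
    | Some a => tau w != 0 /\ a * tau w = e w
    | None => tau w = 0 /\ e w != 0
    end].

Lemma local_pair_infinite gc U z : open U -> U z -> (forall w, U w -> gc w = None) ->
  local_pair gc z.
Proof.
move=> oU Uz gN; exists (fun=> 1), (fun=> 0); apply: filterS (open_near oU Uz) => w Uw.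
by split; [exact: cderivable_cst|exact: cderivable_cst|rewrite gN// oner_neq0].
Qed.

Lemma local_pair_finite gc z : (\forall w \near z, fin_holo_at gc w) -> local_pair gc z.
Proof.
move=> H; exists (fin gc), (fun=> 1); apply: filterS H => w [gw dg].
split; [exact: dg|exact: cderivable_cst|].
by move: gw; rewrite /fin; case: (gc w) => [a _|//]; rewrite oner_neq0 mulr1.
Qed.

(** The pair is [(1, 1 / g)]: extended by 0 at the pole, [1 / g] is continuous there and holomorphic
    around it, so the singularity is removable. *)
Lemma local_pair_pole gc z : pole gc z -> local_pair gc z.
Proof.
move=> [gz /dnbhs_near H B].
pose f w := if gc w is Some a then a^-1 else 0.
have fz : f z = 0 by rewrite /f gz.
have big (b : R) : \forall w \near z, w != z -> toC b <= `|fin gc w| by exact: dnbhs_near (B b).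
have near1 : \forall w \near z, w != z ->
    [/\ fin_holo_at gc w, fin gc w != 0 & f w = (fin gc w)^-1].
  apply: filterS2 H (big 1) => w h1 h2 wz; have [gw dg] := h1 wz.
  split; [by split| |].
  - have := h2 wz; rewrite toC1; apply: contraTneq => ->; by rewrite normr0 ler10.
  - by move: gw; rewrite /f /fin; case: (gc w).
have near2 : \forall w \near z, w != z -> \forall u \near w, f u = (fin gc u)^-1.
  have [d d0 dn] := nbhs_nball near1.
  apply: filterS (nball_nbhs z d0) => w wd wz.
  have h1 := open_near (@open_nball z d) wd.
  have h2 : \forall u \near w, u != z.
    apply/nbhsCP; exists (n1 (w - z)); first by apply: n1_gt0; rewrite subr_eq0.
    by move=> u; apply: contraTneq => ->; rewrite n1_sym ltxx.
  by apply: filterS2 h1 h2 => u /dn h /h[].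
have df : \forall w \near z, w != z -> derivable f w 1.
  apply: filterS2 near1 near2 => w h1 h2 wz; have [[_ dg] g0 _] := h1 wz.
  have hf : {near w, (fun u => (fin gc u)^-1) =1 f} by apply: filterS (h2 wz) => u ->.
  by apply: near_eq_derivable hf _; apply: cderivableV; [exact: g0|exact: dg].
have cf : {for z, continuous f}.
  apply/contCP => e e0; rewrite fz.
  (* Where [g] exceeds [3 / e], [n1V] bounds [1 / g] by [2 e / 3 < e]. *)
  have e30 : 0 < 3 / e by rewrite divr_gt0.
  have [d d0 dh] := nbhs_nball (filterI near1 (big (3 / e))).
  exists d => // w /dh [h1 h2]; rewrite subr0.
  have [->|wz] := eqVneq w z; first by rewrite fz n1_0.
  have [_ g0 ->] := h1 wz; have le3 := h2 wz.
  have n3 : 3 / e <= n1 (fin gc w) by rewrite -le_toC (le_trans le3)// norm_le_n1.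
  apply: (le_lt_trans (n1V _)).
  rewrite ltr_pdivrMr; last exact: lt_le_trans n3.
  by move: n3; rewrite ler_pdivrMr// mulrC; lra.
have dfz : derivable f z 1 by exact: removable_singularity cf df.
exists (fun=> 1), f; apply: filterS2 near1 df => w h1 h2.
have [->|wz] := eqVneq w z.
  by split; [exact: cderivable_cst|exact: dfz|rewrite gz fz oner_neq0].
split; [exact: cderivable_cst|exact: h2|].
have [_ g0 fw] := h1 wz; move: g0 fw; rewrite /fin; case: (gc w) => [a /= a0 ->|]; last by rewrite eqxx.
by rewrite invr_neq0// mulfV.
Qed.

Lemma isD_dz_self (F : C R -> C R) z p q : isD F z p q -> isD F z (dz F z) q.
Proof. by move=> h; rewrite (isD_dz h). Qed.

Lemma isD_holo_combination (F G H : C R -> C R) z p q p' p'' :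
  isD F z p q -> isD G z p' 0 -> isD H z p'' 0 ->
  isD (fun w => F w * G w + H w) z (dz (fun w => F w * G w + H w) z) (q * G z).
Proof.
move=> dF dG dH; have := isD_dz_self (isDD (isDM dF dG) dH).
by rewrite mulr0 !addr0.
Qed.

(** As [A] and [B] are null, the only quadratic term in the square of [u + p A + q B] is [2 p q r];
    it becomes the coefficient of the point at infinity. *)
Lemma cone_hat m (u A B : 'rV[C R]_m) (b b' r p q : C R) :
  dot A A = 0 -> dot B B = 0 -> dot A B = r -> dot u A = b -> dot u B = b' ->
  let v := u + p *: A + q *: B in
  mk3 v ((dot v v + -1) / 2) ((dot v v + 1) / 2) =
  mk3 u ((dot u u + -1) / 2) ((dot u u + 1) / 2) + p *: mk3 A b b + q *: mk3 B b' b'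
    + (p * q * r) *: mk3 0 1 1.
Proof.
move=> AA BB AB uA uB v.
have vv : dot v v = dot u u + 2 * (p * b) + 2 * (q * b') + 2 * (p * q * r).
  rewrite /v !(dotDl, dotDr, dotZl, dotZr) AA BB AB uA uB (dotC A u) (dotC B u) (dotC B A).
  by rewrite uA uB AB; ring.
by rewrite vv !mk3Z !mk3D scaler0 addr0; congr mk3; field.
Qed.

End LocalPairs.

Section FromForm.
Variables (R : realType) (M : riemannSurface R) (n : nat) (x : M -> 'rV[R]_n)
  (xhat : M -> option 'rV[R]_n).
Hypothesis hx : superconformal_minimal x.
Let y p := inv_stereo (Some (x p)).
Let yhat p := inv_stereo (xhat p).
Variables (c : chart R M) (hc : atlas c) (gc : C R -> option (C R)).
Local Notation U := (chart_img c).
Local Notation X := (xi x c).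
Local Notation L := (clift X).
Local Notation T := (clift_z X).
Local Notation Tb := (clift_zb X).
Local Notation P := (cone_pt R n).
Local Notation rho := (metric X).
Local Notation b := (supp X).
Local Notation ph := (phi X).
Let Lhat (z : C R) := cvec (light (yhat (chart_inv c z))).

Hypothesis form : forall z, U z -> match gc z with
  | Some a => exists2 v, xhat (chart_inv c z) = Some v &
      cvec v = loc c x z - ((dot (loc c x z) (Dzb (loc c x) z) + a^*) /
           dot (Dz (loc c x) z) (Dzb (loc c x) z)) *: Dz (loc c x) z
        - ((dot (loc c x z) (Dz (loc c x) z) + a) /
           dot (Dz (loc c x) z) (Dzb (loc c x) z)) *: Dzb (loc c x) z
  | None => xhat (chart_inv c z) = None
  end.
Hypothesis pairs : forall z, U z -> local_pair gc z.

(** For [g = e / t], [s = b t + e] and [l = rho], this is the lift of [xhat] multiplied by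
    [|t| ^ 2]. It stays smooth at the zeros of [t], where it is the nonzero multiple [|e| ^ 2 / rho]
    of [P]. *)
Definition hat_lift (s t l : C R) z := (t * t^*) *: L z + (- (s^* * t / l)) *: T z
  + (- (s * t^* / l)) *: Tb z + (s * s^* / l) *: P.

Lemma subZ2 m (p q : C R) (u v w : 'rV[C R]_m) :
  u - p *: v - q *: w = u + (- p) *: v + (- q) *: w.
Proof. by rewrite !scaleNr. Qed.

Lemma cvec_xt_hat z v a : U z ->
  cvec v = loc c x z - ((dot (loc c x z) (Dzb (loc c x) z) + a^*) /
           dot (Dz (loc c x) z) (Dzb (loc c x) z)) *: Dz (loc c x) z
        - ((dot (loc c x z) (Dz (loc c x) z) + a) /
           dot (Dz (loc c x) z) (Dzb (loc c x) z)) *: Dzb (loc c x) z ->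
  cvec (xt v) = L z + (- ((b z + a)^* / rho z)) *: T z + (- ((b z + a) / rho z)) *: Tb z
    + ((b z + a) * (b z + a)^* / rho z) *: P.
Proof.
move=> Uz vE; have {}vE := etrans vE (subZ2 _ _ _ _ _).
move: vE; rewrite (chart_Dzb_x hx hc Uz) => vE.
have r0 := chart_rho_neq0 hx hc Uz.
have bb := supp_conj X z; have TbE := lift_zbE X z.
have H := @cone_hat R n (loc c x z) (imm_z X z) (vconj (imm_z X z)) (b z) (b z)^* (rho z)
  (- ((b z + a)^* / rho z)) (- ((b z + a) / rho z)) (chart_dot_imm hx hc Uz) _ erefl erefl (esym bb).
have {}H := H (etrans (esym (conj_dot _ _)) (etrans (congr1 (fun q : C R => q^*) (chart_dot_imm hx hc Uz)) (conjC0 _))).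
have vE' : cvec v = loc c x z + (- ((b z + a)^* / rho z)) *: imm_z X z +
    (- ((b z + a) / rho z)) *: vconj (imm_z X z).
  have cD : (b z + a)^* = (b z)^* + a^* by exact: rmorphD.
  by rewrite cD bb; exact: vE.
rewrite cvec_xt vE' H -TbE.
congr (_ + _ + _ + _ *: _).
by move: (b z + a) (b z + a)^* (rho z) r0 => s s' l l0; field.
Qed.

Lemma hat_liftE z e t : U z ->
  match gc z with Some a => t != 0 /\ a * t = e | None => t = 0 /\ e != 0 end ->
  exists2 k : C R, 0 < k & hat_lift (b z * t + e) t (rho z) z = k *: Lhat z.
Proof.
move=> Uz; have r0 := chart_rho_neq0 hx hc Uz; have rp := chart_rho_gt0 hx hc Uz.
have := form Uz; case: (gc z) => [a [v xv vE] [t0 <-]|xN [-> e0]].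
- have := cvec_xt_hat Uz vE => hE.
  exists (t * t^* * toC ((dot v v + 1) / 2)).
    rewrite mulr_gt0//; first by rewrite -normCK exprn_gt0// normr_gt0.
    by rewrite -toC0 lt_toC; have h := dot_ge0 v; rewrite divr_gt0//; lra.
  have -> : Lhat z = toC (2 / (dot v v + 1)) *: cvec (xt v).
    by rewrite /Lhat /yhat xv light_stereo cvecZ.
  rewrite scalerA -mulrA -rmorphM /=.
  have -> : (dot v v + 1) / 2 * (2 / (dot v v + 1)) = 1.
    by have d := dot1_neq0 v; field; rewrite d.
  rewrite toC1 mulr1 hE /hat_lift.
  have -> : b z * t + a * t = t * (b z + a) by ring.
  rewrite rmorphM /=.
  move: (b z + a) (b z + a)^* (L z) (T z) (Tb z) P (rho z) r0 => s s' v1 v2 v3 v4 l l0.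
  by apply/rowP => j; rewrite !mxE; field.
- exists (e * e^* / rho z).
    by rewrite divr_gt0// -normCK exprn_gt0// normr_gt0.
  have -> : Lhat z = P by rewrite /Lhat /yhat xN light_stereo_oo cvec_mk3 toC1 /cvec map_mx0.
  have -> : b z * 0 + e = e by rewrite mulr0 add0r.
  by rewrite /hat_lift conjC0 !mulr0 !mul0r !oppr0 !scale0r !add0r.
Qed.

Let sig (e t : C R -> C R) w := b w * t w + e w.
Let W (e t : C R -> C R) w := hat_lift (sig e t w) (t w) (rho w) w.

Let ball_pair z : U z -> exists2 d : R, 0 < d & exists e t : C R -> C R,
  [/\ nball z d `<=` U, forall w, nball z d w -> derivable e w 1,
      forall w, nball z d w -> derivable t w 1 &
      forall w, nball z d w -> match gc w with
        | Some a => t w != 0 /\ a * t w = e w | None => t w = 0 /\ e w != 0 end].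
Proof.
move=> Uz; have [e [t H]] := pairs Uz.
have [d d0 dh] := nbhs_nball (filterI H (open_near (chart_open hc) Uz)).
exists d => //; exists e, t; split.
- by move=> w /dh[].
- by move=> w /dh[[]].
- by move=> w /dh[[]].
- by move=> w /dh[[]].
Qed.

Let smooth_W z d e t : nball z d `<=` U -> (forall w, nball z d w -> derivable e w 1) ->
  (forall w, nball z d w -> derivable t w 1) ->
  [/\ smoothC (nball z d) (sig e t), smoothC (nball z d) t & smoothV (nball z d) (W e t)].
Proof.
move=> VU de dt; pose V := nball z d; have oV : open V := @open_nball R z d.
have se : smoothC V e := smoothC_holo oV de.
have st : smoothC V t := smoothC_holo oV dt.
have sb : smoothC V b := smoothC_sub VU (chart_smooth_supp hx hc).
have sr : smoothC V rho := smoothC_sub VU (chart_smooth_rho hx hc).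
have srV : smoothC V (fun w => (rho w)^-1).
  by apply: (smoothCV oV _ sr) => w /VU; exact: (chart_rho_neq0 hx hc).
have ss : smoothC V (sig e t) := smoothCD oV (smoothCM oV sb st) se.
have sL := smoothV_sub VU (chart_smooth_L hx hc).
have sT := smoothV_sub VU (chart_smooth_T hx hc).
have sTb := smoothV_sub VU (chart_smooth_Tb hx hc).
have ssc := smoothC_conj oV ss; have stc := smoothC_conj oV st.
split=> //.
apply: (smoothVD oV (smoothVD oV (smoothVD oV _ _) _) _).
- exact: (smoothVZ oV (smoothCM oV st stc) sL).
- exact: (smoothVZ oV (smoothCN oV (smoothCM oV (smoothCM oV ssc st) srV)) sT).
- exact: (smoothVZ oV (smoothCN oV (smoothCM oV (smoothCM oV ss stc) srV)) sTb).
- exact: (smoothVZ oV (smoothCM oV (smoothCM oV ss ssc) srV) (smoothV_cst oV P)).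
Qed.

Lemma smooth_yhat : smoothV U (loc c yhat).
Proof.
move=> j; apply: smoothC_local => z Uz.
have [d d0 [e [t [VU de dt H]]]] := ball_pair Uz.
exists (nball z d); first exact: nball_center.
have [_ _ sW] := smooth_W VU de dt.
apply: (smoothV_of_light (@open_nball R z d) sW) => w Vw.
have [k k0 kE] := hat_liftE (VU _ Vw) (H w Vw).
by exists k; [rewrite lt0r in k0; case/andP: k0|exact: kE].
Qed.

(** The pairing of [L] with the lift [W] is [- |sig| ^ 2 / rho]. The left side mentions neither the
    chart nor the pair, so it serves as the global definition of the open dense set. *)
Lemma sig_neq0 e t z : U z ->
  match gc z with Some a => t z != 0 /\ a * t z = e z | None => t z = 0 /\ e z != 0 end ->
  (mink (light (y (chart_inv c z))) (light (yhat (chart_inv c z))) != 0) = (sig e t z != 0).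
Proof.
move=> Uz H; have r0 := chart_rho_neq0 hx hc Uz.
have [k k0 kE] := hat_liftE Uz H.
have [[LL LT LTb LP] _] := chart_pairings hx hc.
have LW : mink (L z) (W e t z) = - (sig e t z * (sig e t z)^* / rho z).
  by rewrite /W /hat_lift !minkDr !minkZr LL LT LTb LP; ring.
have kn : k != 0 by rewrite lt0r in k0; case/andP: k0.
have mk : mink (cvec (light (y (chart_inv c z)))) (Lhat z) =
    conf_factor x c z * (- (sig e t z * (sig e t z)^* / rho z) / k).
  rewrite cvec_light_y minkZl -LW /W kE minkZr; congr (_ * _).
  by rewrite mulrC mulKf.
have f0 : conf_factor x c z != 0.
  rewrite /conf_factor dot_cvec -toC1 -toCD mulf_neq0 ?pnatr_eq0// invr_neq0//.
  by apply/eqP => /(congr1 (@re R)) /= /eqP; rewrite (negbTE (dot1_neq0 _)).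
have -> : (mink (light (y (chart_inv c z))) (light (yhat (chart_inv c z))) != 0) =
   (mink (cvec (light (y (chart_inv c z)))) (Lhat z) != 0).
  rewrite mink_cvec; congr (~~ _); apply/eqP/eqP => [->//|/(congr1 (@re R))//].
have gen (f s r q : C R) : f != 0 -> r != 0 -> q != 0 ->
    (f * (- (s * s^* / r) / q) != 0) = (s != 0).
  move=> f1 r1 q1; rewrite !mulf_eq0 oppr_eq0 !mulf_eq0 !invr_eq0 conjC_eq0.
  by rewrite (negbTE f1) (negbTE r1) (negbTE q1) !orbF /= orbb.
by rewrite mk; exact: gen.
Qed.

(* With [mu = phi - 2 rho conj h] the Riccati equation for [mu] reads [h_zbar = - rho h ^ 2], which
   [h = 1 / (b + g)] solves for holomorphic [g] because [b_zbar = rho]. *)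
Definition hat_h z : C R := if gc z is Some a then (b z + a)^-1 else 0.
Definition hat_mu z : C R := ph z + - 2 * (rho z * (hat_h z)^*).

Let isD_sig e t z : U z -> derivable e z 1 -> derivable t z 1 ->
  isD (sig e t) z (dz (sig e t) z) (rho z * t z).
Proof.
move=> Uz /derivable_isCd/isD_holo de /derivable_isCd/isD_holo dt.
exact: isD_holo_combination (chart_isD_supp hx hc Uz) dt de.
Qed.

Let sig_near z d e t : 0 < d -> smoothC (nball z d) (sig e t) -> sig e t z != 0 ->
  exists2 d' : R, 0 < d' & nball z d' `<=` nball z d /\ forall w, nball z d' w -> sig e t w != 0.
Proof.
move=> d0 ss s0; have n0 := n1_gt0 s0.
have [d1 d10 dh] := (contCP _ _).1 (smoothC_cont ss (nball_center z d0)) _ n0.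
exists (Num.min d d1); first by rewrite lt_min d0.
split=> w; rewrite /nball /= lt_min => /andP[w1 w2] //.
by apply: contraTneq (dh _ w2) => ->; rewrite sub0r n1N ltxx.
Qed.

Let good w := mink (light (y (chart_inv c w))) (light (yhat (chart_inv c w))) != 0.

Lemma good_near z : U z -> good z -> \forall w \near z, good w.
Proof.
move=> Uz gz; have [d d0 [e [t [VU de dt H]]]] := ball_pair Uz.
have Vz := nball_center z d0; have [ss _ _] := smooth_W VU de dt.
have s0 : sig e t z != 0 by rewrite -(sig_neq0 Uz (H z Vz)).
have [d' d'0 [V'V sn]] := sig_near d0 ss s0.
apply: filterS (nball_nbhs z d'0) => w Vw; have Vw' := V'V _ Vw.
by rewrite /good (sig_neq0 (VU _ Vw') (H w Vw')); exact: sn.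
Qed.

(** If [sig = b t + e] vanished near [z], so would its derivative [sig_zbar = rho t]. Then [t] and
    [e] would both be 0 at [z], which a local pair forbids. *)
Lemma good_dense z : U z -> ~ (\forall w \near z, ~ good w).
Proof.
move=> Uz nb; have [d d0 [e [t [VU de dt H]]]] := ball_pair Uz.
have Vz := nball_center z d0; have Hz := H z Vz.
have s0 : \forall w \near z, 0 = sig e t w.
  apply: filterS2 nb (nball_nbhs z d0) => w gw Vw; apply/esym/eqP.
  by move/negP: gw; rewrite /good (sig_neq0 (VU _ Vw) (H w Vw)) negbK.
have sz : 0 = sig e t z := nbhs_singleton s0.
have dD := isD_sig Uz (de z Vz) (dt z Vz).
have := isD_dzb dD; rewrite (isD_dzb (isD_ext s0 (isD_cst 0 z))) => /esym/eqP.
rewrite mulf_eq0 (negbTE (chart_rho_neq0 hx hc Uz)) /= => /eqP t0.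
move: sz Hz; rewrite /sig t0 mulr0 add0r => <-.
by case: (gc z) => [a []|[]]; rewrite ?t0 eqxx.
Qed.

(** Near such a point [hat_h] is [t / sig], smooth even where [g] is infinite. With [t] holomorphic
    and [sig_zbar = rho t], the quotient rule gives the Riccati equation. *)
Lemma hat_h_near z : U z -> good z -> exists2 d : R, 0 < d &
  [/\ smoothC (nball z d) hat_h,
      isD hat_h z (dz hat_h z) (- (rho z * (hat_h z * hat_h z))) &
      exists2 k : C R, 0 < k & hat_lift 1 (hat_h z) (rho z) z = k *: Lhat z].
Proof.
move=> Uz gz; have [d d0 [e [t [VU de dt H]]]] := ball_pair Uz.
have Vz := nball_center z d0; have [ss st _] := smooth_W VU de dt.
have s0 : sig e t z != 0 by rewrite -(sig_neq0 Uz (H z Vz)).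
have [d' d'0 [V'V sn]] := sig_near d0 ss s0.
have oV' := @open_nball R z d'; have Vz' := nball_center z d'0.
have hE w : nball z d' w -> t w * (sig e t w)^-1 = hat_h w.
  move=> Vw; have Hw := H w (V'V _ Vw); have sw := sn w Vw.
  move: Hw sw; rewrite /hat_h /sig; case: (gc w) => [a [t0 <-] s1|[-> e0] s1]; last by rewrite mul0r.
  have -> : b w * t w + a * t w = t w * (b w + a) by ring.
  by rewrite invfM mulrA mulfV// mul1r.
exists d' => //; split.
- apply: (smoothC_ext oV' hE); apply: (smoothCM oV'); first exact: (smoothC_sub V'V st).
  by apply: (smoothCV oV' sn); exact: (smoothC_sub V'V ss).
- have dts := isD_holo (derivable_isCd (dt z Vz)).
  have dD := isD_sig Uz (de z Vz) (dt z Vz).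
  have h := isD_div_dz s0 dts dD.
  have nE : \forall w \near z, t w * (sig e t w)^-1 = hat_h w.
    by apply: filterS (nball_nbhs z d'0) => w; exact: hE.
  have h' := isD_dz_self (isD_ext nE h).
  have E : - (rho z * (hat_h z * hat_h z)) =
    0 * (sig e t z)^-1 - t z * (rho z * t z) * ((sig e t z)^-1 * (sig e t z)^-1).
    by rewrite -(hE z Vz'); move: (sig e t z)^-1 (rho z) => q l; ring.
  by rewrite E.
- have [k k0 kE] := hat_liftE Uz (H z Vz).
  exists (k / (sig e t z * (sig e t z)^*)).
    by rewrite divr_gt0// -normCK exprn_gt0// normr_gt0.
  have -> : (k / (sig e t z * (sig e t z)^*)) *: Lhat z =
     (sig e t z * (sig e t z)^*)^-1 *: W e t z by rewrite /W kE scalerA mulrC.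
  have r0 := chart_rho_neq0 hx hc Uz.
  have sc0 : (sig e t z)^* != 0 by rewrite conjC_eq0.
  rewrite -(hE z Vz') /W /hat_lift conjC1 rmorphM fmorphV /=.
  move: (sig e t z) (sig e t z)^* (t z) (t z)^* (L z) (T z) (Tb z) P (rho z) s0 sc0 r0.
  move=> s sc u uc v1 v2 v3 v4 l s1 sc1 l1.
  by apply/rowP => j; rewrite !mxE; field; rewrite l1 sc1 s1.
Qed.

Let Uo : set M := [set p | mink (light (y p)) (light (yhat p)) != 0].

Lemma chart_adjoint : exists Y N s kappa kappa' mu,
  [/\ frame c y Y N s kappa kappa', smoothC (c @` (chart_dom c `&` Uo)) mu &
  forall z, (c @` (chart_dom c `&` Uo)) z ->
    let eta := kappa' z + ((mu z)^* / 2) *: kappa z in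
    [/\ exists2 t : R, t != 0 & adjoint_lift Y N mu z = toC t *: loc c (@light R n \o yhat) z,
        dz mu z - (mu z) ^+ 2 / 2 - s z = 0 & mink eta eta = 0]].
Proof.
have [Y [N [s [k1 [k2 [k3 [fr _ _ en]]]]]]] := chart_frame_exists hx hc.
have dom z : (c @` (chart_dom c `&` Uo)) z -> U z /\ good z.
  by move=> [p [dp up] <-]; split; [exists p|rewrite /good (chart_invK hc dp)].
exists Y, N, s, k1, k2, hat_mu; split=> //.
- apply: smoothC_local => z /dom[Uz gz].
  have [d d0 [sh _ _]] := hat_h_near Uz gz.
  have [d' d'0 V'U] := nbhs_nball (open_near (chart_open hc) Uz).
  pose V := nball z (Num.min d d').
  have oV : open V := @open_nball R z _.
  have Vd : V `<=` nball z d by move=> w; rewrite /V /nball /= lt_min => /andP[].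
  have VU : V `<=` U by move=> w; rewrite /V /nball /= lt_min => /andP[_ /V'U].
  exists V; first by apply: nball_center; rewrite lt_min d0.
  apply: (smoothCD oV); first exact: (smoothC_sub VU (chart_smooth_phi hx hc)).
  apply: (smoothCZ oV); apply: (smoothCM oV); first exact: (smoothC_sub VU (chart_smooth_rho hx hc)).
  exact: (smoothC_conj oV (smoothC_sub Vd sh)).
- move=> z /dom[Uz gz] eta.
  have [sE aE] := chart_frame_formula hx hc fr hat_mu Uz.
  have [d d0 [sh dh [k k0 kE]]] := hat_h_near Uz gz.
  have r0 := chart_rho_gt0 hx hc Uz; have rn := chart_rho_neq0 hx hc Uz.
  have l0 := chart_lam_gt0 hx hc Uz.
  have rc := chart_rho_conj x c z.
  have nuE : hat_mu z - ph z = - 2 * (rho z * (hat_h z)^*) by rewrite /hat_mu addrC addKr.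
  split; last exact: en.
  (* With [mu - phi = - 2 rho conj h], the bracket of [aE] is [2 rho ^ 2] times [hat_lift 1 h],
     whence this factor. *)
  + have kp : 0 < lam rho z * (2 * rho z * rho z) * k by rewrite !mulr_gt0.
    move: (kp); rewrite ltC => /andP[/eqP ki kr].
    exists (re (lam rho z * (2 * rho z * rho z) * k)); first by rewrite gt_eqF.
    have -> : toC (re (lam rho z * (2 * rho z * rho z) * k)) = lam rho z * (2 * rho z * rho z) * k.
      by apply: complex_eqP => //; rewrite im_toC -ki.
    rewrite aE nuE -[loc c (@light R n \o yhat) z]/(Lhat z) -[RHS]scalerA -kE -[RHS]scalerA; congr (_ *: _).
    have nc : (- 2 * (rho z * (hat_h z)^*))^* = - 2 * (rho z * hat_h z).
      by rewrite !rmorphM /= conjCK rc rmorphN /= rmorph_nat.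
    rewrite nc /hat_lift conjC1.
    move: (hat_h z) (hat_h z)^* (L z) (T z) (Tb z) P (rho z) rn => h hb v1 v2 v3 v4 l ln.
    by apply/rowP => j; rewrite !mxE; field.
  + have dph := smoothC_isD (chart_smooth_phi hx hc) Uz.
    have dmu := isDD dph (isDZ (- 2) (isDM (chart_isD_rho hx hc Uz) (isD_conj dh))).
    rewrite -/hat_mu in dmu; rewrite (isD_dz dmu) sE /sch expr2.
    have cc : (- (rho z * (hat_h z * hat_h z)))^* = - (rho z * ((hat_h z)^* * (hat_h z)^*)).
      by rewrite rmorphN !rmorphM /= rc.
    rewrite cc /hat_mu.
    move: (hat_h z)^* (rho z) (ph z) (dz ph z) => h l f fz.
    by field.
Qed.

End FromForm.

Theorem adjoint_of_form (R : realType) (M : riemannSurface R) (n : nat)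
    (x : M -> 'rV[R]_n) (xhat : M -> option 'rV[R]_n)
    (g : chart R M -> C R -> option (C R)) : superconformal_minimal x ->
  meromorphic_form g \/ infinite_form g -> given_by_form x g xhat ->
  adjoint_transform_euclidean x xhat.
Proof.
move=> hx hg gf.
have form c (hc : atlas c) z : chart_img c z -> match g c z with
  | Some a => exists2 v, xhat (chart_inv c z) = Some v &
      cvec v = loc c x z - ((dot (loc c x z) (Dzb (loc c x) z) + a^*) /
           dot (Dz (loc c x) z) (Dzb (loc c x) z)) *: Dz (loc c x) z
        - ((dot (loc c x z) (Dz (loc c x) z) + a) /
           dot (Dz (loc c x) z) (Dzb (loc c x) z)) *: Dzb (loc c x) z
  | None => xhat (chart_inv c z) = None
  end.
  by move=> [p dp <-]; rewrite (chart_invK hc dp); exact: (gf c hc p dp).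
have pairs c (hc : atlas c) z : chart_img c z -> local_pair (g c) z.
  move=> Uz; case: hg => [[_ mg]|gi].
  - by have [h|h] := mg c hc z Uz; [exact: local_pair_finite|exact: local_pair_pole].
  - by apply: (local_pair_infinite (chart_open hc) Uz); exact: gi.
split.
- exact: willmore_stereo.
- by move=> c hc; exact: (smooth_yhat hx hc (form c hc) (pairs c hc)).
- by move=> p; exact: inv_stereo_sphere.
(* Two light vectors of this form are orthogonal only when the points of the sphere coincide: this
   is the set where [xhat] differs from [x]. *)
exists [set p | mink (light (inv_stereo (Some (x p)))) (light (inv_stereo (xhat p))) != 0]; split.
- rewrite openE => p /= gp; have [c hc dp] := atlas_cover p.
  have Uz : chart_img c (c p) by exists p.
  have gz : mink (light (inv_stereo (Some (x (chart_inv c (c p))))))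
    (light (inv_stereo (xhat (chart_inv c (c p))))) != 0 by rewrite (chart_invK hc dp).
  have nz := good_near hx hc (form c hc) (pairs c hc) Uz gz.
  apply: filterS (chart_near hc dp nz) => q [dq].
  by rewrite /= (chart_invK hc dq).
- move=> O [p Op] oO; apply: contrapT => nO.
  have [c hc dp] := atlas_cover p; have Uz : chart_img c (c p) by exists p.
  apply: (good_dense hx hc (form c hc) (pairs c hc) Uz).
  have nz : \forall q \near chart_inv c (c p), O q.
    by rewrite (chart_invK hc dp); exact: open_nbhs_nbhs.
  apply: filterS (chart_inv_near hc Uz nz) => w Ow gw.
  by apply: nO; exists (chart_inv c w).
- by move=> c hc; exact: (chart_adjoint hx hc (form c hc) (pairs c hc)).
Qed.

(** * From adjoint transforms to forms *)

Lemma mk3_cmb (K : comNzRingType) m (k p q r t a0 a1 a2 a3 a4 b0 b1 b2 b3 b4 : K)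
    (u0 u1 u2 u3 : 'rV[K]_m) :
  k *: mk3 u0 a0 b0 = p *: mk3 u1 a1 b1 + q *: mk3 u2 a2 b2 + r *: mk3 u3 a3 b3 + t *: mk3 0 a4 b4 ->
  k *: u0 = p *: u1 + q *: u2 + r *: u3.
Proof.
rewrite !mk3Z !mk3D scaler0 addr0 => /(congr1 (fun u : 'rV[K]_(m + 1 + 1) => lsubmx (lsubmx u))).
by rewrite /mk3 !row_mxKl.
Qed.

Section FromAdjoint.
Variables (R : realType) (M : riemannSurface R) (n : nat) (x : M -> 'rV[R]_n)
  (xhat : M -> option 'rV[R]_n).
Hypothesis hx : superconformal_minimal x.
Let y p := inv_stereo (Some (x p)).
Let yhat p := inv_stereo (xhat p).
Variables (c : chart R M) (hc : atlas c) (D : set (C R)).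
Local Notation U := (chart_img c).
Local Notation X := (xi x c).
Local Notation L := (clift X).
Local Notation T := (clift_z X).
Local Notation Tb := (clift_zb X).
Local Notation P := (cone_pt R n).
Local Notation rho := (metric X).
Local Notation b := (supp X).
Local Notation ph := (phi X).
Let Lhat (z : C R) := cvec (light (yhat (chart_inv c z))).
Let oU : open U := chart_open hc.

Hypothesis smooth_hat : smoothV U (loc c yhat).
Hypothesis oD : open D.
Hypothesis DU : D `<=` U.
Hypothesis dense_D : forall z (Q : set (C R)), U z -> (\forall w \near z, Q w) ->
  exists w, D w /\ Q w.
Variables (Y N : C R -> 'rV[R]_(n + 1 + 1)) (s : C R -> C R)
  (kappa kappa' : C R -> 'rV[C R]_(n + 1 + 1)) (mu : C R -> C R).
Hypothesis fr : frame c y Y N s kappa kappa'.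
Hypothesis smooth_mu : smoothC D mu.
Hypothesis adj : forall z, D z ->
  (exists2 t : R, t != 0 & adjoint_lift Y N mu z = toC t *: Lhat z) /\
  dz mu z - (mu z) ^+ 2 / 2 - s z = 0.

(** The hypotheses on [mu] speak of the dense set [D] only; by continuity this carries their
    consequences to all of the chart. *)
Lemma closed_zero (F : C R -> C R) (V : set (C R)) : open V -> V `<=` U -> smoothC V F ->
  (forall z, D z -> V z -> F z = 0) -> forall z, V z -> F z = 0.
Proof.
move=> oV VU sF F0 z Vz; apply/eqP/negPn/negP => /n1_gt0 n0.
have [d d0 dh] := (contCP _ _).1 (smoothC_cont sF Vz) _ n0.
have [w [Dw [wz Vw]]] := dense_D (VU _ Vz) (filterI (nball_nbhs z d0) (open_near oV Vz)).
by have := dh w wz; rewrite (F0 w Dw Vw) sub0r n1N ltxx.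
Qed.

Lemma smoothC_mink m (V : set (C R)) (F G : C R -> 'rV[C R]_(m + 1)) : open V ->
  smoothV V F -> smoothV V G -> smoothC V (fun z => mink (F z) (G z)).
Proof.
move=> oV sF sG; pose k := rshift m (ord0 : 'I_1).
have h := smoothCD oV (smoothC_dot oV sF sG) (smoothCZ oV (- 2) (smoothCM oV (sF k) (sG k))).
apply: (smoothC_ext oV _ h) => z Vz; rewrite minkE -/k.
by rewrite -[RHS]/(dot (F z) (G z) - F z 0 k * G z 0 k *+ 2); ring.
Qed.

(** These pairings are smooth on the whole chart, unlike [mu], so everything is to be expressed by
    them. By [hat_infinite] and [hat_finite], [pp] vanishes exactly where [xhat] is infinite. *)
Let pp z := mink (Lhat z) P.
Let l0 z := mink (Lhat z) (L z).
Let lT z := mink (Lhat z) (T z).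
Let lTb z := mink (Lhat z) (Tb z).

Lemma smooth_Lhat : smoothV U Lhat.
Proof.
have := smoothV_row_mx smooth_hat (smoothV_cst oU (1%:M : 'rV[C R]_1)).
by apply: (smoothV_ext oU) => z _; rewrite /Lhat cvec_light.
Qed.

Let sp : smoothC U pp.
Proof. exact: (smoothC_mink oU smooth_Lhat (smoothV_cst oU P)). Qed.
Let sl0 : smoothC U l0.
Proof. exact: (smoothC_mink oU smooth_Lhat (chart_smooth_L hx hc)). Qed.
Let slT : smoothC U lT.
Proof. exact: (smoothC_mink oU smooth_Lhat (chart_smooth_T hx hc)). Qed.
Let slTb : smoothC U lTb.
Proof. exact: (smoothC_mink oU smooth_Lhat (chart_smooth_Tb hx hc)). Qed.

Lemma mink4 m (l t t' q : 'rV[C R]_(m + 1)) (r a1 a2 a3 a4 : C R) :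
  [/\ mink l l = 0, mink l t = 0, mink l t' = 0 & mink l q = -1] ->
  [/\ mink t t = 0, mink t' t' = 0 & mink t t' = r] ->
  [/\ mink t q = 0, mink t' q = 0 & mink q q = 0] ->
  let F := a1 *: l + a2 *: t + a3 *: t' + a4 *: q in
  [/\ mink F l = - a4, mink F t = a3 * r, mink F t' = a2 * r, mink F q = - a1 &
      mink F F = 2 * (a2 * a3 * r - a1 * a4)].
Proof.
move=> [ll lt lt' lq] [tt t't' tt'] [tq t'q qq] F.
have El : mink F l = - a4.
  by rewrite /F !(minkDl, minkZl) ll (minkC t) lt (minkC t') lt' (minkC q) lq; ring.
have Et : mink F t = a3 * r.
  by rewrite /F !(minkDl, minkZl) lt tt (minkC t') tt' (minkC q) tq; ring.
have Et' : mink F t' = a2 * r.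
  by rewrite /F !(minkDl, minkZl) lt' tt' t't' (minkC q) t'q; ring.
have Eq : mink F q = - a1.
  by rewrite /F !(minkDl, minkZl) lq tq t'q qq; ring.
split=> //; rewrite {2}/F !(minkDr, minkZr) El Et Et' Eq; ring.
Qed.

Let chart4 z a1 a2 a3 a4 : U z ->
  let F := a1 *: L z + a2 *: T z + a3 *: Tb z + a4 *: P in
  [/\ mink F (L z) = - a4, mink F (T z) = a3 * rho z, mink F (Tb z) = a2 * rho z,
      mink F P = - a1 & mink F F = 2 * (a2 * a3 * rho z - a1 * a4)].
Proof.
move=> Uz; have [[LL LT LTb LP] [[TT TbTb TTb] [TP TbP PP]]] := chart_pairings hx hc.
exact: (mink4 _ _ _ _ (And4 (LL z) (LT z) (LTb z) (LP z)) (And3 (TT z Uz) (TbTb z Uz) (TTb z))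
  (And3 (TP z) (TbP z) PP)).
Qed.

Let nu z := mu z - ph z.

Lemma adj_pairings z : D z -> exists2 r : C R, r != 0 &
  (nu z * (nu z)^* / 2) *: L z + (nu z)^* *: T z + nu z *: Tb z + (2 * rho z) *: P = r *: Lhat z /\
  [/\ r * l0 z = - (2 * rho z), r * lT z = nu z * rho z, r * lTb z = (nu z)^* * rho z &
      r * pp z = - (nu z * (nu z)^* / 2)].
Proof.
move=> Dz; have Uz := DU Dz.
have [[t t0 E] _] := adj Dz; have [_ aE] := chart_frame_formula hx hc fr mu Uz.
have ln := lt0r_neq0 (chart_lam_gt0 hx hc Uz).
set F := (nu z * (nu z)^* / 2) *: L z + (nu z)^* *: T z + nu z *: Tb z + (2 * rho z) *: P.
have FE : F = (toC t / lam rho z) *: Lhat z.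
  have h : lam rho z *: F = toC t *: Lhat z by rewrite -E aE.
  by rewrite mulrC -scalerA -h scalerA mulVf// scale1r.
exists (toC t / lam rho z).
  rewrite mulf_neq0 ?invr_neq0//; apply: contra t0 => /eqP/(congr1 (@re R)) /= ->.
  exact: eqxx.
split=> //.
have [h1 h2 h3 h4 _] := chart4 (nu z * (nu z)^* / 2) (nu z)^* (nu z) (2 * rho z) Uz.
by split; rewrite -minkZl -FE.
Qed.

(** On [D] this is [h = - conj nu / (2 rho)]. As a quotient of pairings it ignores the scaling of
    [Lhat], and it is smooth off [D] as well wherever [l0] is nonzero, in particular where [xhat] is
    infinite. *)
Let hh z := lTb z * (rho z * l0 z)^-1.

Lemma hh_nu z : D z -> l0 z != 0 /\ hh z = - 2^-1 * ((nu z)^* * (rho z)^-1).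
Proof.
move=> Dz; have [r r0 [_ [h1 _ h3 _]]] := adj_pairings Dz.
have rn := chart_rho_neq0 hx hc (DU Dz).
have l0n : l0 z != 0.
  by apply: contra_eq_neq h1 => ->; rewrite mulr0 eq_sym oppr_eq0 mulf_neq0// pnatr_eq0.
split=> //; rewrite /hh.
have -> : lTb z = (nu z)^* * rho z / r by rewrite -h3 mulrC mulKf.
have -> : l0 z = - (2 * rho z) / r by rewrite -h1 mulrC mulKf.
by move: (nu z)^* (rho z) rn => v q q0; field; rewrite q0 r0.
Qed.

Lemma isD_hh z : D z -> isD hh z (dz hh z) (- (rho z * (hh z * hh z))).
Proof.
move=> Dz; have Uz := DU Dz; have [_ hE] := hh_nu Dz.
have rn := chart_rho_neq0 hx hc Uz.
have dmu := smoothC_isD smooth_mu Dz.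
have dph := smoothC_isD (chart_smooth_phi hx hc) Uz.
have dnu : isD nu z (ph z * nu z + nu z * nu z / 2) (dzb mu z + -1 * dzb ph z).
  have h := isDD dmu (isDZ (-1) dph).
  have -> : ph z * nu z + nu z * nu z / 2 = dz mu z + -1 * dz ph z.
    have [_ ric] := adj Dz; have [sE _] := chart_frame_formula hx hc fr mu Uz.
    have -> : dz mu z = mu z ^+ 2 / 2 + s z.
      by apply/eqP; rewrite -subr_eq0; apply/eqP; rewrite -[RHS]ric; ring.
    by rewrite sE /sch /nu; move: (dz ph z) => q; field.
  by apply: isD_ext h; near=> w; rewrite /nu mulN1r.
have d1 := isDZ (- 2^-1) (isDM (isD_conj dnu) (isDV rn (chart_isD_rho hx hc Uz))).
have nE' w : D w -> - 2^-1 * ((nu w)^* * (rho w)^-1) = hh w by move=> Dw; exact: esym (hh_nu Dw).2.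
have nE : \forall w \near z, - 2^-1 * ((nu w)^* * (rho w)^-1) = hh w.
  by apply: filterS (open_near oD Dz) => w; exact: nE'.
have := isD_dz_self (isD_ext nE d1).
have -> // : - 2^-1 * ((ph z * nu z + nu z * nu z / 2)^* * (rho z)^-1 +
   (nu z)^* * - ((ph z * rho z)^* * ((rho z)^-1 * (rho z)^-1))) = - (rho z * (hh z * hh z)).
have c1 (f v : C R) : (f * v + v * v / 2)^* = f^* * v^* + v^* * v^* / 2.
  by rewrite rmorphD /= conj_half !rmorphM.
have c2 : (ph z * rho z)^* = (ph z)^* * rho z by rewrite rmorphM /= chart_rho_conj.
rewrite hE c1 c2.
by move: (nu z)^* (rho z) rn (ph z)^* => v q q0 f; field.
Unshelve. all: by end_near. Qed.

(** On [D] the adjoint formula puts [Lhat] in the span of [L], [T], [Tb], [P], where the pairings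
    are its coordinates. Both sides being smooth, the equality extends to [U]. *)
Lemma Lhat_expansion z : U z -> Lhat z = (- pp z) *: L z + (lTb z * (rho z)^-1) *: T z
  + (lT z * (rho z)^-1) *: Tb z + (- l0 z) *: P.
Proof.
move=> Uz; apply/rowP => j; apply/eqP; rewrite -subr_eq0; apply/eqP.
pose E z := (- pp z) *: L z + (lTb z * (rho z)^-1) *: T z
  + (lT z * (rho z)^-1) *: Tb z + (- l0 z) *: P.
have srV : smoothC U (fun w => (rho w)^-1).
  exact: (smoothCV oU (@chart_rho_neq0 _ _ _ _ hx _ hc) (chart_smooth_rho hx hc)).
have sE : smoothV U E.
  apply: (smoothVD oU (smoothVD oU (smoothVD oU _ _) _) _).
  - exact: (smoothVZ oU (smoothCN oU sp) (chart_smooth_L hx hc)).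
  - exact: (smoothVZ oU (smoothCM oU slTb srV) (chart_smooth_T hx hc)).
  - exact: (smoothVZ oU (smoothCM oU slT srV) (chart_smooth_Tb hx hc)).
  - exact: (smoothVZ oU (smoothCN oU sl0) (smoothV_cst oU P)).
have sF := smoothCD oU (smooth_Lhat j) (smoothCN oU (sE j)).
apply: (closed_zero oU (fun w h => h) sF _ Uz) => w Dw Uw.
have [r r0 [FE [h1 h2 h3 h4]]] := adj_pairings Dw.
have rn := chart_rho_neq0 hx hc Uw.
have -> : Lhat w = r^-1 *: (r *: Lhat w) by rewrite scalerA mulVf// scale1r.
rewrite -FE /E.
have -> : lTb w = (nu w)^* * rho w / r by rewrite -h3 mulrC mulKf.
have -> : lT w = nu w * rho w / r by rewrite -h2 mulrC mulKf.
have -> : l0 w = - (2 * rho w) / r by rewrite -h1 mulrC mulKf.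
have -> : pp w = - (nu w * (nu w)^* / 2) / r by rewrite -h4 mulrC mulKf.
move: (L w) (T w) (Tb w) P (nu w) (nu w)^* (rho w) rn => v1 v2 v3 v4 v vb q q0.
by rewrite !mxE; field; rewrite r0 q0.
Qed.

(** [Lhat] is a light vector; this is its vanishing square in the coordinates of
    [Lhat_expansion]. *)
Lemma pairings_null z : U z -> lTb z * lT z = rho z * (pp z * l0 z).
Proof.
move=> Uz; have rn := chart_rho_neq0 hx hc Uz.
have [_ _ _ _ h] := chart4 (- pp z) (lTb z * (rho z)^-1) (lT z * (rho z)^-1) (- l0 z) Uz.
rewrite -(Lhat_expansion Uz) in h.
have LL : mink (Lhat z) (Lhat z) = 0.
  by rewrite /Lhat mink_cvec light_null (inv_stereo_sphere (xhat _)) subrr.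
rewrite LL in h.
move: h; move: (lTb z) (lT z) (rho z) (pp z) (l0 z) rn => u v q p l q0 /esym/eqP.
rewrite mulf_eq0 pnatr_eq0 /= => /eqP h.
apply/eqP; rewrite -subr_eq0; apply/eqP.
have -> : u * v - q * (p * l) = q * (u * q^-1 * (v * q^-1) * q - - p * - l) by field.
by rewrite h mulr0.
Qed.

(** Pairing the formula for [xhat] with the null vector [x_z] leaves [xhat . x_z = - g], which
    dictates this choice. *)
Definition hat_form z : option (C R) :=
  omap (fun v => - dot (cvec v) (imm_z X z)) (xhat (chart_inv c z)).

Lemma hat_infinite z : xhat (chart_inv c z) = None ->
  [/\ pp z = 0, l0 z = -1 & lTb z = 0].
Proof.
move=> xN; have [[_ _ _ LP] [_ [_ TbP PP]]] := chart_pairings hx hc.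
have E : Lhat z = P by rewrite /Lhat /yhat xN light_stereo_oo cvec_mk3 toC1 /cvec map_mx0.
by rewrite /pp /l0 /lTb E PP !(minkC P) LP TbP.
Qed.

Lemma hat_finite z v : xhat (chart_inv c z) = Some v ->
  [/\ pp z != 0, lT z = pp z * (b z - dot (cvec v) (imm_z X z)),
      lTb z = pp z * (b z - dot (cvec v) (imm_z X z))^* &
      Lhat z = - pp z *: cvec (xt v)].
Proof.
move=> xv; pose m := toC (2 / (dot v v + 1)).
have m0 : m != 0.
  apply/eqP => /(congr1 (@re R)) /= /eqP; rewrite mulf_eq0 pnatr_eq0 invr_eq0 /=.
  by rewrite (negbTE (dot1_neq0 v)).
have E : Lhat z = m *: cvec (xt v) by rewrite /Lhat /yhat xv light_stereo cvecZ.
have xP : mink (cvec (xt v)) P = -1 by rewrite cvec_xt mink_mk3 dot0r; field.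
have pE : pp z = - m by rewrite /pp E minkZl xP mulrN1.
have xT : mink (cvec (xt v)) (T z) = - (b z - dot (cvec v) (imm_z X z)).
  by rewrite cvec_xt mink_mk3; field.
have xTb : mink (cvec (xt v)) (Tb z) = - (b z - dot (cvec v) (imm_z X z))^*.
  have cc : (b z - dot (cvec v) (imm_z X z))^* = (b z)^* - dot (cvec v) (vconj (imm_z X z)).
    by rewrite rmorphB /= conj_dot vconj_cvec.
  by rewrite cc (lift_zbE X z) cvec_xt mink_mk3; field.
split.
- by rewrite pE oppr_eq0.
- by rewrite /lT E minkZl xT pE mulrN mulNr.
- by rewrite /lTb E minkZl xTb pE mulrN mulNr.
- by rewrite pE opprK.
Qed.

Lemma hat_formula z v : U z -> xhat (chart_inv c z) = Some v ->
  let a := - dot (cvec v) (imm_z X z) in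
  cvec v = loc c x z - ((dot (loc c x z) (Dzb (loc c x) z) + a^*) /
           dot (Dz (loc c x) z) (Dzb (loc c x) z)) *: Dz (loc c x) z
        - ((dot (loc c x z) (Dz (loc c x) z) + a) /
           dot (Dz (loc c x) z) (Dzb (loc c x) z)) *: Dzb (loc c x) z.
Proof.
move=> Uz xv a; have rn := chart_rho_neq0 hx hc Uz.
have [p0 eT eTb eL] := hat_finite xv.
have bb := supp_conj X z.
have E := Lhat_expansion Uz; rewrite eT eTb eL in E.
apply: etrans (esym (subZ2 _ _ _ _ _)); rewrite (chart_Dzb_x hx hc Uz).
have cD : (b z + a)^* = (b z)^* + a^* by exact: rmorphD.
suff H : cvec v = cvec (X z) + - ((b z + a)^* / rho z) *: imm_z X z +
    - ((b z + a) / rho z) *: vconj (imm_z X z).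
  by rewrite cD bb in H; exact: H.
have TbE := lift_zbE X z; rewrite TbE in E.
rewrite -/a cvec_xt in E; move/mk3_cmb in E.
have -> : cvec v = (- pp z)^-1 *: (- pp z *: cvec v) by rewrite scalerA mulVf ?oppr_eq0// scale1r.
rewrite E; move: (b z + a) (b z + a)^* (pp z) p0 (rho z) rn (vconj (imm_z X z)) (imm_z X z) (cvec (X z)).
move=> q q' p p0 r r0 v1 v2 v3.
by apply/rowP => j; rewrite !mxE; field; rewrite p0 r0.
Qed.

Lemma smooth_near_neq0 (F : C R -> C R) (V : set (C R)) z : open V -> smoothC V F -> V z ->
  F z != 0 -> exists2 d : R, 0 < d & nball z d `<=` V /\ forall w, nball z d w -> F w != 0.
Proof.
move=> oV sF Vz F0; have n0 := n1_gt0 F0.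
have [d1 d10 dh] := (contCP _ _).1 (smoothC_cont sF Vz) _ n0.
have [d d0 dV] := nbhs_nball (open_near oV Vz).
exists (Num.min d d1); first by rewrite lt_min d0.
split=> w; rewrite /nball /= lt_min => /andP[w1 w2]; first exact: dV.
by apply: contraTneq (dh _ w2) => ->; rewrite sub0r n1N ltxx.
Qed.

Lemma near_fin_holo (gc : C R -> option (C R)) (G : C R -> C R) w :
  (\forall u \near w, gc u = Some (G u)) -> derivable G w 1 -> fin_holo_at gc w.
Proof.
move=> nE dG; split; first by rewrite (nbhs_singleton nE).
have hf : {near w, G =1 fin gc} by apply: filterS nE => u uE; rewrite /fin uE.
exact: near_eq_derivable hf dG.
Qed.

(** Where [pp] is nonzero, [a = lT / pp] equals [b + g] and is smooth. On [D] it is [1 / h], so that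
    [a_zbar = rho = b_zbar] there; the equation for [g = a - b] then extends off [D]. *)
Lemma hat_finite_holo z : U z -> pp z != 0 -> \forall w \near z, fin_holo_at hat_form w.
Proof.
move=> Uz p0; have [d d0 [VU pV]] := smooth_near_neq0 oU sp Uz p0.
pose V := nball z d; have oV : open V := @open_nball R z d.
pose a w := lT w * (pp w)^-1.
have spV : smoothC V pp := smoothC_sub VU sp.
have sa : smoothC V a := smoothCM oV (smoothC_sub VU slT) (smoothCV oV pV spV).
pose G w := a w + - b w.
have sG : smoothC V G := smoothCD oV sa (smoothCN oV (smoothC_sub VU (chart_smooth_supp hx hc))).
have ah w : D w -> V w -> hh w != 0 /\ a w = (hh w)^-1.
  move=> Dw Vw; have Uw := VU _ Vw; have [l0n _] := hh_nu Dw.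
  have rn := chart_rho_neq0 hx hc Uw.
  have e1 : hh w * a w = 1.
    rewrite /hh /a; have := pairings_null Uw.
    move: (lTb w) (lT w) (pp w) (pV w Vw) (l0 w) l0n (rho w) rn => u v q q0 l ln k kn h.
    have -> : u * (k * l)^-1 * (v * q^-1) = (u * v) / (k * (q * l)) by field; rewrite q0 ln kn.
    by rewrite h mulfV// !mulf_neq0.
  have h0 : hh w != 0 by apply: contra_eq_neq e1 => ->; rewrite mul0r eq_sym oner_neq0.
  by split=> //; apply: (mulfI h0); rewrite e1 mulfV.
have dG0 : forall w, V w -> dzb G w = 0.
  apply: (closed_zero oV VU (smoothC_dzb oV sG)) => w Dw Vw.
  have Uw := VU _ Vw; have [h0 aE] := ah w Dw Vw.
  have nE : \forall u \near w, (hh u)^-1 = a u.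
    have h1 := open_near oD Dw; have h2 := open_near oV Vw.
    by apply: filterS2 h1 h2 => u Du Vu; exact: esym (ah u Du Vu).2.
  have da := isD_ext nE (isDV h0 (isD_hh Dw)).
  have dG := isDD da (isDN (chart_isD_supp hx hc Uw)).
  rewrite -/G in dG; rewrite (isD_dzb dG).
  by move: (hh w) h0 (rho w) => h h1 k; field.
have holo w : V w -> derivable G w 1.
  by move=> Vw; have [] := smoothC_holomorphic oV sG dG0 Vw.
have gE w : V w -> hat_form w = Some (G w).
  move=> Vw; have pw := pV w Vw; rewrite /hat_form.
  case xw : (xhat (chart_inv c w)) => [v|] /=; last first.
    by have [p1 _ _] := hat_infinite xw; rewrite p1 eqxx in pw.
  have [_ eT _ _] := hat_finite xw; congr Some; rewrite /G /a eT.
  by move: (dot (cvec v) (imm_z X w)) (b w) (pp w) pw => q q' k k0; field.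
apply: filterS (nball_nbhs z d0) => w Vw; apply: near_fin_holo (holo w Vw).
by apply: filterS (open_near oV Vw) => u; exact: gE.
Qed.

(** At such a point [l0 = -1] and [h = 0], so [f = h / (1 - b h)] is smooth nearby. It is
    holomorphic, equals [1 / g] at finite points and vanishes at infinite ones, so [isolated_zeros]
    decides between the alternatives. *)
Lemma hat_infinite_dichotomy z : U z -> xhat (chart_inv c z) = None ->
  pole hat_form z \/ \forall w \near z, xhat (chart_inv c w) = None.
Proof.
move=> Uz xN; have [p0 l1 t0] := hat_infinite xN.
have l0n : l0 z != 0 by rewrite l1 oppr_eq0 oner_neq0.
have [d1 d10 [V1U lV1]] := smooth_near_neq0 oU sl0 Uz l0n.
pose V1 := nball z d1; have oV1 : open V1 := @open_nball R z d1.
have rlV w : V1 w -> rho w * l0 w != 0.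
  by move=> Vw; rewrite mulf_neq0 ?lV1//; exact: (chart_rho_neq0 hx hc (V1U _ Vw)).
have srl : smoothC V1 (fun w => rho w * l0 w).
  exact: (smoothCM oV1 (smoothC_sub V1U (chart_smooth_rho hx hc)) (smoothC_sub V1U sl0)).
have sh1 : smoothC V1 hh := smoothCM oV1 (smoothC_sub V1U slTb) (smoothCV oV1 rlV srl).
pose u w := 1 + - (b w * hh w).
have su1 : smoothC V1 u.
  apply: (smoothCD oV1 (smoothC_cst oV1 1)); apply: (smoothCN oV1).
  exact: (smoothCM oV1 (smoothC_sub V1U (chart_smooth_supp hx hc)) sh1).
have hz : hh z = 0 by rewrite /hh t0 mul0r.
have uz : u z != 0 by rewrite /u hz mulr0 oppr0 addr0 oner_neq0.
have [d d0 [VV1 uV]] := smooth_near_neq0 oV1 su1 (nball_center z d10) uz.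
pose V := nball z d; have oV : open V := @open_nball R z d.
have Vz : V z := nball_center z d0.
have VU : V `<=` U by move=> w /VV1/V1U.
have sh : smoothC V hh := smoothC_sub VV1 sh1.
(* The Riccati equation is known on [D] only, but its terms are smooth on [V]. *)
have dh0 : forall w, V w -> dzb hh w + rho w * (hh w * hh w) = 0.
  apply: (closed_zero oV VU) => [|w Dw Vw].
    apply: (smoothCD oV (smoothC_dzb oV sh)).
    exact: (smoothCM oV (smoothC_sub VU (chart_smooth_rho hx hc)) (smoothCM oV sh sh)).
  by rewrite (isD_dzb (isD_hh Dw)) addNr.
pose f w := hh w * (u w)^-1.
have sf : smoothC V f := smoothCM oV sh (smoothCV oV uV (smoothC_sub VV1 su1)).
have df0 : forall w, V w -> dzb f w = 0.
  move=> w Vw; have Uw := VU _ Vw.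
  have dh : isD hh w (dz hh w) (- (rho w * (hh w * hh w))).
    by rewrite -(addr0 (- _)) -(dh0 w Vw) addrC addrK; exact: smoothC_isD sh Vw.
  have du := isDD (isD_cst 1 w) (isDN (isDM (chart_isD_supp hx hc Uw) dh)).
  have df := isDM dh (isDV (uV w Vw) du).
  rewrite (isD_dzb df) -/(u w).
  have uE : b w * hh w = 1 - u w by rewrite /u; ring.
  move: (uV w Vw) uE; move: (u w) (b w) (hh w) (rho w) => k bb h q k0 kE.
  have -> : 0 + - (q * h + bb * - (q * (h * h))) = - (q * h * (1 - bb * h)) by ring.
  by rewrite kE; field.
have holo w : V w -> derivable f w 1.
  by move=> Vw; have [] := smoothC_holomorphic oV sf df0 Vw.
have gS w : V w -> hat_form w <> None -> f w != 0 /\ hat_form w = Some (f w)^-1.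
  move=> Vw; have Uw := VU _ Vw; rewrite /hat_form.
  case xw : (xhat (chart_inv c w)) => [v|] //= _.
  have [pw eT _ _] := hat_finite xw.
  have := pairings_null Uw; have rl := rlV w (VV1 _ Vw); have un := uV w Vw.
  move: un; rewrite /f /u /hh eT.
  move: rl; rewrite mulf_eq0 negb_or => /andP[rn ln].
  move: (dot (cvec v) (imm_z X w)) (b w) (pp w) pw (lTb w) (rho w) rn (l0 w) ln.
  move=> q bb p pn t k kn l ln un H.
  (* At finite points [pairings_null] says [h * (b + g) = 1] with [g = - q]. Hence [1 - b h = g h]
     and [f = 1 / g]. *)
  have ha : t * (k * l)^-1 * (bb - q) = 1.
    have -> : t * (k * l)^-1 * (bb - q) = t * (p * (bb - q)) / (k * (p * l)) by field; rewrite pn ln kn.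
    by rewrite H mulfV// !mulf_neq0.
  have uE : 1 + - (bb * (t * (k * l)^-1)) = - q * (t * (k * l)^-1).
    by rewrite -[X in X + _]ha; ring.
  have h0 : t * (k * l)^-1 != 0 by apply: contra_eq_neq ha => ->; rewrite mul0r eq_sym oner_neq0.
  rewrite uE in un *; move: un; rewrite mulf_eq0 negb_or => /andP[q0 _].
  move: (t * (k * l)^-1) h0 => h h0.
  have -> : h * (- q * h)^-1 = (- q)^-1 by rewrite invfM mulrCA mulfV// mulr1.
  by rewrite invrK invr_eq0 q0.
have gN w : V w -> hat_form w = None -> xhat (chart_inv c w) = None /\ f w = 0.
  move=> Vw; rewrite /hat_form; case xw : (xhat (chart_inv c w)) => [v|] //= _.
  by have [_ _ t1] := hat_infinite xw; rewrite /f /hh t1 !mul0r.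
have fz : f z = 0 by rewrite /f hz mul0r.
have nholo : \forall w \near z, derivable f w 1.
  by apply: filterS (nball_nbhs z d0) => w; exact: holo.
have [f0|fn] := isolated_zeros nholo.
- right; apply: filterS2 f0 (nball_nbhs z d0) => w fw Vw.
  case E : (hat_form w) => [a|]; last by have [] := gN w Vw E.
  by have [] := gS w Vw; rewrite ?E// fw eqxx.
- left; have gz : hat_form z = None by rewrite /hat_form xN.
  have [e e0 eV] := nbhs_nball (filterI fn (nball_nbhs z d0)).
  have gE w : nball z e w -> w != z -> hat_form w = Some (f w)^-1.
    move=> ew wz; have [fw Vw] := eV w ew; have := fw wz.
    case E : (hat_form w) => [a|]; first by have [] := gS w Vw; rewrite ?E.
    by have [_ ->] := gN w Vw E; rewrite eqxx.
  split=> //.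
  + have H : \forall w \near z, w != z -> fin_holo_at hat_form w.
      apply: filterS (nball_nbhs z e0) => w ew wz; have [fw Vw] := eV w ew.
      apply: (near_fin_holo (G := fun v => (f v)^-1)); last by apply: cderivableV; [exact: fw|exact: holo].
      have h2 : \forall v \near w, v != z.
        apply/nbhsCP; exists (n1 (w - z)); first by apply: n1_gt0; rewrite subr_eq0.
        by move=> v; apply: contraTneq => ->; rewrite n1_sym ltxx.
      by apply: filterS2 (open_near (@open_nball R z e) ew) h2 => v; exact: gE.
    exact: H.
  (* The bound to beat may be zero or negative; [|B| + 1] is a positive substitute whose inverse
     controls [f]. *)
  + move=> B; have B0 : 0 < (`|B| + 1)^-1 by rewrite invr_gt0; have := normr_ge0 B; lra.
    have [e1 e10 e1h] := (contCP _ _).1 (smoothC_cont sf Vz) _ B0.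
    have H : \forall w \near z, w != z -> toC B <= `|fin hat_form w|.
      apply: filterS2 (nball_nbhs z e0) (nball_nbhs z e10) => w ew w1 wz.
      have [fw Vw] := eV w ew; have f0 := fw wz.
      rewrite /fin (gE w ew wz) /= normfV.
      have := e1h w w1; rewrite fz subr0 => fs.
      have f1 : `|f w| <= toC (`|B| + 1)^-1 by rewrite (le_trans (norm_le_n1 _))// le_toC ltW.
      have Bp : 0 < toC (`|B| + 1) by rewrite -toC0 lt_toC; have := normr_ge0 B; lra.
      apply: (@le_trans _ _ (toC (`|B| + 1))).
        by rewrite le_toC; have := ler_norm B; lra.
      rewrite -[leLHS]invrK lef_pV2 ?posrE ?normr_gt0 ?invr_gt0//.
      by rewrite -fmorphV.
    exact: H.
Qed.

End FromAdjoint.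

(** * Change of charts and connectedness *)

Section Globalization.
Variables (R : realType) (M : riemannSurface R) (n : nat) (x : M -> 'rV[R]_n).

(** Since [g = - xhat . x_z] and [xhat] does not depend on the chart, the transformation rule is the
    chain rule for [x] along a holomorphic transition map. *)
Lemma hat_form_transition (xhat : M -> option 'rV[R]_n) : superconformal_minimal x ->
  is_form (hat_form x xhat).
Proof.
move=> hx c d hc hd p cp dp; rewrite /hat_form (chart_invK hc cp) (chart_invK hd dp).
case: (xhat p) => [v|] //=; congr Some.
have Uz : chart_img c (c p) by exists p.
have dUz : chart_img d (d p) by exists p.
have dt : derivable (transition c d) (c p) 1 by apply: (atlas_compat hc hd); exists p.
have dT : is_derive (c p) 1 (transition c d) (derive1 (transition c d) (c p)).
  by rewrite derive1E; exact: derivableP.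
have tE : transition c d (c p) = d p by rewrite /transition (chart_invK hc cp).
have od : open (chart_dom d) by case: (atlas_chart hd).
have nd : \forall q \near chart_inv c (c p), chart_dom d q.
  by rewrite (chart_invK hc cp); exact: open_nbhs_nbhs.
have nE : \forall w \near c p, loc d x (transition c d w) = loc c x w.
  apply: filterS (chart_inv_near hc Uz nd) => w dw.
  by rewrite /loc /transition (chart_invK hd dw).
have h : isDv (loc c x) (c p) (derive1 (transition c d) (c p) *: Dz (loc d x) (d p))
    ((derive1 (transition c d) (c p))^* *: Dzb (loc d x) (d p)).
  move=> j; rewrite !mxE -tE.
  have dUt : chart_img d (transition c d (c p)) by rewrite tE.
  have := isD_comp_holo (chart_open hd) (chart_smooth_x hx hd j) dUt dT.
  rewrite [dz _ _ * _]mulrC [dzb _ _ * _]mulrC; apply: isD_ext.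
  by apply: filterS nE => w ->.
have E := isDv_Dz h; rewrite [imm_z _ (c p)]E dotZr -mulrN mulrC.
by [].
Qed.

Let hat_infinite_at (xhat : M -> option 'rV[R]_n) (p : M) : Prop := \forall q \near p, xhat q = None.

Lemma hat_trichotomy (xhat : M -> option 'rV[R]_n) : superconformal_minimal x ->
  adjoint_transform_euclidean x xhat ->
  given_by_form x (hat_form x xhat) xhat /\
  forall c p, atlas c -> chart_dom c p ->
    [\/ \forall w \near c p, fin_holo_at (hat_form x xhat c) w,
        pole (hat_form x xhat c) (c p) |
        hat_infinite_at xhat p].
Proof.
move=> hx [_ sh _ [Uo [oUo dUo adj]]].
have chart_data c (hc : atlas c) : let D := c @` (chart_dom c `&` Uo) in
  [/\ open D, D `<=` chart_img c & forall z (Q : set (C R)), chart_img c z ->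
     (\forall w \near z, Q w) -> exists w, D w /\ Q w].
  move=> D; split.
  - rewrite openE => _ [p [cp Up] <-]; have Uz : chart_img c (c p) by exists p.
    have nU : \forall q \near chart_inv c (c p), (chart_dom c `&` Uo) q.
      rewrite (chart_invK hc cp); apply: open_nbhs_nbhs; split=> //.
      by apply: openI => //; case: (atlas_chart hc).
    apply: filterS2 (chart_inv_near hc Uz nU) (open_near (chart_open hc) Uz) => w Dw [q cq qw].
    by exists q => //; rewrite -qw (chart_invK hc cq) in Dw.
  - by move=> _ [p [cp _] <-]; exists p.
  - move=> _ Q [p cp <-] nQ; have := chart_near hc cp nQ; rewrite -nbhs_nearE nbhsE; case=> O [oO Op] OQ.
    have [q [Oq Uq]] := dUo O (ex_intro _ p Op) oO; have [cq Qq] := OQ q Oq.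
    by exists (c q); split=> //; exists q.
split.
- move=> c hc p cp; have Uz : chart_img c (c p) by exists p.
  have [Y [N [s [k [k' [mu [fr smu H]]]]]]] := adj c hc.
  have [oD DU dD] := chart_data c hc.
  have xE := congr1 xhat (chart_invK hc cp).
  have H' z (Dz : (c @` (chart_dom c `&` Uo)) z) := let: And3 h1 h2 _ := H z Dz in conj h1 h2.
  rewrite /= /hat_form xE; case xp : (xhat p) => [v|] //=; exists v => //; rewrite xp in xE.
  exact: (hat_formula hx hc (sh c hc) DU dD fr H' Uz xE).
- move=> c p hc cp; have Uz : chart_img c (c p) by exists p.
  have [Y [N [s [k [k' [mu [fr smu H]]]]]]] := adj c hc.
  have [oD DU dD] := chart_data c hc.
  have xE := congr1 xhat (chart_invK hc cp).
  have H' z (Dz : (c @` (chart_dom c `&` Uo)) z) := let: And3 h1 h2 _ := H z Dz in conj h1 h2.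
  case xp : (xhat p) => [v|]; rewrite xp in xE.
  + have [p0 _ _ _] := hat_finite x xE.
    by apply: Or31; exact: (hat_finite_holo hx hc (sh c hc) oD DU dD fr smu H' Uz p0).
  + have [h|h] := hat_infinite_dichotomy hx hc (sh c hc) oD DU dD fr smu H' Uz xE.
      exact: Or32.
    apply: Or33; apply: filterS (chart_near hc cp h) => q [cq].
    by rewrite (chart_invK hc cq).
Qed.

(** The set of points near which [xhat] is infinite is open by definition. It is closed because near
    a finite point, and near a pole except at the pole itself, [xhat] is finite. By connectedness it
    is empty or everything. *)
Lemma form_of_adjoint (xhat : M -> option 'rV[R]_n) : connected [set: M] ->
  superconformal_minimal x -> adjoint_transform_euclidean x xhat ->
  exists g : chart R M -> C R -> option (C R),
    (meromorphic_form g \/ infinite_form g) /\ given_by_form x g xhat.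
Proof.
move=> hM hx ad; exists (hat_form x xhat).
have [gf tri] := hat_trichotomy hx ad.
pose E := [set p : M | hat_infinite_at xhat p].
have xN c p : chart_dom c p -> atlas c -> hat_form x xhat c (c p) <> None -> xhat p <> None.
  by move=> cp hc; rewrite /hat_form (chart_invK hc cp) => h xp; rewrite xp in h.
have oE : open E by rewrite openE => p Ep; exact: nbhs_interior.
have cE : closed E.
  rewrite -openC openE => p nEp; have [c hc cp] := atlas_cover p.
  have notE q : xhat q <> None -> (~` E) q by move=> h Eq; exact: h (nbhs_singleton Eq).
  have [h|[_ h _]|//] := tri c p hc cp.
  - apply: filterS (chart_near hc cp h) => q [cq [hq _]]; apply: notE.
    exact: xN c q cq hc hq.
  - apply: filterS (chart_near hc cp (dnbhs_near h)) => q [cq hq].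
    (* The pole is the one nearby point where [xhat] is infinite; equal coordinates force [q = p],
       which lies outside [E] by assumption. *)
    have [qp|qp] := eqVneq (c q) (c p).
      by have := congr1 (chart_inv c) qp; rewrite !chart_invK// => ->.
    by have [hq' _] := hq qp; apply: notE; exact: xN c q cq hc hq'.
split=> //; have [[p0 Ep0]|nE] := pselect (exists p, E p).
- right=> c hc z [p cp <-].
  have ET : E = [set: M].
    by apply: hM; [exists p0|exists E; rewrite ?setTI|exists E; rewrite ?setTI].
  have Ep : E p by rewrite ET.
  by rewrite /hat_form (chart_invK hc cp) (nbhs_singleton Ep).
- left; split; first exact: hat_form_transition.
  move=> c hc z [p cp <-]; have [h|h|h] := tri c p hc cp; [by left|by right|].
  by exfalso; apply: nE; exists p.
Qed.

End Globalization.

Theorem theorem6p2 (R : realType) (M : riemannSurface R) (n : nat)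
    (x : M -> 'rV[R]_n) (xhat : M -> option 'rV[R]_n)
    (hM : connected [set: M]) (hx : superconformal_minimal x) :
  adjoint_transform_euclidean x xhat <->
  exists g : chart R M -> C R -> option (C R),
    (meromorphic_form g \/ infinite_form g) /\ given_by_form x g xhat.
Proof.
split; first exact: form_of_adjoint.
by move=> [g [hg gf]]; exact: adjoint_of_form hx hg gf.
Qed.
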